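(* Let $g>0$, $\mu>0$, let $\bar\rho=\bar\rho(x_3)\in L^\infty(\mathbb{R})$ satisfy $\bar\rho'\in C_0^\infty(\mathbb{R})$, $\inf_{\mathbb{R}}\bar\rho>0$ and $\bar\rho'(x_3^0)>0$ for some $x_3^0$, and let $M$, $\mathcal A$, $\mathbb{A}^{\mathrm g}$ be as in the context. For each $\xi=(\xi_1,\xi_2)\in\mathbb{A}^{\mathrm g}$ there exist $\lambda=\lambda(\xi)>0$ and functions $(\varphi,\theta,\psi,\pi)=(\varphi,\theta,\psi,\pi)(\xi,x_3)$, all belonging to $H^\infty(\mathbb{R})=\bigcap_{k\ge0}H^k(\mathbb{R})$, solving the system $$\begin{cases}\lambda^2\bar\rho\varphi-\lambda\xi_1\pi+\lambda\mu(|\xi|^2\varphi-\varphi'')=M^2B_1,\\ \lambda^2\bar\rho\theta-\lambda\xi_2\pi+\lambda\mu(|\xi|^2\theta-\theta'')=M^2B_2,\\ \lambda^2\bar\rho\psi+\lambda\pi'+\lambda\mu(|\xi|^2\psi-\psi'')-g\bar\rho'\psi=M^2B_3,\\ \xi_1\varphi+\xi_2\theta+\psi'=0\end{cases}$$ on $\mathbb{R}$ with $\varphi(\pm\infty)=\theta(\pm\infty)=\psi(\pm\infty)=0$, where $(B_1,B_2,B_3)=(0,\ \xi_1\xi_2\varphi-\xi_1^2\theta,\ -(\xi_1^2\psi+\xi_1\varphi'))$ in the horizontal case and $(B_1,B_2,B_3)=(\varphi''+\xi_1\psi',\ \theta''+\xi_2\psi',\ 0)$ in the vertical case. Moreover $\psi\in\mathcal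 A$.
   Context: $'=d/dx_3$. $M_{\mathrm c}:=\sqrt{\sup_{\psi\in H^1(\mathbb{R}),\psi\not\equiv0}\int g\bar\rho'\psi^2dx_3/\int|\psi'|^2dx_3}\in(0,\infty]$. Horizontal case ($\bar{\mathbf M}=M\mathbf e_1$): $M\neq0$ constant; for $0<|M\xi_1|/|\xi|<M_{\mathrm c}$, $S(\xi):=\sqrt{\sup_{\psi\in H^1,\psi\not\equiv0}(g|\xi|^2\int\bar\rho'\psi^2/(M\xi_1)^2-\int|\psi'|^2)/\int|\psi|^2}$; $\mathbb{A}^{\mathrm g}:=(\{\xi:|\xi_1M|/|\xi|\in(0,M_{\mathrm c}),|\xi|<S(\xi)\}\cup\{\xi_1=0\})\setminus\{\mathbf 0\}$. Vertical case ($\bar{\mathbf M}=M\mathbf e_3$): $M$ constant with $|M|\in(0,M_{\mathrm c})$; $\mathcal M_{\mathrm{vc}}:=\{\psi\in H^2:\int(g\bar\rho'\psi^2-M^2|\psi'|^2)>0\}$; $|\xi|^M_{\mathrm{vc}}:=\sqrt{\inf_{\psi\in\mathcal M_{\mathrm{vc}}}M^2\int|\psi''|^2/\int(g\bar\rho'\psi^2-M^2|\psi'|^2)}$; $\mathbb{A}^{\mathrm g}:=\{\xi:|\xi|>|\xi|^M_{\mathrm{vc}}\}$. $\mathcal A:=\{\psi\in H^2(\mathbb{R}):\int\bar\rho(|\xi|^2\psi^2+|\psi'|^2)dx_3=1\}$. *)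

(* Defs.v *)
From HB Require Import structures.
From mathcomp Require Import all_boot all_order all_algebra.
From mathcomp Require Import all_classical all_reals all_analysis.
Set Implicit Arguments. Unset Strict Implicit. Unset Printing Implicit Defensive.
Import Order.TTheory GRing.Theory Num.Theory.
Import numFieldNormedType.Exports.
Local Open Scope classical_set_scope.
Local Open Scope ring_scope.

Section Defs.
Variable R : realType.
Notation mu := (@lebesgue_measure R).

Definition smooth (f : R -> R) : Prop :=
  forall (n : nat) (x : R), derivable (derive1n n f) x 1.

Definition compact_support (f : R -> R) : Prop :=
  exists r : R, forall x, r < `|x| -> f x = 0.

Definition test_fun (f : R -> R) : Prop := smooth f /\ compact_support f.

Definition L2 (f : R -> R) : Prop :=
  measurable_fun setT f /\ mu.-integrable setT (fun x => (f x ^+ 2)%:E).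

(* g is a weak derivative of f (used only for L^2 functions f, g) *)
Definition weak_deriv (f g : R -> R) : Prop :=
  forall phi, test_fun phi ->
    (\int[mu]_x (f x * (derive1 phi) x)%:E = - \int[mu]_x (g x * phi x)%:E)%E.

Definition Hk_with (k : nat) (f : R -> R) (D : nat -> R -> R) : Prop :=
  D 0%N = f /\ (forall j, (j < k)%N -> weak_deriv (D j) (D j.+1)) /\
  (forall j, (j <= k)%N -> L2 (D j)).

Definition Hk (k : nat) (f : R -> R) : Prop := exists D, Hk_with k f D.

Definition Hinf_with (f : R -> R) (D : nat -> R -> R) : Prop :=
  forall k, Hk_with k f D.

Definition Int (f : R -> R) : \bar R := (\int[mu]_x EFin (f x))%E.

Definition nonzeroL2 (f : R -> R) : Prop := (0 < Int (fun x => (f x ^+ 2)%R))%E.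

(* square root on the extended reals (only used on [0, +oo]) *)
Definition esqrt (x : \bar R) : \bar R :=
  match x with
  | EFin r => EFin (Num.sqrt r)
  | +oo%E => +oo%E
  | -oo%E => -oo%E
  end.

Definition normxi (xi1 xi2 : R) : R := Num.sqrt (xi1 ^+ 2 + xi2 ^+ 2).

(* M_c in (0, +oo]; drho stands for rho-bar' *)
Definition Mc (g : R) (drho : R -> R) : \bar R :=
  esqrt (ereal_sup [set r | exists psi D, Hk_with 1 psi D /\ nonzeroL2 psi /\
     r = (Int (fun x => (g * drho x * psi x ^+ 2)%R) /
          Int (fun x => (D 1%N x ^+ 2)%R))%E]).

Definition S2 (g : R) (drho : R -> R) (M xi1 xi2 : R) : \bar R :=
  ereal_sup [set r | exists psi D, Hk_with 1 psi D /\ nonzeroL2 psi /\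
     r = ((EFin (g * (normxi xi1 xi2) ^+ 2 / (M * xi1) ^+ 2)%R *
              Int (fun x => (drho x * psi x ^+ 2)%R)
           - Int (fun x => (D 1%N x ^+ 2)%R)) / Int (fun x => (psi x ^+ 2)%R))%E].

Definition vc2 (g : R) (drho : R -> R) (M : R) : \bar R :=
  ereal_inf [set r | exists psi D, Hk_with 2 psi D /\
     (0 < Int (fun x => (g * drho x * psi x ^+ 2 - M ^+ 2 * D 1%N x ^+ 2)%R))%E /\
     r = (EFin (M ^+ 2)%R * Int (fun x => (D 2%N x ^+ 2)%R) /
          Int (fun x => (g * drho x * psi x ^+ 2 - M ^+ 2 * D 1%N x ^+ 2)%R))%E].
End Defs.

Inductive field_case := Horizontal | Vertical.

Section Defs2.
Variable R : realType.

Definition case_hyp (c : field_case) (g : R) (drho : R -> R) (M : R) : Prop :=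
  match c with
  | Horizontal => M != 0
  | Vertical => (0 < `|M|) /\ (EFin `|M|%R < Mc g drho)%E
  end.

Definition in_Ag (c : field_case) (g : R) (drho : R -> R) (M xi1 xi2 : R) : Prop :=
  match c with
  | Horizontal =>
      ((0 < `|M * xi1| / normxi xi1 xi2) /\
       (EFin (`|M * xi1| / normxi xi1 xi2)%R < Mc g drho)%E /\
       (EFin (normxi xi1 xi2) < esqrt (S2 g drho M xi1 xi2))%E
       \/ xi1 = 0) /\ ~ (xi1 = 0 /\ xi2 = 0)
  | Vertical => (esqrt (vc2 g drho M) < EFin (normxi xi1 xi2))%E
  end.

Definition B1 (c : field_case) (xi1 xi2 : R) (Dphi Dtheta Dpsi : nat -> R -> R) (x : R) : R :=
  match c with
  | Horizontal => 0
  | Vertical => Dphi 2%N x + xi1 * Dpsi 1%N x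
  end.
Definition B2 (c : field_case) (xi1 xi2 : R) (Dphi Dtheta Dpsi : nat -> R -> R) (x : R) : R :=
  match c with
  | Horizontal => xi1 * xi2 * Dphi 0%N x - xi1 ^+ 2 * Dtheta 0%N x
  | Vertical => Dtheta 2%N x + xi2 * Dpsi 1%N x
  end.
Definition B3 (c : field_case) (xi1 xi2 : R) (Dphi Dtheta Dpsi : nat -> R -> R) (x : R) : R :=
  match c with
  | Horizontal => - (xi1 ^+ 2 * Dpsi 0%N x + xi1 * Dphi 1%N x)
  | Vertical => 0
  end.

Definition in_calA (rho : R -> R) (xi1 xi2 : R) (psi : R -> R) (D : nat -> R -> R) : Prop :=
  Hk_with 2 psi D /\
  Int (fun x => (rho x * ((normxi xi1 xi2) ^+ 2 * psi x ^+ 2 + D 1%N x ^+ 2))%R) = 1%E.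
End Defs2.

(* Main.v *)
(** Take xi_2 phi = xi_1 theta, so that phi = - xi_1 psi' / |xi|^2 and
    theta = - xi_2 psi' / |xi|^2, and read off pi from the horizontal momentum. What remains is
    the Euler-Lagrange equation of the form
      Q_l (psi) = l^2 J (psi) + l mu V (psi) + E (psi),
    with J (psi) = int rho (|xi|^2 psi^2 + psi'^2), V (psi) = int (psi''^2 + 2 |xi|^2 psi'^2 + |xi|^4 psi^2)
    and E = magnetic energy - g |xi|^2 int rho' psi^2. That xi lies in A^g says exactly that E is
    negative somewhere on H^1 or H^2; by mollification and truncation it is then negative at a test
    function. Let l be the supremum of the growth rates for which Q_l takes a negative value: Q_l is
    nonnegative, and test functions f_n normalized by int rho' f_n^2 = 1 with Q_l (f_n) -> 0 are bounded
    in H^2. As rho' has compact support, a locally uniform limit psi of the f_n satisfies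
    int rho' psi^2 = 1, and it is a bounded Lipschitz distributional solution of the Euler-Lagrange
    equation. By du Bois-Reymond psi is smooth. Outside the support of rho' the equation has constant
    coefficients and factors as (D^2 - |xi|^2)(D^2 - tau^2) psi = 0, so the bounded solution psi decays
    exponentially with all its derivatives. *)
Require Import Defs.
From HB Require Import structures.
From mathcomp Require Import all_boot all_order all_algebra.
From mathcomp Require Import all_classical all_reals all_analysis.
From mathcomp Require Import measurable_realfun ring lra.
Import Order.TTheory GRing.Theory Num.Theory.
Import numFieldNormedType.Exports.
Local Open Scope classical_set_scope.
Local Open Scope ring_scope.
Set Implicit Arguments. Unset Strict Implicit. Unset Printing Implicit Defensive.

(** * Smooth functions and test functions *)

Section SmoothFunctions.
Context {R : realType}.
Implicit Types (f g h : R -> R).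

(** The rate enters the equation quadratically through inertia and linearly through viscosity, so
    minimizing at the unknown rate is circular; a supremum breaks the circle. It is finite because J
    controls int rho' f^2, and Q_l is nonnegative there because negativity would survive a small
    increase of l. The line is not compact, so almost minimizers could spread out or escape.
    Negativity forces int rho' f^2 > 0, and fixing this integral, which sees only a bounded
    interval, prevents the limit from vanishing. No weak compactness is used: Sobolev bounds make
    the f_n bounded and equi-Lipschitz, and an ultrafilter selects the limit. Square integrability
    of psi is recovered only afterwards from its tails, where just psi and psi' are known to be
    bounded. Both field directions share one form, with magnetic weights e2, e1, e0 of f''^2, f'^2,
    f^2 linked by e2 |xi|^4 + e0 = e1 |xi|^2; this relation is what makes the equation factor
    outside the support of rho'. *)

Definition has_deriv f g := forall x : R, is_derive x (1 : R) f (g x).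
Lemma has_deriv_derive1 f g : has_deriv f g -> derive1 f = g.
Proof. by move=> fg; apply/funext => x; rewrite derive1E; case: (fg x). Qed.
Lemma has_derivP f : (forall x, derivable f x 1) -> has_deriv f (derive1 f).
Proof. by move=> df x; rewrite derive1E; exact/derivableP. Qed.
Lemma has_deriv_derivable f g : has_deriv f g -> forall x, derivable f x 1.
Proof. by move=> fg x; case: (fg x). Qed.
Lemma has_deriv_eq f g h : has_deriv f g -> (forall x, g x = h x) -> has_deriv f h.
Proof. by move=> fg gh x; rewrite -gh. Qed.
Lemma has_deriv_continuous f g : has_deriv f g -> continuous f.
Proof. by move=> fg x; apply: differentiable_continuous; apply/derivable1_diffP; exact: (has_deriv_derivable fg). Qed.
Lemma has_derivD f f' g g' : has_deriv f f' -> has_deriv g g' ->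
  has_deriv (fun x => f x + g x) (fun x => f' x + g' x).
Proof. by move=> ff gg x; exact: is_deriveD. Qed.
Lemma has_derivN f f' : has_deriv f f' -> has_deriv (fun x => - f x) (fun x => - f' x).
Proof. by move=> ff x; exact: is_deriveN. Qed.
Lemma has_derivB f f' g g' : has_deriv f f' -> has_deriv g g' ->
  has_deriv (fun x => f x - g x) (fun x => f' x - g' x).
Proof. by move=> ff gg x; exact: is_deriveB. Qed.
Lemma has_derivM f f' g g' : has_deriv f f' -> has_deriv g g' ->
  has_deriv (fun x => f x * g x) (fun x => f' x * g x + f x * g' x).
Proof.
move=> ff gg x; have := is_deriveM (ff x) (gg x).
by move/is_derive_eq; apply; rewrite addrC; congr (_ + _); exact: mulrC.
Qed.
Lemma has_deriv_cst (c : R) : has_deriv (fun _ => c) (fun _ => 0).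
Proof. by move=> x; exact: is_derive_cst. Qed.
Lemma has_deriv_id : has_deriv (fun x => x) (fun _ => 1).
Proof. by move=> x; exact: is_derive_id. Qed.
Lemma has_derivZ (c : R) f f' : has_deriv f f' -> has_deriv (fun x => c * f x) (fun x => c * f' x).
Proof. by move=> ff x; exact: is_deriveZ. Qed.
Lemma has_deriv_comp f f' g g' : has_deriv f f' -> has_deriv g g' ->
  has_deriv (fun x => f (g x)) (fun x => f' (g x) * g' x).
Proof.
move=> ff gg x; exact: (@is_derive1_comp R f g x (f' (g x)) (g' x) (ff _) (gg _)).
Qed.
Lemma has_deriv_affine (a b : R) f f' : has_deriv f f' ->
  has_deriv (fun x => f (a * x + b)) (fun x => a * f' (a * x + b)).
Proof.
move=> ff; have := has_deriv_comp ff (has_derivD (has_derivZ a has_deriv_id) (has_deriv_cst b)).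
by move/has_deriv_eq; apply => x; rewrite addr0 mulr1 mulrC.
Qed.
(* Sealed versions of [smooth] and [test_fun]: unfolding these to products makes
   unification in [exact:] and [//] very slow. *)
Variant cinf f : Prop := Cinf of smooth f.
Variant ctest f : Prop := Ctest of cinf f & compact_support f.
Lemma ctestP f : test_fun f <-> ctest f.
Proof. by split=> [[sf cf]|[[sf] cf]]. Qed.
Lemma smoothP f : cinf f <-> exists2 g, has_deriv f g & cinf g.
Proof.
split=> [[sf]|[g fg [sg]]].
  exists (derive1 f); first by apply: has_derivP => x; exact: (sf 0%N).
  by split => n x; have := sf n.+1 x; rewrite derive1Sn.
split=> -[|n] x; first exact: (has_deriv_derivable fg).
by rewrite derive1Sn (has_deriv_derive1 fg); exact: sg.
Qed.
Lemma smooth_has_deriv f : cinf f -> has_deriv f (derive1 f).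
Proof. by move=> /smoothP[g fg _]; rewrite (has_deriv_derive1 fg). Qed.
Lemma smooth_derive1 f : cinf f -> cinf (derive1 f).
Proof. by move=> /smoothP[g fg ?]; rewrite (has_deriv_derive1 fg). Qed.
Lemma smooth_derive1n n f : cinf f -> cinf (derive1n n f).
Proof. by move=> sf; elim: n => // n IH; exact: smooth_derive1. Qed.
Lemma smooth_continuous f : cinf f -> continuous f.
Proof. by move=> /smooth_has_deriv/has_deriv_continuous. Qed.
(** Coinduction: smoothness follows from naming a class stable under differentiation, without
    formulas for higher derivatives. *)
Lemma smooth_coind (P : (R -> R) -> Prop) :
  (forall f, P f -> exists2 g, has_deriv f g & P g) -> forall f, P f -> cinf f.
Proof.
move=> H f Pf; split=> n; elim: n f Pf => [|n IH] f Pf x; have [g fg Pg] := H _ Pf.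
  exact: (has_deriv_derivable fg).
by rewrite derive1Sn (has_deriv_derive1 fg); exact: IH.
Qed.
Lemma smooth_cst (c : R) : cinf (fun _ => c).
Proof.
apply: (@smooth_coind (fun f => exists c, f = (fun _ => c))); last by exists c.
by move=> _ [d ->]; exists (fun _ => 0); [exact: has_deriv_cst|exists 0].
Qed.
Lemma smoothD f g : cinf f -> cinf g -> cinf (fun x => f x + g x).
Proof.
move=> sf sg; apply: (@smooth_coind (fun h => exists f g,
  [/\ cinf f, cinf g & h = fun x => f x + g x])); last by exists f, g.
move=> _ [{}f [{}g [{}sf {}sg ->]]]; exists (fun x => derive1 f x + derive1 g x).
  by apply: has_derivD; exact: smooth_has_deriv.
by exists (derive1 f), (derive1 g); split=> //; exact: smooth_derive1.
Qed.
(** Products alone are not stable under differentiation, so coinduction gives way to induction on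
    the order: the derivative is a sum of two products, each covered by the induction hypothesis.
    Splitting the iterated derivative of that sum ([E]) uses derivability at every order up to [n],
    hence the strong form. *)
Lemma smoothM f g : cinf f -> cinf g -> cinf (fun x => f x * g x).
Proof.
move=> sf sg; split=> n; elim: n {-2}n (leqnn n) f g sf sg => [|n IH] m mn f g sf sg x.
  move: mn; rewrite leqn0 => /eqP->; apply: has_deriv_derivable.
  by apply: has_derivM; exact: smooth_has_deriv.
case: m mn => [|m] mn.
  by apply: has_deriv_derivable; apply: has_derivM; exact: smooth_has_deriv.
rewrite derive1Sn (has_deriv_derive1 (has_derivM (smooth_has_deriv sf) (smooth_has_deriv sg))).
have H1 := IH _ _ _ _ (smooth_derive1 sf) sg; have H2 := IH _ _ _ _ sf (smooth_derive1 sg).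
have E : forall j, (j <= n)%N -> 
   derive1n j (fun x => derive1 f x * g x + f x * derive1 g x) =
   fun x => derive1n j (fun x => derive1 f x * g x) x + derive1n j (fun x => f x * derive1 g x) x.
  elim=> // j IHj jn; rewrite derive1nS IHj ?(ltnW jn)//.
  apply: has_deriv_derive1; apply: has_derivD; apply: has_derivP => y.
    by apply: H1; rewrite ltnW.
  by apply: H2; rewrite ltnW.
rewrite E//; apply: derivableD; [exact: H1|exact: H2].
Qed.
Lemma smoothZ (c : R) f : cinf f -> cinf (fun x => c * f x).
Proof. by move=> sf; apply: smoothM => //; exact: smooth_cst. Qed.
Lemma smoothN f : cinf f -> cinf (fun x => - f x).
Proof.
move=> sf; have := @smoothZ (-1) _ sf.
by rewrite (_ : (fun x => -1 * f x) = (fun x => - f x))//; apply/funext => x; rewrite mulN1r.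
Qed.
Lemma smoothB f g : cinf f -> cinf g -> cinf (fun x => f x - g x).
Proof. by move=> sf sg; apply: smoothD => //; exact: smoothN. Qed.
Lemma smooth_affine (a b : R) f : cinf f -> cinf (fun x => f (a * x + b)).
Proof.
move=> sf; apply: (@smooth_coind (fun h => exists c f,
  cinf f /\ h = fun x => c * f (a * x + b))); last first.
  by exists 1, f; split=> //; apply/funext => x; rewrite mul1r.
move=> _ [c [{}f [{}sf ->]]]; exists (fun x => c * a * derive1 f (a * x + b)).
  have := has_derivZ c (has_deriv_affine a b (smooth_has_deriv sf)).
  by move/has_deriv_eq; apply => x; rewrite mulrA.
by exists (c * a), (derive1 f); split => //; exact: smooth_derive1.
Qed.
Lemma derive1nD n f g : cinf f -> cinf g ->
  derive1n n (fun x => f x + g x) = fun x => derive1n n f x + derive1n n g x.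
Proof.
move=> sf sg; elim: n => // n IH; rewrite derive1nS IH; apply: has_deriv_derive1.
by apply: has_derivD; apply: smooth_has_deriv; exact: smooth_derive1n.
Qed.
Lemma derive1nZ n c f : cinf f ->
  derive1n n (fun x => c * f x) = fun x => c * derive1n n f x.
Proof.
move=> sf; elim: n => // n IH; rewrite derive1nS IH; apply: has_deriv_derive1.
by apply: has_derivZ; apply: smooth_has_deriv; exact: smooth_derive1n.
Qed.
Lemma has_deriv_zero_out f g (r : R) : has_deriv f g ->
  (forall x, r < `|x| -> f x = 0) -> forall x, r < `|x| -> g x = 0.
Proof.
move=> fg f0 x rx; apply/esym.
suff H : is_derive x (1:R) f 0 by case: (H) => _ <-; case: (fg x) => _ <-.
have := @has_deriv_cst 0 x; apply: near_eq_is_derive.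
near=> y; apply/esym; rewrite f0//; near: y.
have : \forall y \near x, r < `|y|.
  have /cvgr_gt := @norm_continuous _ R x; exact.
by [].
Unshelve. all: by end_near. Qed.
Lemma test_derive1 f : ctest f -> ctest (derive1 f).
Proof.
move=> [sf [r fr]]; split; first exact: smooth_derive1.
by exists r; apply: has_deriv_zero_out fr; exact: smooth_has_deriv.
Qed.
Lemma test_derive1n n f : ctest f -> ctest (derive1n n f).
Proof. by move=> tf; elim: n => // n IH; exact: test_derive1. Qed.
Lemma csuppD f g : compact_support f -> compact_support g -> compact_support (fun x => f x + g x).
Proof.
move=> [r fr] [s gs]; exists (Num.max r s) => x; rewrite gt_max => /andP[rx sx].
by rewrite fr// gs// addr0.
Qed.
Lemma csuppMl f g : compact_support f -> compact_support (fun x => f x * g x).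
Proof. by move=> [r fr]; exists r => x /fr ->; rewrite mul0r. Qed.
Lemma csuppMr f g : compact_support g -> compact_support (fun x => f x * g x).
Proof. by move=> [r fr]; exists r => x /fr ->; rewrite mulr0. Qed.
Lemma testD f g : ctest f -> ctest g -> ctest (fun x => f x + g x).
Proof. by move=> [sf cf] [sg cg]; split; [exact: smoothD|exact: csuppD]. Qed.
Lemma testMl f g : ctest f -> cinf g -> ctest (fun x => f x * g x).
Proof. by move=> [sf cf] sg; split; [exact: smoothM|exact: csuppMl]. Qed.
Lemma testMr f g : cinf f -> ctest g -> ctest (fun x => f x * g x).
Proof. by move=> sf [sg cg]; split; [exact: smoothM|exact: csuppMr]. Qed.
Lemma testZ (c : R) f : ctest f -> ctest (fun x => c * f x).
Proof. by move=> tf; apply: testMr => //; exact: smooth_cst. Qed.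
Lemma test_affine (a b : R) f : a != 0 -> ctest f -> ctest (fun x => f (a * x + b)).
Proof.
move=> a0 [sf [r fr]]; split; first exact: smooth_affine.
exists ((`|r| + `|b|) / `|a|) => x; rewrite ltr_pdivrMr ?normr_gt0// => H.
apply: fr; have := ler_normB (a * x + b) b; rewrite addrK normrM mulrC => H2.
have := ler_norm r; lra.
Qed.
End SmoothFunctions.

(* Otherwise unification unfolds [derive1] down to limits of difference quotients. *)
Opaque derive1.

(** * Integrals of real functions *)

(* Locked: comparing integrals up to conversion is otherwise prohibitively slow. *)
HB.lock Definition RI (R : realType) (f : R -> R) : R := \int[@lebesgue_measure R]_x f x.
(** The oriented integral from [0] to [x]: for [x != 0] one of the two intervals is empty, so the
    sign of [x] needs no case distinction. *)
HB.lock Definition prim (R : realType) (f : R -> R) (x : R) : R :=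
  \int[@lebesgue_measure R]_(t in `[0, x]) f t - \int[@lebesgue_measure R]_(t in `[x, 0]) f t.
Section Integration.
Context {R : realType}.
Notation mu := (@lebesgue_measure R).
Implicit Types (f g h : R -> R).
Definition intgr f := mu.-integrable setT (EFin \o f).
Lemma RIE f : RI f = \int[mu]_x f x.
Proof. by rewrite RI.unlock. Qed.
Lemma cont_measurable f : continuous f -> measurable_fun setT f.
Proof. exact: continuous_measurable_fun. Qed.
Lemma intgr_itv f (a b : R) : continuous f -> mu.-integrable `[a, b] (EFin \o f).
Proof.
move=> cf; apply: continuous_compact_integrable; first exact: segment_compact.
exact: continuous_subspaceT.
Qed.
Lemma patch_csupp f (r : R) : (forall x, r < `|x| -> f x = 0) -> f \_ `[- r, r] = f.
Proof.
move=> f0; apply/funext => x; rewrite patchE; case: ifPn => // /negP H.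
rewrite f0// ltNge; apply/negP => xr; apply: H; apply/mem_set => /=.
by rewrite in_itv /= -ler_norml.
Qed.
Lemma intgr_csupp f : continuous f -> compact_support f -> intgr f.
Proof.
move=> cf [r f0]; rewrite /intgr -(patch_csupp f0) -restrict_EFin.
by apply/integrable_restrict => //=; rewrite setTI; exact: intgr_itv.
Qed.
Lemma RI_itv f (r : R) : (forall x, r < `|x| -> f x = 0) ->
  RI f = \int[mu]_(x in `[- r, r]) f x.
Proof.
by move=> f0; rewrite Rintegral_mkcond RIE -{1}(patch_csupp f0).
Qed.
Lemma RI_ext f g : (forall x, f x = g x) -> RI f = RI g.
Proof. by move=> /funext->. Qed.
Lemma intgrD f g : intgr f -> intgr g -> intgr (fun x => f x + g x).
Proof. by move=> fi gi; have := integrableD measurableT fi gi. Qed.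
Lemma intgrZ (c : R) f : intgr f -> intgr (fun x => c * f x).
Proof. by move=> fi; have := integrableZl measurableT c fi. Qed.
Lemma intgrB f g : intgr f -> intgr g -> intgr (fun x => f x - g x).
Proof. by move=> fi gi; have := integrableB measurableT fi gi. Qed.
Lemma intgr_norm f : intgr f -> intgr (fun x => `|f x|).
Proof. by move=> fi; have := integrable_norm fi. Qed.
Lemma intgr_measurable f : intgr f -> measurable_fun setT f.
Proof. by move=> /integrableP[/measurable_EFinP]. Qed.
Lemma intgr_le f g : measurable_fun setT f -> intgr g -> (forall x, `|f x| <= g x) -> intgr f.
Proof.
move=> mf gi fg; apply: (le_integrable measurableT _ _ gi).
  exact/measurable_EFinP.
by move=> x _ /=; rewrite lee_fin (le_trans (fg x))// ler_norm.
Qed.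
Lemma RID f g : intgr f -> intgr g -> RI (fun x => f x + g x) = RI f + RI g.
Proof. by move=> fi gi; rewrite !RIE; exact: RintegralD. Qed.
Lemma RIB f g : intgr f -> intgr g -> RI (fun x => f x - g x) = RI f - RI g.
Proof. by move=> fi gi; rewrite !RIE; exact: RintegralB. Qed.
Lemma RIZ (c : R) f : intgr f -> RI (fun x => c * f x) = c * RI f.
Proof. by move=> fi; rewrite !RIE; exact: RintegralZl. Qed.
Lemma RI_ge0 f : (forall x, 0 <= f x) -> 0 <= RI f.
Proof. by move=> f0; rewrite RIE; exact: Rintegral_ge0. Qed.
Lemma RI_le f g : intgr f -> intgr g -> (forall x, f x <= g x) -> RI f <= RI g.
Proof. by move=> fi gi fg; rewrite !RIE; apply: le_Rintegral. Qed.
Lemma RI_norm f : intgr f -> `|RI f| <= RI (fun x => `|f x|).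
Proof. by move=> fi; rewrite !RIE; exact: le_normr_Rintegral. Qed.
Lemma RI_EFin f : intgr f -> (\int[mu]_x (f x)%:E)%E = (RI f)%:E.
Proof. by move=> fi; rewrite RIE fineK//; exact: integrable_fin_num. Qed.
Lemma FTC2 F f (a b : R) : a <= b -> has_deriv F f -> continuous f ->
  \int[mu]_(x in `[a, b]) f x = F b - F a.
Proof.
rewrite le_eqVlt => /predU1P[->|ab] Ff cf.
  by rewrite set_itv1 Rintegral_set1 subrr.
rewrite /Rintegral (@continuous_FTC2 _ f F a b)//.
- exact: continuous_subspaceT.
- split.
  + by move=> x _; exact: (has_deriv_derivable Ff).
  + exact/cvg_at_right_filter/(has_deriv_continuous Ff).
  + exact/cvg_at_left_filter/(has_deriv_continuous Ff).
- by move=> x _; rewrite (has_deriv_derive1 Ff).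
Qed.
Lemma RI_deriv F f : has_deriv F f -> continuous f -> compact_support F -> RI f = 0.
Proof.
move=> Ff cf [r F0]; pose s := `|r| + 1.
have rs : r < s by rewrite /s ltr_pwDr// ler_norm.
have s0 : 0 <= s by rewrite /s addr_ge0.
have f0 := has_deriv_zero_out Ff F0.
rewrite (@RI_itv _ s); last by move=> x /(lt_trans rs); exact: f0.
rewrite (FTC2 _ Ff)//; last by rewrite ge0_cp.
by rewrite !F0 ?subrr// ?normrN ger0_norm.
Qed.
Lemma csupp_deriv f g : has_deriv f g -> compact_support f -> compact_support g.
Proof. by move=> fg [r fr]; exists r; exact: has_deriv_zero_out fr. Qed.
Lemma cont_mul f g : continuous f -> continuous g -> continuous (fun x => f x * g x).
Proof. by move=> cf cg x; apply: continuousM; [exact: cf|exact: cg]. Qed.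
Lemma cont_add f g : continuous f -> continuous g -> continuous (fun x => f x + g x).
Proof. by move=> cf cg x; apply: continuousD; [exact: cf|exact: cg]. Qed.
Lemma cont_sub f g : continuous f -> continuous g -> continuous (fun x => f x - g x).
Proof. by move=> cf cg x; apply: continuousB; [exact: cf|exact: cg]. Qed.
Lemma cont_opp f : continuous f -> continuous (fun x => - f x).
Proof. by move=> cf x; apply: continuousN; exact: cf. Qed.
Lemma cont_cst (c : R) : continuous (fun _ : R => c).
Proof. by move=> x; exact: cst_continuous. Qed.
Lemma cont_scale (c : R) f : continuous f -> continuous (fun x => c * f x).
Proof. by move=> cf; apply: cont_mul => //; exact: cont_cst. Qed.
Lemma intgr_contMr f g : continuous f -> continuous g -> compact_support g -> intgr (fun x => f x * g x).
Proof. by move=> cf cg kf; apply: intgr_csupp; [exact: cont_mul|exact: csuppMr]. Qed.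
Lemma RI_parts f f' g g' : has_deriv f f' -> has_deriv g g' ->
  continuous f' -> continuous g' -> compact_support g ->
  RI (fun x => f x * g' x) = - RI (fun x => f' x * g x).
Proof.
move=> ff gg cf cg kg; apply/eqP; rewrite -addr_eq0 addrC -RID; last 2 first.
- by apply: intgr_contMr => //; exact: has_deriv_continuous gg.
- apply: intgr_contMr => //; first exact: has_deriv_continuous ff.
  exact: csupp_deriv gg kg.
apply/eqP; apply: RI_deriv (has_derivM ff gg) _ _; last exact: csuppMr.
apply: cont_add; apply: cont_mul => //; [exact: has_deriv_continuous gg|exact: has_deriv_continuous ff].
Qed.
Lemma RI_gt0 f (x0 : R) : continuous f -> intgr f -> (forall x, 0 <= f x) -> 0 < f x0 -> 0 < RI f.
Proof.
move=> cf fi f0 fx0.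
have : \forall y \near x0, f x0 / 2 < f y.
  have /cvgr_gt := cf x0; apply; lra.
move=> [/= e e0 He].
pose d := e / 2; have d0 : 0 < d by rewrite /d divr_gt0.
pose A := `[x0 - d, x0 + d]%classic.
have mA : mu A = (2 * d)%:E.
  have dd : x0 - d < x0 + d by lra.
  by rewrite lebesgue_measure_itv/= lte_fin dd -EFinD; congr EFin; ring.
have gi : mu.-integrable A (EFin \o (fun=> f x0 / 2)).
  by apply: intgr_itv; exact: cont_cst.
apply: (@lt_le_trans _ _ (\int[mu]_(x in A) (f x0 / 2))).
  have -> : \int[mu]_(x in A) (f x0 / 2) = f x0 / 2 * (2 * d).
    rewrite Rintegral_cst; last exact: measurable_itv.
    by congr (_ * _); exact: (congr1 fine mA).
  by nra.
rewrite Rintegral_mkcond -RIE; apply: RI_le => //.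
  by rewrite /intgr -restrict_EFin; apply/integrable_restrict => //; [exact: measurable_itv|rewrite setTI].
move=> x; rewrite patchE; case: ifPn => [/set_mem|_]; last exact: f0.
rewrite /A /= in_itv /= => /andP[x1 x2]; apply/ltW/He.
by rewrite /= distrC ltr_distl /d in x1 x2 *; apply/andP; split; lra.
Qed.
(** A base point [a] left of both [0] and [y] turns the oriented integral into one with a fixed
    lower endpoint, the shape required by the fundamental theorem of calculus in [prim_deriv]. *)
Lemma primE f (a y : R) : continuous f -> a < 0 -> a < y ->
  prim f y = \int[mu]_(t in `[a, y]) f t - \int[mu]_(t in `[a, 0]) f t.
Proof.
have key (b c : R) : continuous f -> a < b -> b <= c ->
    \int[mu]_(t in `[a, c]) f t - \int[mu]_(t in `[a, b]) f t = \int[mu]_(t in `[b, c]) f t.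
  move=> cf ab bc; rewrite Rintegral_itvB; last 3 first.
  - exact: intgr_itv.
  - by rewrite bnd_simp ltW.
  - by rewrite bnd_simp.
  rewrite Rintegral_itv_obnd_cbnd//; apply: integrableS (intgr_itv b c cf) => //.
  by apply: subset_itvr; rewrite bnd_simp.
have z (b c : R) : b <= c -> \int[mu]_(t in `[c, b]) f t = 0.
  rewrite le_eqVlt => /predU1P[->|bc]; first by rewrite set_itv1 Rintegral_set1.
  by rewrite set_itv_ge ?Rintegral_set0// bnd_simp -ltNge.
move=> cf a0 ay; rewrite prim.unlock; have [y0|y0] := leP 0 y.
  by rewrite (key _ _ cf a0 y0) (z _ _ y0) subr0.
rewrite (z _ _ (ltW y0)) sub0r; apply: oppr_inj; rewrite opprK opprB key//.
exact: ltW.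
Qed.
Lemma prim_deriv f : continuous f -> has_deriv (prim f) f.
Proof.
move=> cf x; pose a := Num.min 0 x - 1.
have a0 : a < 0 by have : Num.min 0 x <= 0; [rewrite ge_min lexx|rewrite /a; lra].
have ax : a < x by have : Num.min 0 x <= x; [rewrite ge_min lexx orbT|rewrite /a; lra].
have xx : x < x + 1 by rewrite ltrDl.
have [dF Fx] := @continuous_FTC1_closed R f a x (x + 1) xx (intgr_itv _ _ cf) ax (cf x).
have H : is_derive x (1 : R) (fun y => \int[mu]_(t in `[a, y]) f t - \int[mu]_(t in `[a, 0]) f t) (f x - 0).
  apply: is_deriveB; split; [exact: dF|by rewrite -derive1E].
rewrite subr0 in H; apply: near_eq_is_derive H.
near=> y; rewrite (@primE f a)//; near: y.
have cid : continuous (fun y : R => y) by exact: has_deriv_continuous (@has_deriv_id R).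
have /cvgr_gt := cid x; exact.
Unshelve. all: by end_near. Qed.
Lemma prim_continuous f : continuous f -> continuous (prim f).
Proof. by move=> /prim_deriv/has_deriv_continuous. Qed.
End Integration.

(** * Bump functions *)

Section Bumps.
Context {R : realType}.
Implicit Types (f g h F : R -> R).
(** A quadratic remainder estimate stands in for the limit of difference quotients. It serves
    [expinv] at the origin, and convolutions, where such a bound can be integrated. *)
Lemma is_derive_quad h (a d C : R) :
  (forall t, `|t| <= 1 -> `|h (a + t) - h a - t * d| <= C * t ^+ 2) ->
  is_derive a (1 : R) h d.
Proof.
move=> H.
have C0 : 0 <= C.
  have := H 1; rewrite normr1 lexx expr1n mulr1 => /(_ isT).
  by apply: le_trans.
have K : t^-1 *: (h (t *: 1 + a) - h a) @[t --> (0 : R)^'] --> d.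
  apply/cvgrPdist_le => /= e e0.
  near=> t.
  have t0 : t != 0 by near: t; exact: nbhs_dnbhs_neq.
  have te : `|t| <= Num.min 1 (e / (C + 1)).
    near: t; apply: cvg_within; have m0 : 0 < Num.min 1 (e / (C + 1)).
      by rewrite lt_min ltr01 divr_gt0// ltr_wpDl.
    have /cvgr_le := @norm_continuous _ R (0:R); apply.
    by rewrite normr0.
  move: te; rewrite le_min => /andP[t1 te].
  have := H t t1.
  rewrite (_ : t *: 1 + a = a + t); last by rewrite addrC; congr (_ + _); exact: mulr1.
  set u := h (a + t) - h a => Hu.
  rewrite (_ : d - t^-1 *: u = - (t^-1 * (u - t * d))); last first.
    by rewrite (_ : t^-1 *: u = t^-1 * u)//; field.
  rewrite normrN normrM normfV ler_pdivrMl ?normr_gt0//.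
  apply: (le_trans Hu); rewrite -real_normK ?num_real// expr2 mulrA [X in _ <= X]mulrC ler_pM2r ?normr_gt0//.
  move: te; rewrite ler_pdivlMr ?ltr_wpDl// => te.
  by rewrite [C * _]mulrC (le_trans _ te)// ler_wpM2l// lerDl.
apply: DeriveDef; first by apply/cvg_ex; exists d; exact: K.
by apply/cvg_lim => //; exact: K.
Unshelve. all: by end_near. Qed.
Lemma horner_bound (p : {poly R}) : exists2 C, 0 <= C & forall y, 1 <= y -> `|p.[y]| <= C * y ^+ (size p).
Proof.
exists (\sum_(i < size p) `|p`_i|); first by apply: sumr_ge0.
move=> y y1; rewrite horner_coef (le_trans (ler_norm_sum _ _ _))// mulr_suml.
apply: ler_sum => i _; rewrite normrM ler_wpM2l// normrX ger0_norm ?(le_trans ler01)//.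
by rewrite ler_weXn2l// ltnW.
Qed.
(** From 1 + t <= exp t at t = y / (m + 1), raised to the power m + 1. *)
Lemma expR_ge_pow (m : nat) (y : R) : 0 <= y -> (y / m.+1%:R) ^+ m.+1 <= expR y.
Proof.
move=> y0; have -> : expR y = expR (y / m.+1%:R) ^+ m.+1.
  by rewrite -expRM_natl; congr expR; rewrite mulrC divfK// pnatr_eq0.
rewrite lerXn2r// ?nnegrE ?expR_ge0//; first by rewrite divr_ge0.
by rewrite (le_trans _ (expR_ge1Dx _))// lerDr.
Qed.
(** The functions p(1/x) exp(-1/x), extended by zero. Letting [p] vary makes the family stable under
    differentiation: the chain rule replaces p by X^2 (p - p'). *)
Definition expinv (p : {poly R}) (x : R) : R :=
  if 0 < x then p.[x^-1] * expR (- x^-1) else 0.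
Lemma expinv_bound p : exists C, forall x, x <= 1 -> `|expinv p x| <= C * x ^+ 2.
Proof.
(* [m.+1] is [size p] plus two: the two extra powers of 1/x beaten by the exponential leave the
   factor [x ^+ 2]. *)
have [C C0 HC] := horner_bound p; pose m := (size p).+1.
have He (y : R) : 0 <= y -> y ^+ m.+1 / m.+1%:R ^+ m.+1 <= expR y.
  by move=> y0; have := @expR_ge_pow m y y0; rewrite expr_div_n.
have : 0 < (m.+1%:R ^+ m.+1 : R) by rewrite exprn_gt0.
move: He; set K : R := m.+1%:R ^+ m.+1 => He K0; clearbody K.
exists (C * K) => x x1; rewrite /expinv; case: ifPn => x0; last first.
  rewrite normr0; apply: mulr_ge0; last exact: sqr_ge0.
  by rewrite mulr_ge0// ltW.
have y1 : 1 <= x^-1 by rewrite invf_ge1.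
have y0 : 0 < x^-1 by rewrite invr_gt0.
rewrite normrM [X in _ * X]ger0_norm ?expR_ge0// expRN.
rewrite ler_pdivrMr ?expR_gt0//.
apply: (le_trans (HC _ y1)).
rewrite -(mulrA (C * K)) -(mulrA C) ler_wpM2l//.
have := He _ (ltW y0); rewrite ler_pdivrMr// => H.
have : x ^+ 2 * (x^-1 ^+ m.+1) <= x ^+ 2 * (expR x^-1 * K) by rewrite ler_pM2l ?exprn_gt0.
have x00 : x != 0 by rewrite gt_eqF.
have -> : x ^+ 2 * x^-1 ^+ m.+1 = x^-1 ^+ size p.
  by rewrite /m (exprD _ 2 (size p)) mulrA -exprMn mulfV// expr1n mul1r.
move=> /le_trans; apply.
by rewrite [_ * K]mulrC [X in X <= _]mulrCA.
Qed.
Lemma expinv_deriv p : has_deriv (expinv p) (expinv ('X^2 * (p - p^`()))).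
Proof.
move=> x; case: (ltgtP x 0) => x0.
- rewrite /expinv ltNge (ltW x0)/=.
  have := @has_deriv_cst R 0 x; apply: near_eq_is_derive; near=> y.
  rewrite ltNge ltW//; near: y.
  have cid : continuous (fun y : R => y) by exact: has_deriv_continuous (@has_deriv_id R).
  by have /cvgr_lt := cid x; apply.
- have H : is_derive x (1 : R) (fun x : R => p.[x^-1] * expR (- x^-1)) (expinv ('X^2 * (p - p^`())) x).
    have xn0 : x != 0 by rewrite gt_eqF.
    have dV : is_derive x (1 : R) (fun x : R => x^-1) (- x ^- 2).
      have := @is_deriveV R (fun x : R => x) x 1 1 xn0 (is_derive_id x 1).
      by move/is_derive_eq; apply; rewrite -[RHS]mulr1.
    have dp := @is_derive1_comp R (fun y => p.[y]) (fun x => x^-1) x _ _ (is_derive_poly p x^-1) dV.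
    have dN : is_derive x (1 : R) (fun x : R => - x^-1) (x ^- 2).
      by have := is_deriveN dV; rewrite opprK.
    have de := @is_derive1_comp R expR (fun x => - x^-1) x _ _ (is_derive_expR _) dN.
    have := is_deriveM dp de; move/is_derive_eq; apply.
    rewrite /expinv x0 hornerM hornerXn hornerD hornerN /=.
    have sc (a b : R) : a *: b = a * b by [].
    rewrite !sc.
    rewrite exprVn.
    ring.
  apply: near_eq_is_derive H; near=> y; rewrite /expinv ifT//; near: y.
  have cid : continuous (fun y : R => y) by exact: has_deriv_continuous (@has_deriv_id R).
  by have /cvgr_gt := cid x; apply.
- rewrite x0 {2}/expinv ltxx; have [C HC] := expinv_bound p.
  apply: (@is_derive_quad _ _ _ C) => t t1; rewrite add0r mulr0 subr0.
  rewrite {2}/expinv ltxx subr0; apply: HC.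
  by rewrite (le_trans _ t1)// ler_norm.
Unshelve. all: by end_near. Qed.
Lemma expinv_smooth p : cinf (expinv p).
Proof.
apply: (@smooth_coind _ (fun h => exists p, h = expinv p)); last by exists p.
by move=> _ [q ->]; exists (expinv ('X^2 * (q - q^`()))); [exact: expinv_deriv|exists ('X^2 * (q - q^`()))].
Qed.
Definition bump0 (x : R) : R := expinv 1 (1 * x + 1) * expinv 1 (-1 * x + 1).
Lemma expinv1_ge0 x : 0 <= expinv 1 x.
Proof. by rewrite /expinv; case: ifP => // _; rewrite hornerC mul1r expR_ge0. Qed.
Lemma bump0_smooth : cinf bump0.
Proof. by apply: smoothM; apply: smooth_affine; exact: expinv_smooth. Qed.
Lemma bump0_out x : 1 <= `|x| -> bump0 x = 0.
Proof.
rewrite ler_normr => /orP[] x1; rewrite /bump0 /expinv.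
  by rewrite [X in _ * X]ifF ?mulr0//; apply/negbTE; rewrite -leNgt; lra.
by rewrite ifF ?mul0r//; apply/negbTE; rewrite -leNgt; lra.
Qed.
Lemma bump0_ge0 x : 0 <= bump0 x.
Proof. by rewrite mulr_ge0 ?expinv1_ge0. Qed.
Lemma bump0_gt0 : 0 < bump0 0.
Proof.
by rewrite /bump0 /expinv !mulr0 !add0r ltr01 hornerC mul1r mulr_gt0 ?expR_gt0.
Qed.
Lemma bump0_test : ctest bump0.
Proof. by split; [exact: bump0_smooth|exists 1 => x /ltW; exact: bump0_out]. Qed.
Lemma bump0_RI : 0 < RI bump0.
Proof.
have [sb kb] := bump0_test; have cb := smooth_continuous sb.
by apply: (RI_gt0 cb _ bump0_ge0 bump0_gt0); exact: intgr_csupp.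
Qed.
Definition stdbump (x : R) : R := (RI bump0)^-1 * bump0 x.
Lemma stdbump_test : ctest stdbump.
Proof. by apply: testZ; exact: bump0_test. Qed.
Lemma stdbump_ge0 x : 0 <= stdbump x.
Proof. by rewrite mulr_ge0 ?bump0_ge0// invr_ge0 ltW ?bump0_RI. Qed.
Lemma stdbump_out x : 1 <= `|x| -> stdbump x = 0.
Proof. by move=> x1; rewrite /stdbump bump0_out ?mulr0. Qed.
Lemma stdbump_gt0 : 0 < stdbump 0.
Proof. by rewrite mulr_gt0 ?bump0_gt0// invr_gt0 bump0_RI. Qed.
Lemma test_continuous f : ctest f -> continuous f.
Proof. by case=> /smooth_continuous. Qed.
Lemma test_intgr f : ctest f -> intgr f.
Proof. by move=> [/smooth_continuous cf kf]; exact: intgr_csupp. Qed.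
Lemma stdbump_RI : RI stdbump = 1.
Proof.
rewrite RIZ; last exact: test_intgr bump0_test.
by rewrite mulVf// gt_eqF// bump0_RI.
Qed.
(** The fundamental lemma of the calculus of variations, by a bump supported where [F] is positive,
    then the same for [- F]. *)
Lemma cont_test_zero F : continuous F ->
  (forall chi, ctest chi -> RI (fun x => F x * chi x) = 0) -> forall x, F x = 0.
Proof.
have pos (G : R -> R) : continuous G -> (forall chi, ctest chi -> RI (fun x => G x * chi x) = 0) ->
    forall x, G x <= 0.
  move=> cG HG x0; rewrite leNgt; apply/negP => G0.
  have : \forall y \near x0, 0 < G y by have /cvgr_gt := cG x0; apply.
  move=> [/= e e0 He].
  have e1 : e^-1 != 0 by rewrite invr_eq0 gt_eqF.
  pose chi y := stdbump (e^-1 * y + (- (x0 / e))).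
  have tchi : ctest chi by apply: test_affine => //; exact: stdbump_test.
  have := HG _ tchi; apply/eqP; rewrite gt_eqF//.
  have [_ kc] := tchi; have cc := test_continuous tchi.
  apply: (@RI_gt0 _ _ x0).
  - exact: cont_mul.
  - exact: intgr_contMr.
  - move=> y; have [ye|ye] := ltP `|x0 - y| e.
      by rewrite mulr_ge0 ?stdbump_ge0// ltW//; exact: He.
    rewrite /chi stdbump_out ?mulr0//.
    rewrite (_ : e^-1 * y + _ = - ((x0 - y) / e)); last by ring.
    by rewrite normrN normrM normfV (gtr0_norm e0) ler_pdivlMr// mul1r.
  - rewrite mulr_gt0// /chi (_ : _ + _ = 0) ?stdbump_gt0//; ring.
move=> cF HF x; apply/eqP; rewrite eq_le pos//=.
rewrite -oppr_le0; apply: (pos (fun x => - F x)); first exact: cont_opp.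
move=> chi tchi; have [_ kc] := tchi.
rewrite (RI_ext (g := fun x => (-1) * (F x * chi x))); last by move=> y; ring.
rewrite RIZ ?HF ?mulr0//; apply: intgr_contMr => //; exact: test_continuous.
Qed.
End Bumps.

(** * Distributional solutions of fourth-order equations *)

Section DuBoisReymond.
Context {R : realType}.
Implicit Types (f g h F chi eta : R -> R).
Lemma prim_const f (u v : R) : continuous f -> u <= v ->
  (forall y, u <= y <= v -> f y = 0) -> prim f u = prim f v.
Proof.
move=> cf uv f0; apply/eqP; rewrite -subr_eq0 -oppr_eq0 opprB.
rewrite -(FTC2 uv (prim_deriv cf) cf); apply/eqP.
rewrite (@eq_Rintegral _ _ _ _ _ (fun=> 0)); last first.
  by move=> y /set_mem /=; rewrite in_itv => /= H; exact: f0.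
by rewrite Rintegral_cst ?mul0r//; exact: measurable_itv.
Qed.
(** The primitive started left of the support vanishes on the left by construction, and on the right
    because the total integral is zero. *)
Lemma test_primitive chi : ctest chi -> RI chi = 0 ->
  exists2 omega, ctest omega & has_deriv omega chi.
Proof.
move=> [sc [r kr]] I0; have cc := smooth_continuous sc.
pose s := `|r| + 1; have rs : r < s by rewrite /s ltr_pwDr// ler_norm.
have s0 : 0 <= s by rewrite /s addr_ge0.
pose omega x := prim chi x - prim chi (- s).
have dom : has_deriv omega chi.
  apply: (has_deriv_eq (has_derivB (prim_deriv cc) (has_deriv_cst (prim chi (- s))))).
  by move=> x; rewrite subr0.
have neg u v : u <= v -> v <= - s -> prim chi u = prim chi v.
  move=> uv vs; apply: prim_const => // y /andP[uy yv]; apply: kr.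
  by rewrite (lt_le_trans rs)// ler_normr; apply/orP; right; lra.
have pos u v : u <= v -> r < u -> prim chi u = prim chi v.
  move=> uv ru; apply: prim_const => // y /andP[uy yv]; apply: kr.
  by rewrite ltr_normr; apply/orP; left; lra.
exists omega => //; split; first by apply/smoothP; exists chi.
exists s => x; rewrite /omega ltr_normr => /orP[sx|sx].
  have x0 : 0 <= x by lra.
  (* Moving the base point from [- s] to [- x] makes the interval symmetric, so that the integral
     over it is [RI chi]. *)
  rewrite -(neg (- x) (- s)); [|lra|lra].
  rewrite -(FTC2 _ (prim_deriv cc) cc); last lra.
  rewrite -RI_itv// => y xy; apply: kr; lra.
by rewrite (neg x (- s)) ?subrr//; lra.
Qed.
Definition tlin (T : (R -> R) -> R) := forall chi eta (c : R), ctest chi -> ctest eta ->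
  T (fun x => chi x + c * eta x) = T chi + c * T eta.
(** Subtracting [RI chi] times [stdbump] from [chi] leaves a test function of zero integral, that
    is, the derivative of a test function; the constant is the value of [T] at [stdbump]. *)
Lemma tlin_deriv0 T : tlin T -> (forall chi, ctest chi -> T (derive1 chi) = 0) ->
  exists c, forall chi, ctest chi -> T chi = c * RI chi.
Proof.
move=> lT H; exists (T stdbump) => chi tc.
have tb := @stdbump_test R.
have t2 : ctest (fun x => chi x + (- RI chi) * stdbump x) by apply: testD => //; exact: testZ.
have I0 : RI (fun x => chi x + (- RI chi) * stdbump x) = 0.
  rewrite RID; [|exact: test_intgr|exact/intgrZ/test_intgr].
  by rewrite RIZ ?stdbump_RI; [ring|exact: test_intgr].
have [omega to dom] := test_primitive t2 I0.
have := H _ to; rewrite (has_deriv_derive1 dom) lT// => /eqP; rewrite mulNr subr_eq0 => /eqP ->.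
exact: mulrC.
Qed.
Lemma test_intgrM f chi : continuous f -> ctest chi -> intgr (fun x => f x * chi x).
Proof. by move=> cf [/smooth_continuous cc kc]; exact: intgr_contMr. Qed.
Lemma tlin_RI (A : R -> R) n : continuous A -> tlin (fun chi => RI (fun x => A x * derive1n n chi x)).
Proof.
move=> cA chi eta c tc te; rewrite derive1nD; last 2 first.
- by case: tc.
- by apply: smoothZ; case: te.
rewrite derive1nZ; last by case: te.
rewrite -RIZ; last by apply: test_intgrM => //; exact: test_derive1n.
rewrite -RID; last 2 first.
- by apply: test_intgrM => //; exact: test_derive1n.
- by apply: intgrZ; apply: test_intgrM => //; exact: test_derive1n.
by apply: RI_ext => x; ring.
Qed.
Lemma tlinD T1 T2 : tlin T1 -> tlin T2 -> tlin (fun chi => T1 chi + T2 chi).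
Proof. by move=> l1 l2 chi eta c tc te; rewrite l1// l2//; ring. Qed.
(* Integrating [A0] by parts turns the hypothesis into the vanishing of a functional on derivatives. *)
Lemma weak_lower T (A0 A1 : R -> R) : tlin T -> continuous A0 -> continuous A1 ->
  (forall chi, ctest chi -> RI (fun x => A0 x * chi x) + RI (fun x => A1 x * derive1 chi x)
     + T (derive1 chi) = 0) ->
  exists c, forall chi, ctest chi -> RI (fun x => (A1 x - prim A0 x - c) * chi x) + T chi = 0.
Proof.
move=> lT c0 c1 H; have cp := prim_continuous c0.
have cAp := cont_sub c1 cp.
pose S chi := RI (fun x => (A1 x - prim A0 x) * derive1n 0 chi x) + T chi.
have lS : tlin S by apply: tlinD => //; exact: tlin_RI.
have [|c Hc] := tlin_deriv0 lS.
  move=> chi tc; have [sc kc] := tc.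
  have cd : continuous (derive1 chi) by exact: smooth_continuous (smooth_derive1 sc).
  have td := test_derive1 tc.
  rewrite /S /= (RI_ext (g := fun x => A1 x * derive1 chi x - prim A0 x * derive1 chi x)); last by move=> x; ring.
  rewrite RIB; [|exact: test_intgrM|exact: test_intgrM].
  rewrite (RI_parts (prim_deriv c0) (smooth_has_deriv sc))//.
  by rewrite -[RHS](H _ tc); ring.
exists c => chi tc; have := Hc _ tc; rewrite /S /= => HH.
rewrite (RI_ext (g := fun x => (A1 x - prim A0 x) * chi x - c * chi x)); last by move=> x; ring.
rewrite RIB; [|exact: test_intgrM|by apply: intgrZ; exact: test_intgr].
rewrite RIZ; last exact: test_intgr.
by rewrite addrAC HH subrr.
Qed.
(** Four uses of [weak_lower] strip the derivatives from the test function one by one, until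
    [a * psi] equals the primitive of a continuous function up to a constant. Unwinding the chain
    [G3], [G2], [G1], [A0] then gives four classical derivatives of [psi]. *)
Lemma weak_ode (a : R) (b c psi : R -> R) : a != 0 -> cinf b -> cinf c -> continuous psi ->
  (forall chi, ctest chi ->
     RI (fun x => psi x * (a * derive1n 4 chi x - (derive1 b x * derive1 chi x + b x * derive1n 2 chi x)
        + c x * chi x)) = 0) ->
  cinf psi /\
  forall x, a * derive1n 4 psi x - (derive1 b x * derive1 psi x + b x * derive1n 2 psi x) + c x * psi x = 0.
Proof.
move=> a0 sb sc cpsi H.
have cb := smooth_continuous sb; have cc := smooth_continuous sc.
have cdb := smooth_continuous (smooth_derive1 sb).
pose A0 x := c x * psi x; pose A1 x := - (derive1 b x * psi x).
pose A2 x := - (b x * psi x); pose A4 x := a * psi x.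
have cA0 : continuous A0 by exact: cont_mul.
have cA1 : continuous A1 by apply: cont_opp; exact: cont_mul.
have cA2 : continuous A2 by apply: cont_opp; exact: cont_mul.
have cA4 : continuous A4 by exact: cont_scale.
have [] := @weak_lower (fun chi => RI (fun x => A2 x * derive1n 1 chi x) + RI (fun x => A4 x * derive1n 3 chi x)) A0 A1.
- by apply: tlinD; exact: tlin_RI.
- exact: cA0.
- exact: cA1.
- move=> chi tc; rewrite -[RHS](H _ tc).
  have t1 := test_derive1 tc; have t2 := test_derive1 t1; have t4 := test_derive1n 4 tc.
  have cf1 := cont_mul cc cpsi; rewrite -/A0 in cf1.
  have -> : derive1n 3 (derive1 chi) = derive1n 4 chi by rewrite -derive1Sn.
  have -> : derive1n 1 (derive1 chi) = derive1n 2 chi by rewrite -derive1Sn.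
  have {t2} t2 : ctest (derive1n 2 chi) := t2.
  move: (derive1n 4 chi) (derive1n 2 chi) (derive1 chi) t4 t2 t1 => x4 x2 x1 t4 t2 t1.
  have i0 := test_intgrM cA0 tc; have i1 := test_intgrM cA1 t1.
  have i2 := test_intgrM cA2 t2; have i4 := test_intgrM cA4 t4.
  rewrite -(RID i0 i1) -(RID i2 i4) -(RID (intgrD i0 i1) (intgrD i2 i4)).
  apply: RI_ext => x; rewrite /A0 /A1 /A2 /A4.
  move: (x4 x) (x2 x) (x1 x) (chi x) (derive1 b x) (b x) (c x) (psi x) => *; ring.
move=> c1 HG1; pose G1 x := A1 x - prim A0 x - c1.
have cG1 : continuous G1 by apply: cont_sub; [apply: cont_sub => //; exact: prim_continuous|exact: cont_cst].
have [] := @weak_lower (fun chi => RI (fun x => A4 x * derive1n 2 chi x)) G1 A2.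
- exact: tlin_RI.
- exact: cG1.
- exact: cA2.
- by move=> chi tc; rewrite -[RHS](HG1 _ tc) -addrA; congr (_ + _); rewrite -derive1Sn.
move=> c2 HG2; pose G2 x := A2 x - prim G1 x - c2.
have cG2 : continuous G2 by apply: cont_sub; [apply: cont_sub => //; exact: prim_continuous|exact: cont_cst].
have [] := @weak_lower (fun chi => RI (fun x => A4 x * derive1n 1 chi x)) G2 (fun=> 0).
- exact: tlin_RI.
- exact: cG2.
- exact: cont_cst.
- move=> chi tc; rewrite -[RHS](HG2 _ tc) -addrA; congr (_ + _).
  by rewrite (RI_ext (g := fun x => 0 * derive1 chi x))// RIZ ?mul0r ?add0r -?derive1Sn//; exact/test_intgr/test_derive1.
move=> c3 HG3; pose G3 x := 0 - prim G2 x - c3.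
have cG3 : continuous G3 by apply: cont_sub; [apply: cont_sub; [exact: cont_cst|exact: prim_continuous]|exact: cont_cst].
have [] := @weak_lower (fun=> 0) G3 A4.
- by move=> *; ring.
- exact: cG3.
- exact: cA4.
- by move=> chi tc; rewrite -[RHS](HG3 _ tc) addr0.
move=> c4 HG4.
have E4 : forall x, A4 x - prim G3 x - c4 = 0.
  apply: cont_test_zero; first by apply: cont_sub; [apply: cont_sub => //; exact: prim_continuous|exact: cont_cst].
  by move=> chi tc; rewrite -[RHS](HG4 _ tc) addr0.
pose psi1 x := a^-1 * G3 x.
have d0 : has_deriv psi psi1.
  have -> : psi = fun x => a^-1 * (prim G3 x + c4).
    by apply/funext => x; rewrite (_ : prim G3 x + c4 = A4 x) /A4 ?mulKf//; have := E4 x; rewrite /A4; lra.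
  have := has_derivZ a^-1 (has_derivD (prim_deriv cG3) (has_deriv_cst c4)).
  by move/has_deriv_eq; apply => x; rewrite addr0.
pose psi2 x := - (a^-1 * G2 x).
have d1 : has_deriv psi1 psi2.
  have := has_derivZ a^-1 (has_derivB (has_derivB (has_deriv_cst 0) (prim_deriv cG2)) (has_deriv_cst c3)).
  by move/has_deriv_eq; apply => x; rewrite /psi2; ring.
(* The term b' psi arising from the derivative of [A2] cancels the one in [A1]; what remains can be
   differentiated once more. *)
pose psi3 x := a^-1 * (b x * psi1 x - prim A0 x - c1).
have d2 : has_deriv psi2 psi3.
  have := has_derivN (has_derivZ a^-1 (has_derivB (has_derivB (has_derivN (has_derivM (smooth_has_deriv sb) d0))
     (prim_deriv cG1)) (has_deriv_cst c2))).
  by move/has_deriv_eq; apply => x; rewrite /psi3 /G1 /A1; ring.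
pose psi4 x := a^-1 * (derive1 b x * psi1 x + b x * psi2 x - c x * psi x).
have d3 : has_deriv psi3 psi4.
  have := has_derivZ a^-1 (has_derivB (has_derivB (has_derivM (smooth_has_deriv sb) d1)
     (prim_deriv cA0)) (has_deriv_cst c1)).
  by move/has_deriv_eq; apply => x; rewrite /psi4 /A0; ring.
split; last first.
  move=> x; have -> : derive1n 4 psi = psi4.
    by rewrite !derive1nS derive1n0 (has_deriv_derive1 d0) (has_deriv_derive1 d1) (has_deriv_derive1 d2) (has_deriv_derive1 d3).
  have -> : derive1n 2 psi = psi2.
    by rewrite !derive1nS derive1n0 (has_deriv_derive1 d0) (has_deriv_derive1 d1).
  rewrite (has_deriv_derive1 d0) /psi4; field.
  exact: a0.
(* Combinations of [psi], ..., [psi3] with smooth coefficients are stable under differentiation,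
   since the equation expresses [psi4] by lower orders. *)
apply: (@smooth_coind _ (fun h => exists s0 s1 s2 s3, [/\ cinf s0, cinf s1, cinf s2, cinf s3 &
   h = fun x => s0 x * psi x + s1 x * psi1 x + (s2 x * psi2 x + s3 x * psi3 x)])); last first.
  exists (fun=> 1), (fun=> 0), (fun=> 0), (fun=> 0); split; try exact: smooth_cst.
  by apply/funext => x; ring.
move=> _ [s0 [s1 [s2 [s3 [h0 h1 h2 h3 ->]]]]].
have D0 := smooth_has_deriv h0; have D1 := smooth_has_deriv h1.
have D2 := smooth_has_deriv h2; have D3 := smooth_has_deriv h3.
have HD := has_derivD (has_derivD (has_derivM D0 d0) (has_derivM D1 d1)) (has_derivD (has_derivM D2 d2) (has_derivM D3 d3)).
eexists; first exact: HD.
exists (fun x => derive1 s0 x - a^-1 * (s3 x * c x)), (fun x => s0 x + derive1 s1 x + a^-1 * (s3 x * derive1 b x)),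
  (fun x => s1 x + derive1 s2 x + a^-1 * (s3 x * b x)), (fun x => s2 x + derive1 s3 x).
split.
- by apply: smoothB; [exact: smooth_derive1|apply: smoothZ; exact: smoothM].
- by apply: smoothD; [apply: smoothD => //; exact: smooth_derive1|apply: smoothZ; apply: smoothM => //; exact: smooth_derive1].
- by apply: smoothD; [apply: smoothD => //; exact: smooth_derive1|apply: smoothZ; exact: smoothM].
- by apply: smoothD => //; exact: smooth_derive1.
by apply/funext => x; rewrite /psi4; ring.
Qed.
End DuBoisReymond.

(** * The quadratic forms *)

HB.lock Definition quad (R : realType) (w : R -> R) (i : nat) (f : R -> R) : R :=
  RI (fun x => w x * derive1n i f x ^+ 2).
Section Quadratic.
Context {R : realType}.
Implicit Types (f g h chi w : R -> R).
Lemma quadE w i f : quad w i f = RI (fun x => w x * derive1n i f x ^+ 2).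
Proof. by rewrite quad.unlock. Qed.
Lemma intgr_eq f g : intgr f -> (forall x, f x = g x) -> intgr g.
Proof. by move=> fi /funext <-. Qed.
Lemma test_intgr2 w f g : continuous w -> ctest f -> ctest g -> intgr (fun x => w x * (f x * g x)).
Proof. by move=> cw tf tg; apply: test_intgrM => //; apply: testMl => //; case: tg. Qed.
Lemma test_intgr_sqr w f : continuous w -> ctest f -> intgr (fun x => w x * f x ^+ 2).
Proof. by move=> cw tf; have := test_intgr2 cw tf tf. Qed.
Lemma quad_addw w1 w2 i f : continuous w1 -> continuous w2 -> ctest f ->
  quad (fun x => w1 x + w2 x) i f = quad w1 i f + quad w2 i f.
Proof.
move=> c1 c2 tf; rewrite !quadE -RID; last 2 first.
- by apply: test_intgr_sqr => //; exact: test_derive1n.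
- by apply: test_intgr_sqr => //; exact: test_derive1n.
by apply: RI_ext => x; rewrite mulrDl.
Qed.
Lemma quad_scalew (c : R) w i f : continuous w -> ctest f ->
  quad (fun x => c * w x) i f = c * quad w i f.
Proof.
move=> c1 tf; rewrite !quadE -RIZ; last by apply: test_intgr_sqr => //; exact: test_derive1n.
by apply: RI_ext => x; rewrite mulrA.
Qed.
Lemma quad_ge0 w i f : (forall x, 0 <= w x) -> 0 <= quad w i f.
Proof. by move=> w0; rewrite quadE; apply: RI_ge0 => x; rewrite mulr_ge0// sqr_ge0. Qed.
Lemma quad_le w1 w2 i f : continuous w1 -> continuous w2 -> ctest f ->
  (forall x, w1 x <= w2 x) -> quad w1 i f <= quad w2 i f.
Proof.
move=> c1 c2 tf w12; rewrite !quadE; apply: RI_le.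
- by apply: test_intgr_sqr => //; exact: test_derive1n.
- by apply: test_intgr_sqr => //; exact: test_derive1n.
by move=> x; rewrite ler_wpM2r// sqr_ge0.
Qed.
Lemma quad_scale (c : R) w i f : continuous w -> ctest f ->
  quad w i (fun x => c * f x) = c ^+ 2 * quad w i f.
Proof.
move=> cw tf; rewrite !quadE derive1nZ; last by case: tf.
rewrite -RIZ; last by apply: test_intgr_sqr => //; exact: test_derive1n.
by apply: RI_ext => x; move: (derive1n i f x) => *; ring.
Qed.
Lemma quad_addf (t : R) w i f g : continuous w -> ctest f -> ctest g ->
  quad w i (fun x => f x + t * g x) =
  quad w i f + 2 * t * RI (fun x => w x * (derive1n i f x * derive1n i g x)) + t ^+ 2 * quad w i g.
Proof.
move=> cw tf tg; have tfi := test_derive1n i tf; have tgi := test_derive1n i tg.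
rewrite !quadE derive1nD; [|by case: tf|by apply: smoothZ; case: tg].
rewrite derive1nZ; last by case: tg.
rewrite -RIZ; last exact: test_intgr2.
rewrite -RIZ; last exact: test_intgr_sqr.
rewrite -RID; [|exact: test_intgr_sqr|by apply: intgrZ; exact: test_intgr2].
rewrite -RID; last 2 first.
- by apply: intgrD; [exact: test_intgr_sqr|apply: intgrZ; exact: test_intgr2].
- by apply: intgrZ; exact: test_intgr_sqr.
by apply: RI_ext => x; move: (derive1n i f x) (derive1n i g x) => *; ring.
Qed.
(** The one-dimensional Sobolev inequality: 2 f f' <= f^2 + f'^2 is integrated from the left of the
    support up to [x]. *)
Lemma test_sup_bound f x : ctest f -> f x ^+ 2 <= quad (fun=> 1) 0 f + quad (fun=> 1) 1 f.
Proof.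
move=> tf; have tf' := test_derive1 tf; have [sf [r kf]] := tf.
have cf := test_continuous tf; have cf' := test_continuous tf'.
have df := smooth_has_deriv sf.
pose h y := f y ^+ 2 + derive1 f y ^+ 2.
have ch : continuous h by apply: cont_add; exact: cont_mul.
pose s := Num.max `|x| r + 1.
have xs : `|x| < s by rewrite /s; have : `|x| <= Num.max `|x| r; [rewrite le_max lexx|lra].
have rs : r < s by rewrite /s; have : r <= Num.max `|x| r; [rewrite le_max lexx orbT|lra].
have s0 : 0 <= s by rewrite (le_trans (normr_ge0 x))// ltW.
have kf' := has_deriv_zero_out df kf.
move: xs; rewrite ltr_norml => /andP[xs1 xs2].
have -> : quad (fun=> 1) 0 f + quad (fun=> 1) 1 f = prim h s - prim h (- s).
  rewrite -(FTC2 _ (prim_deriv ch) ch); last by rewrite ge0_cp.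
  rewrite -RI_itv; last by move=> y sy; rewrite /h kf ?kf'; [ring|exact: lt_trans rs sy|exact: lt_trans rs sy].
  rewrite !quadE -RID; [|by apply: test_intgr_sqr => //; exact: cont_cst|by apply: test_intgr_sqr => //; exact: cont_cst].
  by apply: RI_ext => y; rewrite /h /=; move: (derive1 f y) => *; ring.
have fs : f (- s) = 0 by apply: kf; rewrite normrN ger0_norm.
have H1 : 0 <= prim h s - prim h x.
  rewrite -(FTC2 (ltW xs2) (prim_deriv ch) ch); apply: Rintegral_ge0 => y _.
  by rewrite addr_ge0 ?sqr_ge0.
have dff := has_derivM df df.
have H2 := has_derivB (prim_deriv ch) dff.
have cg : continuous (fun y => h y - (derive1 f y * f y + f y * derive1 f y)).
  by apply: cont_sub => //; apply: cont_add; exact: cont_mul.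
have := FTC2 (ltW xs1) H2 cg; rewrite fs => H3.
have : 0 <= (prim h x - f x * f x) - (prim h (- s) - 0 * 0).
  rewrite -H3; apply: Rintegral_ge0 => y _; rewrite /h.
  by rewrite (_ : _ - _ = (f y - derive1 f y) ^+ 2) ?sqr_ge0//; ring.
by rewrite expr2; lra.
Qed.
Lemma lipschitz_deriv f f' (M : R) : has_deriv f f' -> (forall x, `|f' x| <= M) ->
  forall x y, `|f x - f y| <= M * `|x - y|.
Proof.
move=> df HM; have K x y : x < y -> `|f x - f y| <= M * `|x - y|.
  move=> xy; have [z _ E] := @MVT _ f f' x y xy (fun z _ => df z)
    (continuous_subspaceT (has_deriv_continuous df)).
  by rewrite distrC E normrM [`|x - y|]distrC ler_wpM2r.
move=> x y; case: (ltgtP x y) => [/K//|/K|->].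
  by rewrite distrC [`|y - x|]distrC.
by rewrite !subrr !normr0 mulr0.
Qed.
Lemma csuppN f : compact_support f -> compact_support (fun x => - f x).
Proof. by move=> [r fr]; exists r => x /fr ->; rewrite oppr0. Qed.
Lemma parts2 (a : R) f f1 f2 g2 g3 g4 : has_deriv f f1 -> has_deriv f1 f2 ->
  has_deriv g2 g3 -> has_deriv g3 g4 -> continuous f1 -> continuous f2 ->
  continuous g3 -> continuous g4 -> compact_support g2 ->
  RI (fun x => a * (f2 x * g2 x)) = RI (fun x => f x * (a * g4 x)).
Proof.
move=> d0 d1 e2 e3 cf1 cf2 cg3 cg4 k2.
have k3 := csupp_deriv e2 k2; have k4 := csupp_deriv e3 k3.
have E1 := RI_parts d1 e2 cf2 cg3 k2.
have E2 := RI_parts d0 e3 cf1 cg4 k3.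
have cf := has_deriv_continuous d0; have cg2 := has_deriv_continuous e2.
rewrite RIZ; last exact: intgr_contMr.
rewrite -[RI _]opprK -E1 -E2 -RIZ; last exact: intgr_contMr.
by apply: RI_ext => x; rewrite mulrCA.
Qed.
Lemma parts1 b b1 f f1 g1 g2 : has_deriv b b1 -> has_deriv f f1 -> has_deriv g1 g2 ->
  continuous b -> continuous b1 -> continuous f1 -> continuous g1 -> continuous g2 -> compact_support g1 ->
  RI (fun x => b x * (f1 x * g1 x)) = RI (fun x => f x * (- (b1 x * g1 x + b x * g2 x))).
Proof.
move=> db d0 e1 cb cb1 cf1 cg1 cg2 k1; have cf := has_deriv_continuous d0.
have k2 := csupp_deriv e1 k1.
have cc : continuous (fun x => b1 x * g1 x + b x * g2 x) by apply: cont_add; exact: cont_mul.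
have kk : compact_support (fun x => b1 x * g1 x + b x * g2 x) by apply: csuppD; exact: csuppMr.
have := RI_parts d0 (has_derivM db e1) cf1 cc (csuppMr _ k1).
rewrite (RI_ext (g := fun x => b x * (f1 x * g1 x)) (f := fun x => f1 x * _)); last by move=> x; ring.
move=> E; apply: oppr_inj; rewrite -E -mulN1r -RIZ; last by apply: intgr_contMr => //; [exact: cont_opp|exact: csuppN].
by apply: RI_ext => x; ring.
Qed.
End Quadratic.

(** * The form Q_l and its Euler-Lagrange operator *)

Section Variational.
Context {R : realType}.
Variables (rho : R -> R) (k nu G e0 e1 e2 c0 : R).
Hypotheses (k0 : 0 < k) (nu0 : 0 < nu) (G0 : 0 < G) (he0 : 0 <= e0) (he1 : 0 <= e1) (he2 : 0 <= e2).
Hypotheses (srho : cinf rho) (trho : ctest (derive1 rho)) (c00 : 0 < c0) (rho_ge : forall x, c0 <= rho x).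
Implicit Types (f g chi : R -> R) (l : R).
(** [nu] is the viscosity, [G] stands for g |xi|^2, and [e2], [e1], [e0] are the magnetic weights.
    The three coefficients are the weights of f''^2, f'^2 and f^2 once Q_l is sorted by order of
    derivative. *)
Definition el_coef2 l : R := l * nu + e2.
Definition el_coef1 l (x : R) : R := l ^+ 2 * rho x + (2 * l * nu * k ^+ 2 + e1).
Definition el_coef0 l (x : R) : R := l ^+ 2 * k ^+ 2 * rho x + (l * nu * k ^+ 4 + e0) - G * derive1 rho x.
Local Notation one := (fun _ : R => 1 : R).
Definition formK f : R := quad (derive1 rho) 0 f.
Definition formJ f : R := k ^+ 2 * quad rho 0 f + quad rho 1 f.
Definition formV f : R := quad one 2 f + 2 * k ^+ 2 * quad one 1 f + k ^+ 4 * quad one 0 f.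
Definition formE f : R := e2 * quad one 2 f + e1 * quad one 1 f + e0 * quad one 0 f - G * formK f.
Definition formQ l f : R := l ^+ 2 * formJ f + l * nu * formV f + formE f.
Let crho := smooth_continuous srho.
Let cdrho := test_continuous trho.
Lemma formQE l f : ctest f ->
  formQ l f = quad (fun=> el_coef2 l) 2 f + quad (el_coef1 l) 1 f + quad (el_coef0 l) 0 f.
Proof.
move=> tf; have c1 := @cont_cst R 1.
have -> : (fun=> el_coef2 l) = (fun x => el_coef2 l * one x) by apply/funext => x; rewrite mulr1.
have -> : el_coef1 l = (fun x => l ^+ 2 * rho x + (2 * l * nu * k ^+ 2 + e1) * one x).
  by apply/funext => x; rewrite mulr1.
have -> : el_coef0 l = (fun x => l ^+ 2 * k ^+ 2 * rho x + ((l * nu * k ^+ 4 + e0) * one x + (- G) * derive1 rho x)).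
  by apply/funext => x; rewrite mulr1 addrA mulNr.
rewrite !quad_addw ?quad_scalew//; try by [exact: cont_scale|apply: cont_add; exact: cont_scale].
rewrite /formQ /formE /formJ /formV /formK /el_coef2.
by move: (quad rho 1 f) (quad rho 0 f) (quad (derive1 rho) 0 f) (quad one 2 f) (quad one 1 f) (quad one 0 f)
  => *; ring.
Qed.
Lemma formQ_scale l (c : R) f : ctest f -> formQ l (fun x => c * f x) = c ^+ 2 * formQ l f.
Proof.
move=> tf; have c1 := @cont_cst R 1.
rewrite /formQ /formE /formJ /formV /formK !quad_scale//.
by move: (quad rho 1 f) (quad rho 0 f) (quad (derive1 rho) 0 f) (quad one 2 f) (quad one 1 f) (quad one 0 f)
  => *; ring.
Qed.
(** The operator (a2 chi'')'' - (a1 chi')' + a0 chi with the middle term expanded. It is formally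
    self-adjoint, so the distributional equation read off from it is the Euler-Lagrange equation
    itself. *)
Definition adj l chi (x : R) : R := el_coef2 l * derive1n 4 chi x -
  (derive1 (el_coef1 l) x * derive1 chi x + el_coef1 l x * derive1n 2 chi x) + el_coef0 l x * chi x.
Lemma el_coef1_smooth l : cinf (el_coef1 l).
Proof. by apply: smoothD; [exact: smoothZ|exact: smooth_cst]. Qed.
Lemma el_coef0_smooth l : cinf (el_coef0 l).
Proof.
apply: smoothB; last by apply: smoothZ; exact: smooth_derive1.
by apply: smoothD; [exact: smoothZ|exact: smooth_cst].
Qed.
Lemma adj_test l chi : ctest chi -> ctest (adj l chi).
Proof.
move=> tc; have s1 := el_coef1_smooth l; have s0 := el_coef0_smooth l.
have t4 := testZ (el_coef2 l) (test_derive1n 4 tc).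
have t1 := testMr (smooth_derive1 s1) (test_derive1 tc).
have t2 := testMr s1 (test_derive1n 2 tc).
have t0 := testMr s0 tc.
have := testD (testD t4 (testZ (-1) (testD t1 t2))) t0.
by congr ctest; apply/funext => x; rewrite mulN1r.
Qed.
Lemma form_parts l f chi : ctest f -> ctest chi ->
  RI (fun x => el_coef2 l * (derive1n 2 f x * derive1n 2 chi x)) +
  RI (fun x => el_coef1 l x * (derive1n 1 f x * derive1n 1 chi x)) +
  RI (fun x => el_coef0 l x * (derive1n 0 f x * derive1n 0 chi x)) = RI (fun x => f x * adj l chi x).
Proof.
move=> tf tc; have s1 := el_coef1_smooth l; have s0 := el_coef0_smooth l.
have cf := test_continuous tf.
have t1 := test_derive1 tc; have t2 := test_derive1 t1; have t3 := test_derive1 t2.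
have t4 := test_derive1 t3; have tf1 := test_derive1 tf; have tf2 := test_derive1 tf1.
have D g : ctest g -> has_deriv g (derive1 g) by case=> /smooth_has_deriv.
have C g : ctest g -> continuous g by exact: test_continuous.
have S g : ctest g -> compact_support g by case.
have -> := parts2 (el_coef2 l) (D _ tf) (D _ tf1) (D _ t2) (D _ t3) (C _ tf1) (C _ tf2) (C _ t3) (C _ t4) (S _ t2).
have -> := parts1 (smooth_has_deriv s1) (D _ tf) (D _ t1) (smooth_continuous s1)
  (smooth_continuous (smooth_derive1 s1)) (C _ tf1) (C _ t1) (C _ t2) (S _ t1).
rewrite -RID; last 2 first.
- by apply: test_intgrM => //; exact: testZ.
- apply: test_intgrM => //.
  have := testZ (-1) (testD (testMr (smooth_derive1 s1) t1) (testMr s1 t2)).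
  by congr ctest; apply/funext => x; rewrite mulN1r.
have cc0 := smooth_continuous s0.
rewrite -RID; last 2 first.
- apply: intgrD; first by apply: test_intgrM => //; exact: testZ.
  apply: test_intgrM => //.
  have := testZ (-1) (testD (testMr (smooth_derive1 s1) t1) (testMr s1 t2)).
  by congr ctest; apply/funext => x; rewrite mulN1r.
- exact: test_intgr2 cc0 tf tc.
apply: RI_ext => x; rewrite /adj !derive1nS !derive1n0.
move: (el_coef2 l) (el_coef1 l x) (el_coef0 l x) (derive1 (el_coef1 l) x) (derive1 (derive1 (derive1 (derive1 chi))) x) => *.
by move: (derive1 (derive1 chi) x) (derive1 chi x) => *; ring.
Qed.
Lemma formQ_add l (t : R) f chi : ctest f -> ctest chi ->
  formQ l (fun x => f x + t * chi x) = formQ l f + 2 * t * RI (fun x => f x * adj l chi x) + t ^+ 2 * formQ l chi.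
Proof.
move=> tf tc; rewrite -form_parts// !formQE//; last by apply: testD => //; exact: testZ.
rewrite !quad_addf//; [|exact: smooth_continuous (el_coef0_smooth l)|exact: smooth_continuous (el_coef1_smooth l)|exact: cont_cst].
move: (RI _) (RI _) (RI _) (quad _ 2 f) (quad _ 2 chi) (quad _ 1 f) (quad _ 1 chi) (quad _ 0 f) (quad _ 0 chi).
by move=> *; ring.
Qed.
End Variational.

(** * Minimizing sequences *)

Section Arithmetic.
Context {R : realFieldType}.
Implicit Types (a b d e j l nu q t v : R).
Lemma small_parameter a e : 0 <= a -> e < 0 -> exists2 t, 0 < t <= 1 & t * a + e < 0.
Proof.
move=> a0 e0; pose d := - e / (2 * (a + 1)).
have p0 : 0 < 2 * (a + 1) by lra.
have dE : d * (2 * (a + 1)) = - e by rewrite /d divfK// gt_eqF.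
have d0 : 0 < d by rewrite divr_gt0// oppr_gt0.
have tpos : 0 < Num.min 1 d by rewrite lt_min ltr01.
have t1 : Num.min 1 d <= 1 by rewrite ge_min lexx.
have td : Num.min 1 d <= d by rewrite ge_min lexx orbT.
exists (Num.min 1 d); first by rewrite tpos.
have : Num.min 1 d * a <= d * a by rewrite ler_wpM2r.
by nra.
Qed.
Lemma quadratic_small j v e nu t : 0 <= j -> 0 < t <= 1 -> t * (j + nu * v) + e < 0 ->
  t ^+ 2 * j + t * nu * v + e < 0.
Proof.
move=> j0 /andP[t0 t1] H; have : t * t * j <= t * j by rewrite -mulrA ler_piMl// mulr_ge0// ltW.
by rewrite expr2; lra.
Qed.
(** Applied to a test function with int rho' f^2 = 1: [j] and [v] are J and V, [n] is the
    nonnegative magnetic part. Negativity at [l'], at least half of [l], gives l^2 j <= 4 G and l nu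
    v <= 2 G. Passing from [l'] to [l] costs (l - l') ((l + l') j + nu v), with (l + l') j <= 8 G /
    l and nu v <= 2 G / l, hence the factor 10. *)
Lemma sup_bounds l l' nu j v n G : 0 < l -> 0 < nu -> 0 < G -> l / 2 <= l' <= l ->
  0 <= j -> 0 <= v -> 0 <= n -> l' ^+ 2 * j + l' * nu * v + (n - G) < 0 ->
  [/\ j <= 4 * G / l ^+ 2, v <= 2 * G / (l * nu) &
     l ^+ 2 * j + l * nu * v + (n - G) <= (l - l') * (10 * G / l)].
Proof.
move=> l0 nu0 G0 /andP[l1 l2] j0 v0 n0 H.
have l'0 : 0 < l' by lra.
have a1 : 0 <= l' ^+ 2 * j by rewrite mulr_ge0// sqr_ge0.
have a2 : 0 <= l' * nu * v by rewrite mulr_ge0// mulr_ge0// ltW.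
have b1 : l ^+ 2 * j <= 4 * G.
  have : (l / 2) ^+ 2 * j <= l' ^+ 2 * j.
    apply: ler_wpM2r => //; rewrite lerXn2r// nnegrE; lra.
  by rewrite expr_div_n; lra.
have b2 : l * nu * v <= 2 * G.
  have : l / 2 * (nu * v) <= l' * (nu * v) by apply: ler_wpM2r => //; rewrite mulr_ge0// ltW.
  by rewrite -!mulrA in a2 *; lra.
have c1 : j <= 4 * G / l ^+ 2 by rewrite ler_pdivlMr ?exprn_gt0// mulrC.
have c2 : v <= 2 * G / (l * nu) by rewrite ler_pdivlMr ?mulr_gt0// mulrC.
split => //.
have d1 : l * j <= 4 * G / l by rewrite ler_pdivlMr// mulrAC -expr2.
have d2 : nu * v <= 2 * G / l by rewrite ler_pdivlMr// mulrC mulrA.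
have e1 : (l - l') * ((l + l') * j + nu * v) <= (l - l') * (10 * G / l).
  apply: ler_wpM2l; first lra.
  have : (l + l') * j <= 2 * (l * j) by rewrite mulrA ler_wpM2r//; lra.
  lra.
by rewrite (_ : l ^+ 2 * j = l' ^+ 2 * j + (l - l') * ((l + l') * j)); [lra|ring].
Qed.
End Arithmetic.

(** * Normalized almost minimizers at the critical growth rate *)

Section Minimizer.
Context {R : realType}.
Variables (rho : R -> R) (k nu G e0 e1 e2 c0 : R).
Hypotheses (k0 : 0 < k) (nu0 : 0 < nu) (G0 : 0 < G) (he0 : 0 <= e0) (he1 : 0 <= e1) (he2 : 0 <= e2).
Hypotheses (srho : cinf rho) (trho : ctest (derive1 rho)) (c00 : 0 < c0) (rho_ge : forall x, c0 <= rho x).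
Implicit Types (f g chi : R -> R) (l : R).
Local Notation one := (fun _ : R => 1 : R).
Local Notation K := (formK rho).
Local Notation J := (formJ rho k).
Local Notation V := (formV k).
Local Notation E := (formE rho G e0 e1 e2).
Local Notation Q := (formQ rho k nu G e0 e1 e2).
Let crho := smooth_continuous srho.
Let cdrho := test_continuous trho.
Lemma test_bounded f : ctest f -> exists2 B, 0 <= B & forall x, `|f x| <= B.
Proof.
move=> tf; pose B2 := quad one 0 f + quad one 1 f.
have B20 : 0 <= B2 by rewrite addr_ge0// quad_ge0.
exists (Num.sqrt B2); first exact: sqrtr_ge0.
by move=> x; rewrite -sqrtr_sqr ler_wsqrtr// test_sup_bound.
Qed.
Let J_ge f : ctest f -> c0 * (k ^+ 2 * quad one 0 f + quad one 1 f) <= J f.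
Proof.
move=> tf; have H i : c0 * quad one i f <= quad rho i f.
  rewrite -quad_scalew//; last exact: cont_cst.
  by apply: quad_le => //; [exact: cont_cst|move=> x; rewrite mulr1].
have := H 0%N; have := H 1%N; rewrite /formJ.
have : 0 <= k ^+ 2 by rewrite sqr_ge0.
move: (quad one 0 f) (quad one 1 f) (quad rho 0 f) (quad rho 1 f) (k ^+ 2) => a b c d m; nra.
Qed.
Let n_ge0 i f : 0 <= quad one i f. Proof. exact: quad_ge0. Qed.
Let J_ge0 f : ctest f -> 0 <= J f.
Proof.
move=> tf; apply: le_trans (J_ge tf); have := n_ge0 0 f; have := n_ge0 1 f => ? ?.
apply: mulr_ge0; first exact: ltW.
by apply: addr_ge0 => //; apply: mulr_ge0 => //; exact: sqr_ge0.
Qed.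
Let V_ge0 f : 0 <= V f.
Proof.
have H0 := n_ge0 0 f; have H1 := n_ge0 1 f; have H2 := n_ge0 2 f.
by rewrite /formV !addr_ge0// !mulr_ge0// ?exprn_ge0// ltW.
Qed.
Let N_ge0 f : 0 <= e2 * quad one 2 f + e1 * quad one 1 f + e0 * quad one 0 f.
Proof.
have H0 := n_ge0 0 f; have H1 := n_ge0 1 f; have H2 := n_ge0 2 f.
by rewrite !addr_ge0// mulr_ge0.
Qed.
Let K_le : exists2 C, 0 <= C & forall f, ctest f -> K f <= C * quad one 0 f.
Proof.
have [C C0 HC] := test_bounded trho; exists C => // f tf.
rewrite -quad_scalew//; last exact: cont_cst.
apply: quad_le => //; first exact: cont_cst.
by move=> x; rewrite mulr1 (le_trans (ler_norm _)).
Qed.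
(* [l] is the supremum of the growth rates at which the form takes a negative value:
   the form is nonnegative there, and the weight [formK = 1] keeps the almost
   minimizers from vanishing in the limit. *)
Lemma minimizing_sequence f0 : ctest f0 -> E f0 < 0 ->
  exists l, [/\ 0 < l, forall f, ctest f -> 0 <= Q l f & exists B, 0 <= B /\ forall n, exists f,
    [/\ ctest f, K f = 1, [/\ quad one 0 f <= B, quad one 1 f <= B & quad one 2 f <= B] &
     Q l f <= B / n.+1%:R]].
Proof.
move=> tf0 Ef0.
pose S := [set l : R | 0 < l /\ exists f, ctest f /\ Q l f < 0].
have S0 : S !=set0.
  have [|t t01 Ht] := @small_parameter _ (J f0 + nu * V f0) _ _ Ef0.
    by apply: addr_ge0; [exact: J_ge0|apply: mulr_ge0; [exact: ltW|exact: V_ge0]].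
  exists t; split; first by case/andP: t01.
  by exists f0; split => //; apply: quadratic_small => //; exact: J_ge0.
have [C C0 HC] := K_le.
have ub : has_ubound S.
  (* Beyond this value [l] is at least 1 and l^2 c0 k^2 >= G C, so the inertial term l^2 J dominates
     G K and the form cannot be negative. *)
  exists (1 + G * C / (c0 * k ^+ 2)) => l [l0 [f [tf Qf]]].
  rewrite leNgt; apply/negP => lU; move: Qf; apply/negP; rewrite -leNgt.
  have ck : 0 < c0 * k ^+ 2 by rewrite mulr_gt0// exprn_gt0.
  have U0 : 0 <= G * C / (c0 * k ^+ 2) by rewrite divr_ge0 ?mulr_ge0// ltW.
  have l1 : 1 <= l by lra.
  have H1 : G * C <= l ^+ 2 * (c0 * k ^+ 2).
    rewrite -ler_pdivrMr//; apply: (@le_trans _ _ l); first lra.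
    by rewrite expr2 ler_peMl// ltW.
  have := J_ge tf; have := HC _ tf; have := n_ge0 0 f; have := n_ge0 1 f; have := V_ge0 f; have := N_ge0 f.
  rewrite /formQ /formE.
  have lnu : 0 < l * nu by rewrite mulr_gt0.
  move: (V f) (J f) (K f) (e2 * quad one 2 f + e1 * quad one 1 f + e0 * quad one 0 f) => v j kk nn.
  move: (quad one 0 f) (quad one 1 f) => n0 n1 hnn hv h1 h0 hk hj.
  have a1 : 0 <= l * nu * v by rewrite mulr_ge0// ltW.
  have a2 : G * kk <= G * (C * n0) by rewrite ler_wpM2l// ltW.
  have a3 : G * C * n0 <= l ^+ 2 * (c0 * k ^+ 2) * n0 by rewrite ler_wpM2r.
  have a4 : l ^+ 2 * (c0 * (k ^+ 2 * n0)) <= l ^+ 2 * j.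
    apply: ler_wpM2l; first exact: sqr_ge0.
    by apply: le_trans hj; rewrite ler_pM2l// lerDl.
  lra.
have hS : has_sup S by split.
pose l := sup S; have lub := sup_upper_bound hS.
have l0 : 0 < l by case: S0 => s Ss; have := lub _ Ss; case: Ss => s0 _; rewrite -/l; lra.
have Qge f : ctest f -> 0 <= Q l f.
  move=> tf; rewrite leNgt; apply/negP => Qf.
  have J0 := J_ge0 tf; have V0 := V_ge0 f.
  (* Q at l + t equals Q_l + t (2 l J + nu V) + t^2 J, so negativity at the supremum would persist
     for some t > 0. *)
  have [|t t01 Ht] := @small_parameter _ (J f + (2 * l * J f + nu * V f)) _ _ Qf.
    apply: addr_ge0 => //; apply: addr_ge0; apply: mulr_ge0 => //; last exact: ltW.
    by rewrite mulr_ge0// ltW.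
  have tpos : 0 < t by case/andP: t01.
  suff : S (l + t) by move/lub; rewrite -/l; lra.
  split; first lra.
  exists f; split => //.
  have -> : Q (l + t) f = t ^+ 2 * J f + t * 1 * (2 * l * J f + nu * V f) + Q l f.
    by rewrite /formQ; move: (J f) (V f) (E f) => *; ring.
  by apply: quadratic_small => //; rewrite mul1r.
exists l; split => //.
(* One summand for each bound: on int f^2 and int f'^2 through J, on int f''^2 through V, and the
   factor of the gap in [sup_bounds]. *)
pose B := 4 * G / (l ^+ 2 * (c0 * k ^+ 2)) + 4 * G / (l ^+ 2 * c0) + 2 * G / (l * nu) + 10 * G / l.
have ck : 0 < c0 * k ^+ 2 by rewrite mulr_gt0// exprn_gt0.
have l20 : 0 < l ^+ 2 by rewrite exprn_gt0.
have b1 : 0 <= 4 * G / (l ^+ 2 * (c0 * k ^+ 2)) by rewrite divr_ge0 ?mulr_ge0 ?ltW// mulr_gt0.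
have b2 : 0 <= 4 * G / (l ^+ 2 * c0) by rewrite divr_ge0 ?mulr_ge0 ?ltW// mulr_gt0.
have b3 : 0 <= 2 * G / (l * nu) by rewrite divr_ge0 ?mulr_ge0 ?ltW// mulr_gt0.
have b4 : 0 <= 10 * G / l by rewrite divr_ge0 ?mulr_ge0 ?ltW.
exists B; split; first by rewrite /B; lra.
(* [l / 2] serves [sup_bounds], and the second entry gives the rate at which the form tends to
   zero. *)
move=> n; pose e := Num.min (l / 2) (n.+1%:R^-1).
have n0 : 0 < n.+1%:R^-1 :> R by rewrite invr_gt0.
have e00 : 0 < e by rewrite lt_min n0 divr_gt0.
have el : e <= l / 2 by rewrite ge_min lexx.
have en : e <= n.+1%:R^-1 by rewrite ge_min lexx orbT.
have [l' [l'0 [f [tf Qf]]] ll'] := sup_adherent e00 hS.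
have l'l : l' <= l by apply: lub; split => //; exists f.
rewrite -/l in ll'.
(* All other terms of the form are nonnegative, so a negative value forces the weight to be positive
   and allows normalization. *)
have Kf : 0 < K f.
  have := J_ge0 tf; have := V_ge0 f; have := N_ge0 f; move: Qf; rewrite /formQ /formE.
  move: (V f) (J f) (K f) (e2 * quad one 2 f + e1 * quad one 1 f + e0 * quad one 0 f) => v j kk nn q hn hv hj.
  have : 0 <= l' ^+ 2 * j by rewrite mulr_ge0// sqr_ge0.
  have : 0 <= l' * nu * v by rewrite mulr_ge0// mulr_ge0// ltW.
  by move=> ? ?; rewrite -(pmulr_rgt0 _ G0); lra.
pose c := (Num.sqrt (K f))^-1.
have c2 : c ^+ 2 = (K f)^-1 by rewrite /c exprVn sqr_sqrtr// ltW.
have c2pos : 0 < c ^+ 2 by rewrite c2 invr_gt0.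
pose h x := c * f x.
have th : ctest h := testZ c tf.
have Kh : K h = 1 by rewrite /formK quad_scale// -/(K f) c2 mulVf// gt_eqF.
have Qh : Q l' h < 0 by rewrite formQ_scale// pmulr_rlt0.
have QE l1 : Q l1 h = l1 ^+ 2 * J h + l1 * nu * V h + (e2 * quad one 2 h + e1 * quad one 1 h + e0 * quad one 0 h - G).
  by rewrite /formQ /formE Kh mulr1.
rewrite QE in Qh.
have ll2 : l / 2 <= l' <= l by apply/andP; split => //; lra.
have [hJ hV hQ] := sup_bounds l0 nu0 G0 ll2 (J_ge0 th) (V_ge0 h) (N_ge0 h) Qh.
rewrite -QE in hQ.
exists h; split => //.
  have hJ' := le_trans (J_ge th) hJ.
  have H0 := n_ge0 0 h; have H1 := n_ge0 1 h; have H2 := n_ge0 2 h.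
  have k20 : 0 <= k ^+ 2 := sqr_ge0 k.
  have k40 : 0 <= k ^+ 4 by rewrite exprn_ge0// ltW.
  split.
  - apply: (@le_trans _ _ (4 * G / (l ^+ 2 * (c0 * k ^+ 2)))); last by rewrite /B; lra.
    rewrite invfM mulrA ler_pdivlMr// mulrC; apply: le_trans hJ'.
    by rewrite -mulrA ler_pM2l// lerDl.
  - apply: (@le_trans _ _ (4 * G / (l ^+ 2 * c0))); last by rewrite /B; lra.
    rewrite invfM mulrA ler_pdivlMr// mulrC; apply: le_trans hJ'.
    by rewrite ler_pM2l// lerDr mulr_ge0.
  - apply: (@le_trans _ _ (2 * G / (l * nu))); last by rewrite /B; lra.
    apply: le_trans hV; rewrite /formV -addrA lerDl.
    by apply: addr_ge0; apply: mulr_ge0 => //; rewrite mulr_ge0.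
apply: (le_trans hQ).
apply: (@le_trans _ _ (n.+1%:R^-1 * (10 * G / l))).
  apply: ler_wpM2r => //; apply: le_trans en.
  by rewrite lerBlDr -lerBlDl; exact: ltW.
by rewrite mulrC; apply: ler_wpM2r; [exact: ltW|rewrite /B; lra].
Qed.
End Minimizer.

(** * Passage to the limit *)

Section UltraLimit.
Context {R : realType}.
Lemma ultra_fmap (T U : Type) (f : T -> U) (F : set_system T) :
  UltraFilter F -> UltraFilter (f @ F).
Proof.
move=> FU; have PF : ProperFilter F by exact: ultra_proper.
split=> [|G GF sFG]; first exact: fmap_proper_filter.
apply/seteqP; split => // A GA.
have [//|FnA] := in_ultra_setVsetC (f @^-1` A) FU.
have GnA : G (~` A) by apply: sFG.
have G0 : G set0 by rewrite -(setICr A); apply: filterI.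
by have := @filter_not_empty _ G GF.
Qed.
(* Pointwise limits along an ultrafilter; equicontinuity makes them locally uniform
   along suitable indices. *)
Lemma lipschitz_limit (fn : nat -> R -> R) (M : R) : 0 <= M ->
  (forall n x, `|fn n x| <= M) -> (forall n x y, `|fn n x - fn n y| <= M * `|x - y|) ->
  exists psi : R -> R, [/\ forall x, `|psi x| <= M, forall x y, `|psi x - psi y| <= M * `|x - y| &
    forall (r e : R) N, 0 < e -> exists n, (N <= n)%N /\ forall x, `|x| <= r -> `|fn n x - psi x| <= e].
Proof.
move=> M0 fb fl.
have [U [UU sU]] : exists U, UltraFilter U /\ (\oo : set_system nat) `<=` U by exact: ultraFilterLemma.
have PU : ProperFilter U by exact: ultra_proper.
have lim x : exists p, `|p| <= M /\ forall e, 0 < e -> U [set n | `|fn n x - p| < e].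
  have cK := @segment_compact R (- M) M; rewrite compact_ultra in cK.
  have [|p [/= pM pU]] := cK _ (ultra_fmap (fun n => fn n x) UU).
    rewrite /fmap /=; apply: filterS (filterT) => n _ /=.
    by rewrite in_itv /= -ler_norml.
  exists p; split; first by move: pM; rewrite in_itv /= -ler_norml.
  move/cvgrPdist_lt: pU => H e e0.
  by apply: filterS (H e e0) => n /=; rewrite distrC.
have [psi Hpsi] := choice lim.
have b x := (Hpsi x).1; have c x := (Hpsi x).2.
have lp x y : `|psi x - psi y| <= M * `|x - y|.
  apply/ler_addgt0Pr => e e0; have e20 : 0 < e / 2 by rewrite divr_gt0.
  have [n [/= h1 h2]] := filter_ex (filterI (c x _ e20) (c y _ e20)).
  have -> : psi x - psi y = (fn n x - fn n y) - (fn n x - psi x) + (fn n y - psi y) by ring.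
  apply: (le_trans (ler_normD _ _)); have := ler_normB (fn n x - fn n y) (fn n x - psi x).
  by have := fl n x y; lra.
exists psi; split => // r e N e0.
(* Mesh of a grid on [-r, r] for an argument in three thirds of [e]: the Lipschitz bound costs at
   most [e / 3] within one cell, once for [fn n] and once for [psi]. *)
pose d := e / (3 * (M + 1)); have M1 : 0 < 3 * (M + 1) by lra.
have d0 : 0 < d by rewrite divr_gt0.
have Md : M * d <= e / 3.
  have : d * (3 * (M + 1)) = e by rewrite divfK// gt_eqF.
  by nra.
pose xi (i : nat) := - r + i%:R * d.
have e30 : 0 < e / 3 by rewrite divr_gt0.
(* Only finitely many grid points are imposed, so one member of the ultrafilter serves them all; it
   meets every tail of the indices. *)
have fin m : U [set n | forall i, (i < m)%N -> `|fn n (xi i) - psi (xi i)| < e / 3].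
  elim: m => [|m IH]; first by apply: filterS filterT.
  apply: filterS (filterI IH (c (xi m) _ e30)) => n [/= h1 h2] i.
  by rewrite ltnS leq_eqVlt => /predU1P[->//|]; exact: h1.
have UN : U [set n | (N <= n)%N] by apply: sU; exists N.
pose m := (Num.truncn (2 * r / d)).+1.
have [n [/= nN Hn]] := filter_ex (filterI UN (fin m)).
exists n; split => // x; rewrite ler_norml => /andP[x1 x2].
pose i := Num.truncn ((x + r) / d).
have xr : 0 <= (x + r) / d by apply: divr_ge0; [lra|exact: ltW].
have /andP[i1 i2] := truncn_itv xr.
have im : (i < m)%N.
  have rr : 0 <= 2 * r / d by apply: divr_ge0; [lra|exact: ltW].
  have /andP[_ m2] := truncn_itv rr.
  rewrite -(ltr_nat R); apply: le_lt_trans i1 _; apply: le_lt_trans m2.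
  by rewrite ler_pM2r ?invr_gt0//; lra.
have hi := Hn _ im.
have xx : `|x - xi i| <= d.
  rewrite ler_pdivlMr// in i1; rewrite ltr_pdivrMr// in i2.
  rewrite ler_norml /xi; move: i1 i2; rewrite -/i -natr1 => i1 i2; apply/andP; split; lra.
have Mx : M * `|x - xi i| <= e / 3 by apply: le_trans Md; rewrite ler_wpM2l.
have h1 := fl n x (xi i); have h2 := lp (xi i) x; rewrite distrC in h2.
have -> : fn n x - psi x = (fn n x - fn n (xi i)) + (fn n (xi i) - psi (xi i)) - (psi x - psi (xi i)) by ring.
apply: (le_trans (ler_normB _ _)); have := ler_normD (fn n x - fn n (xi i)) (fn n (xi i) - psi (xi i)).
by move: h2 hi h1 Mx; rewrite [`|xi i - x|]distrC; lra.
Qed.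
Lemma lipschitz_continuous (f : R -> R) (M : R) : (forall x y, `|f x - f y| <= M * `|x - y|) -> continuous f.
Proof.
move=> H x; apply/cvgrPdist_le => /= e e0; near=> y.
apply: (le_trans (H x y)).
have M1 : M <= `|M| + 1 by have := ler_norm M; lra.
have p : 0 < `|M| + 1 by rewrite ltr_wpDl.
apply: (@le_trans _ _ ((`|M| + 1) * `|x - y|)); first by rewrite ler_wpM2r.
rewrite mulrC -ler_pdivlMr//; near: y.
apply: cvgr_dist_le; first exact: cvg_id.
by rewrite divr_gt0.
Unshelve. all: by end_near. Qed.
End UltraLimit.

(** * The Euler-Lagrange equation for the limit *)

Section EulerLagrange.
Context {R : realType}.
Variables (rho : R -> R) (k nu G e0 e1 e2 c0 : R).
Hypotheses (k0 : 0 < k) (nu0 : 0 < nu) (G0 : 0 < G) (he0 : 0 <= e0) (he1 : 0 <= e1) (he2 : 0 <= e2).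
Hypotheses (srho : cinf rho) (trho : ctest (derive1 rho)) (c00 : 0 < c0) (rho_ge : forall x, c0 <= rho x).
Local Notation Q := (formQ rho k nu G e0 e1 e2).
(* A nonnegative form that is almost zero at [f] is almost orthogonal to [f], by
   Cauchy-Schwarz, so the equation only needs locally uniform convergence once all
   derivatives are moved to the test function. *)
Lemma euler_lagrange f0 : ctest f0 -> formE rho G e0 e1 e2 f0 < 0 ->
  exists l, 0 < l /\ exists psi : R -> R, [/\
    exists M, forall x, `|psi x| <= M,
    exists M, forall x y, `|psi x - psi y| <= M * `|x - y|,
    exists x, psi x != 0 &
    forall chi, ctest chi -> RI (fun x => psi x * adj rho k nu G e0 e1 e2 l chi x) = 0].
Proof.
move=> tf0 Ef0.
have [l [l0 Qge [B [B0 HB]]]] := minimizing_sequence k0 nu0 G0 he0 he1 he2 srho trho c00 rho_ge tf0 Ef0.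
exists l; split => //.
have [fn Hfn] := choice HB.
pose M := Num.sqrt (B + B).
have M0 : 0 <= M by exact: sqrtr_ge0.
have tfn n : ctest (fn n) by case: (Hfn n).
have sb f x : ctest f -> quad (fun=> 1) 0 f <= B -> quad (fun=> 1) 1 f <= B -> `|f x| <= M.
  move=> tf h0 h1; rewrite -sqrtr_sqr ler_wsqrtr// (le_trans (test_sup_bound x tf))//.
  exact: lerD.
have fb n x : `|fn n x| <= M by case: (Hfn n) => tf _ [h0 h1 h2] _; exact: sb.
have fl n x y : `|fn n x - fn n y| <= M * `|x - y|.
  have [[sf _] _ [h0 h1 h2] _] := Hfn n.
  apply: (lipschitz_deriv (smooth_has_deriv sf)) => z; apply: sb; first exact: test_derive1.
    by move: h1; rewrite !quadE.
  by move: h2; rewrite !quadE.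
have [psi [pb pl pc]] := lipschitz_limit M0 fb fl.
have cpsi := lipschitz_continuous pl.
exists psi; split; [by exists M|by exists M| |].
- apply: contrapT => /forallNP H.
  have [Cr Cr0 HCr] := test_bounded trho.
  have [_ [r kr]] := trho.
  pose A := RI (fun x => `|derive1 rho x|).
  have cdr := test_continuous trho.
  have iA : intgr (fun x => `|derive1 rho x|) by apply: intgr_norm; exact: test_intgr.
  have A0 : 0 <= A by apply: RI_ge0.
  (* If the limit vanished, f_n^2 would be at most [e] on the support of rho' for some n, and int
     rho' f_n^2 <= A e < 1 would contradict the normalization. *)
  pose e := (A + 1)^-1 / 2.
  have e1' : 0 < (A + 1)^-1 by rewrite invr_gt0; lra.
  have e0' : 0 < Num.min 1 e by rewrite lt_min ltr01 divr_gt0.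
  have [n [_ Hn]] := pc r _ 0%N e0'.
  have [tf K1 _ _] := Hfn n.
  have Hx x : `|x| <= r -> fn n x ^+ 2 <= e.
    move=> xr; have := Hn x xr; have -> : psi x = 0 by apply/eqP/negbNE/negP; exact: H.
    rewrite subr0 le_min => /andP[h1 h2].
    rewrite -real_normK ?num_real// expr2 -[e]mul1r; exact: ler_pM.
  have : formK rho (fn n) <= A * e.
    rewrite /formK quadE mulrC -RIZ//; apply: RI_le.
    + by apply: test_intgr_sqr.
    + exact: intgrZ.
    move=> x /=; have [xr|xr] := leP `|x| r; last by rewrite kr// mul0r normr0 mulr0.
    rewrite mulrC; apply: (@le_trans _ _ (fn n x ^+ 2 * `|derive1 rho x|)).
      by rewrite ler_wpM2l ?sqr_ge0// ler_norm.
    by rewrite ler_wpM2r// Hx.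
  rewrite K1; apply/negP; rewrite -ltNge /e.
  rewrite mulrA ltr_pdivrMr// ltr_pdivrMr; lra.
move=> chi tc.
have sl := el_coef1_smooth k nu e1 srho l.
have ta := adj_test k nu G e0 e1 e2 srho l tc.
have [_ [r kr]] := ta; have ca := test_continuous ta.
pose a := adj rho k nu G e0 e1 e2 l chi; rewrite -/a in ta kr ca *.
pose A := RI (fun x => `|a x|).
have iA : intgr (fun x => `|a x|) by apply: intgr_norm; exact: test_intgr.
have A0 : 0 <= A by apply: RI_ge0.
have ip (f : R -> R) : continuous f -> intgr (fun x => f x * a x) by move=> cf; exact: test_intgrM.
have Qc := Qge _ tc.
pose I := RI (fun x => psi x * a x).
(* Expands 0 <= Q_l (f_n - t chi), with n so large that Q_l (f_n) <= e and f_n is within [e] of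
   [psi] on the support of the test function [a]. *)
have key (t e : R) : 0 < e -> 2 * t * I <= 2 * `|t| * (A * e) + e + t ^+ 2 * Q l chi.
  move=> ep.
  have [n [nN Hn]] := pc r e (Num.truncn (B / e)) ep.
  have [tf _ _ hQ] := Hfn n.
  have BE : B / n.+1%:R <= e.
    rewrite ler_pdivrMr// mulrC -ler_pdivrMr//.
    have Be : 0 <= B / e by rewrite divr_ge0// ltW.
    have /andP[_ h] := truncn_itv Be.
    by apply: (le_trans (ltW h)); rewrite ler_nat.
  have H := formQ_add k nu G e0 e1 e2 srho trho l (- t) tf tc.
  have := Qge _ (testD tf (testZ (- t) tc)); rewrite H -/a => H1.
  have cf := test_continuous tf.
  have H2 : `|I - RI (fun x => fn n x * a x)| <= A * e.
    rewrite /I -RIB; [|exact: ip|exact: ip].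
    have ii : intgr (fun x => psi x * a x - fn n x * a x) by apply: intgrB; exact: ip.
    apply: (le_trans (RI_norm ii)); rewrite mulrC -RIZ//; apply: RI_le.
    + exact: intgr_norm.
    + exact: intgrZ.
    move=> x /=; rewrite -mulrBl normrM.
    have [xr|xr] := leP `|x| r; last by rewrite kr// normr0 !mulr0.
    by rewrite ler_wpM2r// distrC Hn.
  have H3 : 2 * t * (I - RI (fun x => fn n x * a x)) <= 2 * `|t| * (A * e).
    apply: (le_trans (ler_norm _)); rewrite !normrM ger0_norm// ler_wpM2l//.
  move: H1 H3 hQ BE; rewrite sqrrN.
  move: (RI _) (Q l chi) (Q l (fn n)) (B / _) => u v w z *; nra.
have key2 (t : R) : 2 * t * I <= t ^+ 2 * Q l chi.
  apply/ler_addgt0Pr => e ep.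
  have p : 0 < 2 * `|t| * A + 1 by rewrite ltr_wpDl// !mulr_ge0.
  have := key t (e / (2 * `|t| * A + 1)) (divr_gt0 ep p).
  rewrite [X in _ <= X + _ -> _](_ : _ = e); first by rewrite addrC.
  by field; rewrite gt_eqF.
apply/eqP; rewrite -/I; apply/negPn/negP => I0.
have p : 0 < Q l chi + 1 by lra.
(* A linear term bounded by a quadratic one for every t must vanish. The [+ 1] keeps the denominator
   positive when Q_l (chi) = 0. *)
have := key2 (I / (Q l chi + 1)).
have I2 : 0 < I ^+ 2 by rewrite exprn_even_gt0.
rewrite (_ : 2 * _ * I = (2 * I ^+ 2) / (Q l chi + 1)); last by field; rewrite gt_eqF.
rewrite ler_pdivrMr//.
rewrite (_ : _ * (Q l chi + 1) = I ^+ 2 * (Q l chi / (Q l chi + 1))); last by field; rewrite gt_eqF.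
have : Q l chi / (Q l chi + 1) <= 1 by rewrite ler_pdivrMr//; lra.
nra.
Qed.
End EulerLagrange.

(** * Behaviour at infinity *)

Section Tails.
Context {R : realType}.
Implicit Types (f g h : R -> R) (r k tau M : R).
Lemma MVTx f f' (x y : R) : has_deriv f f' -> x < y -> exists2 c, x < c < y & f y - f x = f' c * (y - x).
Proof.
move=> df xy; have [c] := @MVT _ f f' x y xy (fun z _ => df z)
    (continuous_subspaceT (has_deriv_continuous df)).
by rewrite in_itv; exists c.
Qed.
Lemma mono_ray f f' r : has_deriv f f' -> (forall x, r < x -> 0 <= f' x) ->
  forall x y, r < x -> x <= y -> f x <= f y.
Proof.
move=> df f0 x y rx; rewrite le_eqVlt => /predU1P[->//|xy].
have [c /andP[xc _] E] := MVTx df xy; rewrite -subr_ge0 E mulr_ge0//.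
  by apply: f0; lra.
by rewrite subr_ge0 ltW.
Qed.
Lemma const_ray f f' r : has_deriv f f' -> (forall x, r < x -> f' x = 0) ->
  forall x y, r < x -> r < y -> f x = f y.
Proof.
move=> df f0 x y rx ry; wlog xy : x y rx ry / x <= y.
  by move=> H; have [/ltW|] := ltP x y; [exact: H|move/(H _ _ ry rx)].
move: xy; rewrite le_eqVlt => /predU1P[->//|xy].
have [c /andP[xc _] E] := MVTx df xy.
by apply/eqP; rewrite eq_sym -subr_eq0 E f0 ?mul0r//; lra.
Qed.
Lemma deriv_ray f f' r : has_deriv f f' -> (forall x, r < x -> f x = 0) -> forall x, r < x -> f' x = 0.
Proof.
move=> df f0 x rx; apply/esym.
suff H : is_derive x (1 : R) f 0 by case: (H) => _ <-; case: (df x) => _ <-.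
have := @has_deriv_cst R 0 x; apply: near_eq_is_derive.
near=> y; apply/esym; rewrite f0//; near: y.
have cid : continuous (fun y : R => y) by exact: has_deriv_continuous (@has_deriv_id R).
by have /cvgr_gt := cid x; apply.
Unshelve. all: by end_near. Qed.
Lemma has_deriv_expR (c : R) : has_deriv (fun x => expR (c * x)) (fun x => c * expR (c * x)).
Proof.
have d : has_deriv (@expR R) (@expR R) by move=> x; exact: is_derive_expR.
have := has_deriv_comp d (has_derivZ c (@has_deriv_id R)).
by move/has_deriv_eq; apply => x; rewrite mulr1 mulrC.
Qed.
Lemma first_order_ray f f' r (c : R) : has_deriv f f' -> (forall x, r < x -> f' x = c * f x) ->
  exists A, forall x, r < x -> f x = A * expR (c * x).
Proof.
move=> df H; pose g x := f x * expR (- c * x).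
have dg := has_derivM df (has_deriv_expR (- c)).
exists (g (r + 1)) => x rx.
have r1 : r < r + 1 by rewrite ltrDl.
have -> : g (r + 1) = g x.
  by apply: (const_ray dg _ r1 rx) => y ry; rewrite H//; ring.
by rewrite /g -mulrA -expRD mulNr addNr expR0 mulr1.
Qed.
Lemma expR_grow (A c r M : R) : 0 < c -> (forall x, r < x -> A * expR (c * x) <= M) -> A <= 0.
Proof.
move=> c0 H; rewrite leNgt; apply/negP => A0.
pose x := `|r| + 1 + `|M| / (A * c).
have Ac : 0 < A * c by rewrite mulr_gt0.
have q0 : 0 <= `|M| / (A * c) by apply: divr_ge0 => //; exact: ltW.
have rx : r < x by rewrite /x; have := ler_norm r; lra.
have x0 : 0 <= x by rewrite /x; have := normr_ge0 r; lra.
have := H x rx; apply/negP; rewrite -ltNge.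
have e1 := expR_ge1Dx (c * x).
apply: (@lt_le_trans _ _ (A * (1 + c * x))); last by rewrite ler_pM2l.
apply: (le_lt_trans (ler_norm M)).
have : `|M| = (A * c) * (`|M| / (A * c)) by rewrite mulrC divfK// gt_eqF.
have : A * c * (`|M| / (A * c)) <= A * c * x.
  by rewrite ler_pM2l// /x; have := normr_ge0 r; lra.
by rewrite [A * (1 + _)]mulrDr mulr1 mulrA; lra.
Qed.
(* The equation reads (D^2 - k^2)(D^2 - tau^2) f = 0; boundedness of [f] and [f'] removes
   the modes exp(tau x) and exp(k x). The roots [k] and [tau] may coincide, hence no
   explicit formula for [f]. *)
Lemma tail_first_order f f1 f2 f3 f4 r k tau M : 0 < k -> 0 < tau ->
  has_deriv f f1 -> has_deriv f1 f2 -> has_deriv f2 f3 -> has_deriv f3 f4 ->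
  (forall x, `|f x| <= M) -> (forall x, `|f1 x| <= M) -> 0 <= r ->
  (forall x, r < x -> f4 x = (k ^+ 2 + tau ^+ 2) * f2 x - k ^+ 2 * tau ^+ 2 * f x) ->
  exists B, forall x, r < x -> f1 x = - k * f x + B * expR (- tau * x).
Proof.
move=> k0 t0 d0 d1 d2 d3 b0 b1 r0 H.
have cf := has_deriv_continuous d0.
(* z = (D^2 - k^2) f satisfies z'' = tau^2 z on the ray; its two first-order factors are solved
   separately. *)
pose z x := f2 x - k ^+ 2 * f x.
pose z1 x := f3 x - k ^+ 2 * f1 x.
have dz : has_deriv z z1 := has_derivB d2 (has_derivZ _ d0).
have dz1 := has_derivB d3 (has_derivZ (k ^+ 2) d1).
have [P HP] : exists P, forall x, r < x -> z1 x + tau * z x = P * expR (tau * x).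
  apply: (first_order_ray (has_derivD dz1 (has_derivZ tau dz))) => x rx /=.
  by rewrite H// /z /z1; ring.
have [S HS] : exists S, forall x, r < x -> z1 x - tau * z x = S * expR (- tau * x).
  apply: (first_order_ray (has_derivB dz1 (has_derivZ tau dz))) => x rx /=.
  by rewrite H// /z /z1; ring.
have zE x : r < x -> 2 * tau * z x = P * expR (tau * x) - S * expR (- tau * x).
  by move=> rx; rewrite -HP// -HS//; ring.
have e1 x : r < x -> expR (- tau * x) <= 1.
  by move=> rx; rewrite mulNr expR_le1 oppr_le0 mulr_ge0// ltW//; lra.
have M0 : 0 <= M by apply: le_trans (b0 0).
have k20 : 0 <= k ^+ 2 by exact: sqr_ge0.
(* No bound on f'' is available, so [z] is not controlled pointwise. Its mean over [x, x + 1]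
   involves only f and f', which gives a good point in each such interval. *)
have zavg x : r < x -> exists2 y, x < y & `|z y| <= 2 * M + k ^+ 2 * M.
  move=> rx; have dH := has_derivB d1 (has_derivZ (k ^+ 2) (prim_deriv cf)).
  have xx : x < x + 1 by rewrite ltrDl.
  have [y /andP[xy _] E] := MVTx dH xx.
  have [y' _ E'] := MVTx (prim_deriv cf) xx.
  have x11 : x + 1 - x = 1 by ring.
  exists y => //; move: E E'; rewrite x11 !mulr1 -/(z y) => <- E'.
  have -> : f1 (x + 1) - k ^+ 2 * prim f (x + 1) - (f1 x - k ^+ 2 * prim f x) =
    f1 (x + 1) - f1 x - k ^+ 2 * f y' by rewrite -E'; ring.
  apply: (le_trans (ler_normB _ _)); apply: lerD.
    by apply: (le_trans (ler_normB _ _)); have := b1 x; have := b1 (x + 1); lra.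
  by rewrite normrM (ger0_norm k20) ler_wpM2l.
have P0 : P = 0.
  pose M' := 2 * tau * (2 * M + k ^+ 2 * M) + `|S|.
  (* The sign [s] is 1 or -1. If s P >= 0, then s P exp(tau x) increases, so the bound at the good
     point to the right of [x] carries over to [x]. *)
  have bound (s : R) : `|s| = 1 -> s * P <= 0.
    move=> s1; apply: (@expR_grow _ tau r M' t0) => x rx.
    rewrite leNgt; apply/negP => Hlt.
    have [y xy zy] := zavg x rx; have ry : r < y by lra.
    have ex : expR (tau * x) <= expR (tau * y) by rewrite ler_expR ler_pM2l// ltW.
    have sP : 0 <= s * P.
      rewrite leNgt; apply/negP => sP0; move: Hlt; apply/negP; rewrite -leNgt.
      apply: (@le_trans _ _ 0); first by rewrite nmulr_rle0// expR_ge0.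
      by rewrite /M' addr_ge0// mulr_ge0// ?addr_ge0 ?mulr_ge0// ltW.
    have : s * P * expR (tau * y) <= M'.
      have -> : s * P * expR (tau * y) = s * (2 * tau * z y) + s * (S * expR (- tau * y)).
        by rewrite zE//; ring.
      rewrite /M'; apply: (le_trans (ler_norm _)); apply: (le_trans (ler_normD _ _)).
      rewrite !normrM s1 !mul1r; apply: lerD.
        by rewrite (ger0_norm (ltW t0)) ger0_norm// ler_wpM2l// mulr_ge0// ltW.
      by rewrite (ger0_norm (expR_ge0 _)) ler_piMr// e1.
    have : s * P * expR (tau * x) <= s * P * expR (tau * y) by rewrite ler_wpM2l.
    lra.
  have := bound 1; have := bound (-1); rewrite normrN normr1 => /(_ erefl) + /(_ erefl).
  by rewrite mulN1r mul1r => ? ?; apply/eqP; rewrite eq_le; apply/andP; split; lra.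
pose B0 := - S / (2 * tau).
have zB x : r < x -> z x = B0 * expR (- tau * x).
  move=> rx; have := zE x rx; rewrite P0 mul0r sub0r /B0 => E.
  have t00 : tau != 0 by rewrite gt_eqF.
  by rewrite mulrAC mulNr -E; field.
have kt : 0 < k + tau by rewrite addr_gt0.
(* Adding B1 exp(-tau x) to f' + k f produces a solution of w' = k w. The denominator is a sum, so
   the case k = tau causes no resonance here. *)
pose B1 := B0 / (k + tau).
have dw := has_derivD (has_derivD d1 (has_derivZ k d0)) (has_derivZ B1 (has_deriv_expR (- tau))).
have [W HW] : exists W, forall x, r < x -> f1 x + k * f x + B1 * expR (- tau * x) = W * expR (k * x).
  apply: (first_order_ray dw) => x rx /=.
  have := zB x rx; rewrite /z => E.
  have -> : f2 x = k ^+ 2 * f x + B0 * expR (- tau * x) by rewrite -E; ring.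
  have -> : B0 = B1 * (k + tau) by rewrite /B1 divfK// gt_eqF.
  by ring.
have W0 : W = 0.
  pose M' := M + k * M + `|B1|.
  have bound (s : R) : `|s| = 1 -> s * W <= 0.
    move=> s1; apply: (@expR_grow _ k r M' k0) => x rx.
    rewrite -mulrA -HW//; apply: (le_trans (ler_norm _)); rewrite normrM s1 mul1r.
    apply: (le_trans (ler_normD _ _)); apply: lerD.
      apply: (le_trans (ler_normD _ _)); apply: lerD => //.
      by rewrite normrM (gtr0_norm k0) ler_pM2l.
    by rewrite normrM (ger0_norm (expR_ge0 _)) ler_piMr// e1.
  have := bound 1; have := bound (-1); rewrite normrN normr1 => /(_ erefl) + /(_ erefl).
  by rewrite mulN1r mul1r => ? ?; apply/eqP; rewrite eq_le; apply/andP; split; lra.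
exists (- B1) => x rx; have := HW x rx; rewrite W0 mul0r; lra.
Qed.
(** The derivative of f exp(k x) is B exp((k - tau) x), dominated by that of L exp((k - d) x);
    comparing monotone functions replaces integration. Halving the minimum of k and tau absorbs the
    factor x that appears when they coincide. *)
Lemma tail_decay f f1 r k tau M B : 0 < k -> 0 < tau -> has_deriv f f1 ->
  (forall x, `|f x| <= M) -> 0 <= r ->
  (forall x, r < x -> f1 x = - k * f x + B * expR (- tau * x)) ->
  exists C d, [/\ 0 < d, d <= tau & forall x, r < x -> `|f x| <= C * expR (- d * x)].
Proof.
move=> k0 t0 d0 b0 r0 H.
pose m := Num.min k tau.
have m0 : 0 < m by rewrite lt_min k0.
have mk : m <= k by rewrite ge_min lexx.
have mt : m <= tau by rewrite ge_min lexx orbT.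
pose d := m / 2; have dpos : 0 < d by rewrite divr_gt0.
have dk : 0 < k - d by rewrite /d; lra.
have dt : d <= tau by rewrite /d; lra.
pose L := `|B| / (k - d).
have L0 : 0 <= L by apply: divr_ge0 => //; exact: ltW.
have dS := has_derivZ L (has_deriv_expR (k - d)).
have dy := has_derivM d0 (has_deriv_expR k).
have M0 : 0 <= M by apply: le_trans (b0 0).
have yb x : r < x -> `|f1 x * expR (k * x) + f x * (k * expR (k * x))| <= L * ((k - d) * expR ((k - d) * x)).
  move=> rx; rewrite H//.
  have -> : (- k * f x + B * expR (- tau * x)) * expR (k * x) + f x * (k * expR (k * x)) =
    B * expR ((k - tau) * x) by rewrite mulrBl expRD -[in RHS]mulNr; ring.
  rewrite mulrA divfK ?gt_eqF// normrM (ger0_norm (expR_ge0 _)) ler_wpM2l// ler_expR ler_wpM2r//; lra.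
(* The equation holds strictly to the right of [r], so the comparison starts at [s]; between [r] and
   [s] the global bound [M] is used. *)
pose s := r + 1.
pose C1 := `|f s| * expR (k * s) + L.
exists (C1 + M * expR (d * s)), d; split => // x rx.
have C10 : 0 <= C1 by rewrite addr_ge0// mulr_ge0// expR_ge0.
have [sx|xs] := leP s x; last first.
  apply: (le_trans (b0 x)); rewrite mulrDl; apply: (@le_trans _ _ (M * expR (d * s) * expR (- d * x))); last first.
    by rewrite lerDr mulr_ge0// expR_ge0.
  rewrite -mulrA -expRD ler_peMr// -expR0 ler_expR mulNr -mulrBr mulr_ge0// ?ltW//; lra.
have rs : r < s by rewrite ltrDl.
have up : `|f x * expR (k * x)| <= `|f s| * expR (k * s) + L * expR ((k - d) * x).
  have H1 := mono_ray (has_derivB dS dy) _ rs sx; have H2 := mono_ray (has_derivD dS dy) _ rs sx.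
  have e0 : 0 <= L * expR ((k - d) * s) by rewrite mulr_ge0// expR_ge0.
  have e1 : `|f s * expR (k * s)| = `|f s| * expR (k * s) by rewrite normrM (ger0_norm (expR_ge0 _)).
  have := ler_norm (f s * expR (k * s)); have := ler_norm (- (f s * expR (k * s))); rewrite normrN e1 => n1 n2.
  have {}H1 : L * expR ((k - d) * s) - f s * expR (k * s) <= L * expR ((k - d) * x) - f x * expR (k * x).
    apply: H1 => y ry; rewrite subr_ge0; apply: le_trans (yb y ry); exact: ler_norm.
  have {}H2 : L * expR ((k - d) * s) + f s * expR (k * s) <= L * expR ((k - d) * x) + f x * expR (k * x).
    apply: H2 => y ry; have := yb y ry; rewrite ler_norml => /andP[+ _]; lra.
  by rewrite ler_norml; apply/andP; split; lra.
have Ex : expR (- d * x) * expR (k * x) = expR ((k - d) * x) by rewrite -expRD; congr expR; ring.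
rewrite -(ler_pM2r (expR_gt0 (k * x))) -mulrA Ex.
move: up; rewrite normrM [X in _ * X <= _](ger0_norm (expR_ge0 _)) => /le_trans; apply.
have E1 : 1 <= expR ((k - d) * x) by rewrite -expR0 ler_expR mulr_ge0// ?ltW//; lra.
move: E1; set u := expR ((k - d) * x) => E1.
rewrite /C1 !mulrDl.
have : `|f s| * expR (k * s) <= `|f s| * expR (k * s) * u by rewrite ler_peMr// mulr_ge0// expR_ge0.
have : 0 <= M * expR (d * s) * u by rewrite !mulr_ge0// expR_ge0.
lra.
Qed.
Lemma exp_decay_cvg f (C d : R) : 0 < d -> (forall x, 0 <= x -> `|f x| <= C * expR (- (d * x))) ->
  f x @[x --> +oo] --> 0.
Proof.
move=> d0 H; apply/cvgrPdist_le => e e0.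
pose X := `|C| / (e * d).
have ed : 0 < e * d by rewrite mulr_gt0.
have X0 : 0 <= X by apply: divr_ge0 => //; exact: ltW.
near=> x.
have xX : X <= x by near: x; apply: nbhs_pinfty_ge; exact: num_real.
have x0 : 0 <= x by apply: le_trans xX.
rewrite sub0r normrN; apply: (le_trans (H x x0)).
rewrite expRN ler_pdivrMr ?expR_gt0//.
apply: (@le_trans _ _ (e * (1 + d * x))); last by rewrite ler_pM2l// expR_ge1Dx.
apply: (le_trans (ler_norm _)).
have : `|C| = X * (e * d) by rewrite /X divfK// gt_eqF.
have : X * (e * d) <= x * (e * d) by rewrite ler_pM2r.
have : e * (1 + d * x) = e + x * (e * d) by ring.
lra.
Unshelve. all: by end_near. Qed.
Lemma expR_even_intgr (c : R) : 0 < c -> intgr (fun x => expR (- (c * `|x|))).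
Proof.
move=> c0.
have cf : continuous (fun x : R => expR (- (c * `|x|))).
  move=> x; apply: continuous_comp; last exact: continuous_expR.
  by apply: cont_opp; apply: cont_scale; exact: norm_continuous.
apply/integrableP; split; first by apply/measurable_EFinP; exact: cont_measurable.
under eq_integral do rewrite /= ger0_norm ?expR_ge0//.
rewrite ge0_symfun_integralT//; last first.
  by move=> x /=; rewrite normrN.
have -> : [set x : R | 0 <= x] = `[0, +oo[%classic by rewrite set_itvcy.
have d := has_derivZ (- c^-1) (has_deriv_expR (- c)).
rewrite (@ge0_continuous_FTC2y _ _ (fun x => - c^-1 * expR (- c * x)) _ 0).
- by rewrite sub0e mulr0 expR0 -EFinN -EFinM ltry.
- by move=> x _; rewrite expR_ge0.
- exact: continuous_subspaceT.
- apply: (@exp_decay_cvg _ `|c^-1| c c0) => x x0.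
  by rewrite normrM normrN (ger0_norm (expR_ge0 _)) mulNr.
- by move=> x _; exact: (has_deriv_derivable d).
- by apply: cvg_at_right_filter; exact: (has_deriv_continuous d).
- move=> x; rewrite in_itv /= andbT => x0; rewrite (has_deriv_derive1 d).
  by rewrite mulrA mulrNN mulVf ?mul1r ?gt_eqF// gtr0_norm// mulNr.
Qed.
End Tails.

(** * Mollification and truncation *)

Section LimitTheorems.
Context {R : realType}.
Notation mu := (@lebesgue_measure R).
Implicit Types (f g h : R -> R).
Lemma ae_imp (P Q : R -> Prop) : (forall x, P x -> Q x) ->
  {ae mu, forall x, P x} -> {ae mu, forall x, Q x}.
Proof.
move=> PQ [N [mN N0 sub]]; exists N; split => // x nQ.
by apply: sub => Px; apply: nQ; exact: PQ.
Qed.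
Lemma RI_dct (u : nat -> R -> R) (v g : R -> R) :
  (forall n, measurable_fun setT (u n)) -> measurable_fun setT v ->
  {ae mu, forall x, u ^~ x @ \oo --> v x} -> intgr g -> (forall n x, `|u n x| <= g x) ->
  RI (u n) @[n --> \oo] --> RI v.
Proof.
move=> mu_ mv uv ig ug.
have [|||||iv _ cv] := @dominated_convergence _ _ _ mu setT measurableT (fun n x => (u n x)%:E) (fun x => (v x)%:E)
  (fun x => (g x)%:E).
- by move=> n; apply/measurable_EFinP; exact: mu_.
- by apply/measurable_EFinP; exact: mv.
- by apply: ae_imp uv => x H _; apply: cvg_EFin; [exact: nearW|exact: H].
- exact: ig.
- by apply: aeW => x n _ /=; rewrite lee_fin.
rewrite RIE; under eq_fun do rewrite RIE.
apply: fine_cvg; rewrite fineK; first exact: cv.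
exact: integrable_fin_num.
Qed.
(* Fatou for a uniformly bounded sequence of integrals: dominated convergence for [min (u n) v]. *)
Lemma RI_fatou (u : nat -> R -> R) (v : R -> R) (c : R) :
  (forall n x, 0 <= u n x) -> (forall n, intgr (u n)) -> (forall n, RI (u n) <= c) ->
  (forall x, 0 <= v x) -> intgr v ->
  {ae mu, forall x, u ^~ x @ \oo --> v x} -> RI v <= c.
Proof.
move=> u0 iu uc v0 iv uv.
pose w n x := Num.min (u n x) (v x).
have mv := intgr_measurable iv.
have mw n : measurable_fun setT (w n) by apply: measurable_minr => //; exact: intgr_measurable.
have wv n x : `|w n x| <= v x.
  by rewrite ger0_norm ?le_min ?u0 ?v0// /w ge_min lexx orbT.
have iw n : intgr (w n) by exact: intgr_le (wv n).
have cw : RI (w n) @[n --> \oo] --> RI v.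
  apply: (RI_dct mw mv _ iv wv); apply: ae_imp uv => x H.
  apply/cvgrPdist_le => /= e e0; move/cvgrPdist_le: H => /(_ e e0); apply: filterS => n /=.
  by rewrite /w minElt; case: ifP => // _ _; rewrite subrr normr0 ltW.
rewrite -(cvg_lim _ cw)//; apply: limr_le; first by apply/cvg_ex; exists (RI v).
apply: nearW => n; apply: le_trans (uc n); apply: RI_le => // x.
by rewrite /w ge_min lexx.
Qed.
End LimitTheorems.

(** * Convolution with a test function *)

Section Convolution.
Context {R : realType}.
Notation mu := (@lebesgue_measure R).
Implicit Types (f g h phi kappa : R -> R).
Definition cut (s : R) (y : R) : R := \1_(`[- s, s]%classic : set R) y.
Lemma cutE s y : cut s y = if `|y| <= s then 1 else 0.
Proof.
rewrite /cut indicE; case: ifPn => H; last first.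
  rewrite memNset//=; apply/negP; rewrite in_itv /= -ler_norml//.
by rewrite mem_set//= in_itv /= -ler_norml.
Qed.
Lemma cut_ge0 s y : 0 <= cut s y. Proof. by rewrite cutE; case: ifP. Qed.
Lemma cut_measurable s : measurable_fun setT (cut s).
Proof. by apply: measurable_indic; exact: measurable_itv. Qed.
Lemma cut_intgr s : intgr (cut s).
Proof.
have -> : cut s = (fun=> 1 : R) \_ `[- s, s].
  by apply/funext => y; rewrite patchE /cut indicE; case: (_ \in _).
rewrite /intgr -restrict_EFin; apply/integrable_restrict => //=; rewrite setTI.
by apply: intgr_itv; exact: cont_cst.
Qed.
(** Local integrability phrased through integrals over the whole line, so that the calculus of [RI]
    and [intgr] applies directly. *)
Definition locally_L1 f := measurable_fun setT f /\ forall s, intgr (fun y => `|f y| * cut s y).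
Lemma intgr_lint f : intgr f -> locally_L1 f.
Proof.
move=> fi; have mf := intgr_measurable fi; split => // s.
apply: (intgr_le _ (intgr_norm fi)).
  by apply: measurable_funM; [exact: measurableT_comp|exact: cut_measurable].
move=> x; rewrite normrM normr_id cutE; case: ifP => _; first by rewrite normr1 mulr1.
by rewrite normr0 mulr0.
Qed.
Lemma L2_lint f : L2 f -> locally_L1 f.
Proof.
move=> [mf fi]; split => // s.
apply: (intgr_le (g := fun x => f x ^+ 2 + cut s x)); last 2 first.
- by apply: intgrD; [exact: fi|exact: cut_intgr].
- move=> x; rewrite ger0_norm ?mulr_ge0 ?cut_ge0// cutE; case: ifP => _; last by rewrite mulr0 addr0 sqr_ge0.
  rewrite mulr1 -(real_normK (num_real (f x))); have := sqr_ge0 (`|f x| - 1).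
  have := normr_ge0 (f x); nra.
by apply: measurable_funM; [exact: measurableT_comp|exact: cut_measurable].
Qed.
Lemma lint_intgr f g (s M : R) : locally_L1 f -> measurable_fun setT g ->
  (forall y, `|g y| <= M * cut s y) -> intgr (fun y => f y * g y).
Proof.
move=> [mf fi] mg gM; apply: (intgr_le (g := fun y => M * (`|f y| * cut s y))).
- exact: measurable_funM.
- exact: intgrZ.
- move=> y; rewrite normrM mulrCA ler_wpM2l//.
Qed.
Lemma lint_test f g : locally_L1 f -> ctest g -> intgr (fun y => f y * g y).
Proof.
move=> lf tg; have [M M0 HM] := test_bounded tg; have [_ [s ks]] := tg.
apply: (@lint_intgr _ _ s M) => //; first by apply: cont_measurable; exact: test_continuous.
move=> y; rewrite cutE; case: ifPn => [_|]; first by rewrite mulr1.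
by rewrite -ltNge => /ks ->; rewrite normr0 mulr0.
Qed.
(** Usual convolution; x - y is written [-1 * y + x] to match the lemmas on affine substitutions. *)
Definition conv f phi (x : R) : R := RI (fun y => f y * phi (-1 * y + x)).
Lemma flip_test phi x : ctest phi -> ctest (fun y => phi (-1 * y + x)).
Proof. by apply: test_affine; rewrite oppr_eq0 oner_neq0. Qed.
(** The mean value theorem for [phi] minus its tangent slope, with the Lipschitz bound of [phi1];
    this yields [M] instead of the sharp M / 2. *)
Lemma taylor1 phi phi1 phi2 (M u t : R) : has_deriv phi phi1 -> has_deriv phi1 phi2 ->
  (forall x, `|phi2 x| <= M) -> `|phi (u + t) - phi u - t * phi1 u| <= M * t ^+ 2.
Proof.
move=> d1 d2 H2; pose g x := phi x - phi1 u * x.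
have dg := has_derivB d1 (has_derivZ (phi1 u) (@has_deriv_id R)).
pose I := `|t|.
have L := lipschitz_deriv d2 H2.
have M0 : 0 <= M by apply: le_trans (H2 0).
have key a b : a < b -> `|a - u| <= I -> `|b - u| <= I -> `|g b - g a| <= M * I * `|b - a|.
  move=> ab ha hb; have [c /andP[ac cb] E] := MVTx dg ab.
  rewrite E normrM ler_wpM2r// mulr1; apply: (le_trans (L _ _)); rewrite ler_wpM2l//.
  by move: ha hb; rewrite !ler_norml => /andP[? ?] /andP[? ?]; apply/andP; split; lra.
have -> : phi (u + t) - phi u - t * phi1 u = g (u + t) - g u by rewrite /g; ring.
have tt : t ^+ 2 = I * I by rewrite -expr2 real_normK// num_real.
rewrite tt mulrA; have h0 : `|u - u| <= I by rewrite subrr normr0 normr_ge0.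
have h1 : `|u + t - u| <= I by rewrite addrAC subrr add0r.
case: (ltgtP t 0) => t0.
- have := key _ _ _ h1 h0; rewrite [`|g u - _|]distrC.
  have -> : u - (u + t) = - t by ring.
  rewrite normrN; apply; lra.
- have := key _ _ _ h0 h1; have -> : u + t - u = t by ring.
  apply; lra.
- by rewrite t0 addr0 subrr normr0 !mulr_ge0// normr_ge0.
Qed.
Lemma conv_deriv f phi : locally_L1 f -> ctest phi -> has_deriv (conv f phi) (conv f (derive1 phi)).
Proof.
move=> lf tp x; have tp1 := test_derive1 tp; have tp2 := test_derive1 tp1.
have [M M0 HM] := test_bounded tp2.
have [sp [r kr]] := tp; have kr1 := has_deriv_zero_out (smooth_has_deriv sp) kr.
(* For |t| <= 1 and |y| > s, both x - y and x + t - y lie outside the support of [phi]. *)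
pose s := `|x| + `|r| + 1.
apply: (@is_derive_quad _ _ _ _ (M * RI (fun y => `|f y| * cut s y))) => t t1.
rewrite /conv -RIB; [|exact/lint_test/flip_test|exact/lint_test/flip_test].
rewrite -RIZ; last exact/lint_test/flip_test.
rewrite -RIB; last 2 first.
- by apply: intgrB; exact/lint_test/flip_test.
- by apply: intgrZ; exact/lint_test/flip_test.
set F := fun y => _.
have iF : intgr F.
  by apply: intgrB; [apply: intgrB|apply: intgrZ]; exact/lint_test/flip_test.
apply: (le_trans (RI_norm iF)).
rewrite mulrAC -RIZ; last exact: (lf.2 s).
apply: RI_le; [exact: intgr_norm|apply: intgrZ; exact: (lf.2 s)|].
move=> y; rewrite /F.
have -> : f y * phi (-1 * y + (x + t)) - f y * phi (-1 * y + x) - t * (f y * derive1 phi (-1 * y + x)) =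
   f y * (phi (-1 * y + x + t) - phi (-1 * y + x) - t * derive1 phi (-1 * y + x)).
  by rewrite addrA; move: (derive1 phi _) => *; ring.
rewrite normrM mulrCA ler_wpM2l// cutE; case: ifPn => ys.
  by rewrite mulr1; exact: (taylor1 _ _ (smooth_has_deriv sp) (smooth_has_deriv (smooth_derive1 sp))).
rewrite mulr0 !kr ?kr1 ?mulr0 ?subrr ?normr0//.
all: rewrite -ltNge /s in ys; have := ler_norm r; have := ler_normB (-1 * y + x) x; have := ler_normB (-1 * y + x + t) (x + t).
all: rewrite (_ : -1 * y + x - x = - y); last by ring.
all: rewrite (_ : -1 * y + x + t - (x + t) = - y) ?normrN; last by ring.
all: have := ler_normD x t; lra.
Qed.
Lemma conv_smooth f phi : locally_L1 f -> ctest phi -> cinf (conv f phi).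
Proof.
move=> lf tp; apply: (@smooth_coind _ (fun h => exists phi, ctest phi /\ h = conv f phi)); last by exists phi.
move=> _ [{}phi [{}tp ->]]; exists (conv f (derive1 phi)); first exact: conv_deriv.
by exists (derive1 phi); split => //; exact: test_derive1.
Qed.
(** The weak derivative is tested against y -> phi (x - y); the sign produced by the reflection
    cancels the one in the definition. *)
Lemma conv_weak f g phi : L2 f -> L2 g -> weak_deriv f g -> ctest phi ->
  conv f (derive1 phi) = conv g phi.
Proof.
move=> f2 g2 fg tp; apply/funext => x.
have lf := L2_lint f2; have lg := L2_lint g2.
have tq := flip_test x tp; have tq1 := flip_test x (test_derive1 tp).
have := fg _ ((ctestP _).2 tq).
have [sp _] := tp.
rewrite (has_deriv_derive1 (has_deriv_affine (-1) x (smooth_has_deriv sp))).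
have i1 := lint_test lf (testZ (-1) tq1); have i2 := lint_test lg tq.
rewrite (RI_EFin i1) (RI_EFin i2) -EFinN => -[E]; rewrite /conv.
apply: oppr_inj; rewrite -E -[- RI _]mulN1r -RIZ; last exact: lint_test.
by apply: RI_ext => y; move: (derive1 phi _) => *; ring.
Qed.
(** As a^2 = 1, [a * prim kappa (a * y + b)] is an antiderivative of the integrand, and [prim kappa]
    is constant on each side of the support. No change of variables for the Lebesgue integral is
    invoked. *)
Lemma RI_flip (kappa : R -> R) (a b : R) : `|a| = 1 -> ctest kappa ->
  RI (fun y => kappa (a * y + b)) = RI kappa.
Proof.
move=> a1 tk; have ck := test_continuous tk; have [sk [r kr]] := tk.
have a0 : a != 0 by rewrite -normr_eq0 a1 oner_neq0.
have aa : a * a = 1 by rewrite -expr2 -(real_normK (num_real a)) a1 expr1n.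
pose s := `|r| + `|b| + 1.
have dH := has_derivZ a (has_deriv_affine a b (prim_deriv ck)).
have dH' : has_deriv (fun y => a * prim kappa (a * y + b)) (fun y => kappa (a * y + b)).
  by apply: (has_deriv_eq dH) => y; rewrite mulrA aa mul1r.
have s0 : - s <= s by rewrite /s; have := normr_ge0 r; have := normr_ge0 b; lra.
have rs : r <= s by rewrite /s; have := ler_norm r; have := normr_ge0 b; lra.
have ck' : continuous (fun y => kappa (a * y + b)).
  by apply: test_continuous; exact: test_affine.
rewrite (@RI_itv _ _ s); last first.
  move=> y sy; apply: kr; have := ler_normB (a * y + b) b; rewrite addrK normrM a1 mul1r.
  by move: sy; rewrite /s; have := ler_norm r; lra.
rewrite (FTC2 s0 dH' ck').
pose t := s + `|b|.
have st : s <= t by rewrite lerDl.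
rewrite (@RI_itv _ _ t); last by move=> y ty; apply: kr; apply: le_lt_trans ty; exact: le_trans st.
rewrite (FTC2 _ (prim_deriv ck) ck); last by rewrite /t; have := normr_ge0 b; lra.
have pos u v : r < u -> u <= v -> prim kappa u = prim kappa v.
  move=> ru uv; apply: prim_const => // y /andP[uy yv]; apply: kr.
  by rewrite ltr_normr; apply/orP; left; lra.
have neg u v : v < - r -> u <= v -> prim kappa u = prim kappa v.
  move=> ru uv; apply: prim_const => // y /andP[uy yv]; apply: kr.
  by rewrite ltr_normr; apply/orP; right; lra.
have hb1 := ler_norm b; have hb2 := ler_norm (- b); rewrite normrN in hb2; have hr := ler_norm r.
have [->|->] : a = 1 \/ a = -1.
  have : (a - 1) * (a + 1) = 0 by rewrite (_ : _ * _ = a * a - 1); [rewrite aa subrr|ring].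
  move/eqP; rewrite mulf_eq0 subr_eq0 addr_eq0 => /orP[/eqP|/eqP]; [by left|by right].
- rewrite !mul1r (pos (s + b) t); [|rewrite /s; lra|rewrite /t; lra].
  by rewrite (neg (- t) (- s + b))//; rewrite /t /s; lra.
- rewrite !mulN1r !opprK (neg (- t) (- s + b)); [|rewrite /s; lra|rewrite /t /s; lra].
  rewrite (pos (s + b) t); [|rewrite /s; lra|rewrite /t; lra].
  by ring.
Qed.
End Convolution.

(** * Mollifiers: contraction in L^2 and convergence almost everywhere *)

Section Mollifier.
Context {R : realType}.
Notation mu := (@lebesgue_measure R).
Implicit Types (f g h phi kappa : R -> R).
Lemma RI_scale (kappa : R -> R) (a : R) : 0 < a -> ctest kappa ->
  RI (fun y => kappa (a * y + 0)) = a^-1 * RI kappa.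
Proof.
move=> a0 tk; have ck := test_continuous tk; have [sk [r kr]] := tk.
have an0 : a != 0 by rewrite gt_eqF.
have dH' : has_deriv (fun y => a^-1 * prim kappa (a * y + 0)) (fun y => kappa (a * y + 0)).
  apply: (has_deriv_eq (has_derivZ a^-1 (has_deriv_affine a 0 (prim_deriv ck)))).
  by move=> y; rewrite mulrA mulVf// mul1r.
pose u := `|r| + 1; pose s := u / a.
have u0 : 0 < u by rewrite ltr_wpDl.
have s0 : 0 < s by exact: divr_gt0.
have ru : r < u by have := ler_norm r; rewrite /u; lra.
have asu : a * s = u by rewrite /s mulrC divfK.
rewrite (@RI_itv _ _ s); last first.
  move=> y sy; apply: kr; rewrite addr0 normrM (gtr0_norm a0); apply: (lt_trans ru).
  by rewrite -asu ltr_pM2l.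
rewrite (FTC2 _ dH'); last 2 first.
- by rewrite ge0_cp// ltW.
- by apply: test_continuous; exact: test_affine.
rewrite (@RI_itv _ kappa u); last by move=> y uy; apply: kr; exact: lt_trans uy.
rewrite (FTC2 _ (prim_deriv ck) ck); last by rewrite ge0_cp// ltW.
by rewrite !addr0 mulrN asu mulrBr.
Qed.
Definition moll (n : nat) (u : R) : R := n.+1%:R * stdbump (n.+1%:R * u + 0).
Lemma moll_test n : ctest (moll n).
Proof. by apply: testZ; apply: test_affine; [rewrite pnatr_eq0|exact: stdbump_test]. Qed.
Lemma moll_ge0 n u : 0 <= moll n u.
Proof. by rewrite mulr_ge0// stdbump_ge0. Qed.
Lemma moll_RI n : RI (moll n) = 1.
Proof.
have tb := @stdbump_test R.
rewrite RIZ; last by apply: test_intgr; apply: test_affine => //; rewrite pnatr_eq0.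
by rewrite RI_scale// stdbump_RI mulr1 mulfV// pnatr_eq0.
Qed.
Lemma moll_out n u : n.+1%:R^-1 <= `|u| -> moll n u = 0.
Proof.
move=> H; rewrite /moll stdbump_out ?mulr0// addr0 normrM ger0_norm//.
by rewrite -ler_pdivrMl// mulr1.
Qed.
(** By Tonelli: integrating in x first leaves the mass 1 of a translate of [kappa]. *)
Lemma conv_L1 h kappa : (forall x, 0 <= h x) -> intgr h -> ctest kappa -> (forall x, 0 <= kappa x) ->
  RI kappa = 1 -> intgr (conv h kappa) /\ RI (conv h kappa) = RI h.
Proof.
move=> h0 hi tk k0 k1; have lh := intgr_lint hi; have ck := test_continuous tk.
have mh := intgr_measurable hi.
have cc : continuous (conv h kappa) by apply: smooth_continuous; exact: conv_smooth.
have c0 x : 0 <= conv h kappa x by apply: RI_ge0 => y; rewrite mulr_ge0.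
have E : (\int[mu]_x (conv h kappa x)%:E = (RI h)%:E)%E.
  have -> : (\int[mu]_x (conv h kappa x)%:E = \int[mu]_x \int[mu]_y (h y * kappa (-1 * y + x))%:E)%E.
    by apply: eq_integral => x _; rewrite RI_EFin//; exact/lint_test/flip_test.
  pose F (p : R * R) := (h p.2 * kappa (-1 * p.2 + p.1))%:E.
  rewrite (@fubini_tonelli _ _ _ _ _ mu mu F).
  - rewrite -RI_EFin//; apply: eq_integral => y _; rewrite /F /=.
    have tky : ctest (fun x => kappa (1 * x + - y)) by apply: test_affine => //; exact: oner_neq0.
    have -> : (fun x => (h y * kappa (-1 * y + x))%:E) = (fun x => (h y * kappa (1 * x + - y))%:E).
      by apply/funext => x; congr ((_ * kappa _)%:E); ring.
    rewrite RI_EFin; last by apply: intgrZ; exact: test_intgr.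
    by rewrite RIZ ?RI_flip ?k1 ?mulr1 ?normr1//; exact: test_intgr.
  - apply/measurable_EFinP; apply: measurable_funM; first exact: measurableT_comp mh measurable_snd.
    apply: (measurableT_comp (cont_measurable ck)).
    by apply: measurable_funD => //; apply: measurable_funM.
  - by move=> p; rewrite lee_fin mulr_ge0.
have ic : intgr (conv h kappa).
  apply/integrableP; split; first by apply/measurable_EFinP; exact: cont_measurable.
  under eq_integral do rewrite /= ger0_norm//.
  by rewrite E ltry.
split => //; rewrite RIE /Rintegral E.
by [].
Qed.
(** Jensen's inequality as nonnegativity of a variance: int (f(y) - c)^2 kappa(x - y) dy >= 0 at c =
    conv f kappa x. It is then integrated by [conv_L1]. *)
Lemma conv_jensen f kappa : L2 f -> ctest kappa -> (forall x, 0 <= kappa x) -> RI kappa = 1 ->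
  L2 (conv f kappa) /\ RI (fun x => conv f kappa x ^+ 2) <= RI (fun x => f x ^+ 2).
Proof.
move=> f2 tk k0 k1; have lf := L2_lint f2; have [mf fi] := f2.
have fi' : intgr (fun x => f x ^+ 2) := fi.
have lf2 := intgr_lint fi'.
have [ic Ec] := conv_L1 (fun x => sqr_ge0 (f x)) fi' tk k0 k1.
have cc : continuous (conv f kappa) by apply: smooth_continuous; exact: conv_smooth.
have pw x : conv f kappa x ^+ 2 <= conv (fun x => f x ^+ 2) kappa x.
  set c := conv f kappa x.
  have tx := flip_test x tk.
  have i1 := lint_test lf2 tx; have i2 := lint_test lf tx; have i3 := test_intgr tx.
  have : 0 <= RI (fun y => f y ^+ 2 * kappa (-1 * y + x) - 2 * c * (f y * kappa (-1 * y + x)) + c ^+ 2 * kappa (-1 * y + x)).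
    apply: RI_ge0 => y.
    rewrite (_ : _ + _ = (f y - c) ^+ 2 * kappa (-1 * y + x)); last by ring.
    by rewrite mulr_ge0// sqr_ge0.
  rewrite RID; [|by apply: intgrB => //; exact: intgrZ|exact: intgrZ].
  rewrite RIB; [|by []|exact: intgrZ].
  rewrite !RIZ// RI_flip// ?normrN ?normr1// k1 -/(conv f kappa x) -/c.
  by rewrite -/(conv (fun x => f x ^+ 2) kappa x); lra.
have i2 : intgr (fun x => conv f kappa x ^+ 2).
  apply: (intgr_le _ ic); first by apply: cont_measurable; exact: cont_mul.
  by move=> x; rewrite ger0_norm ?sqr_ge0.
split; first by split; [exact: cont_measurable|exact: i2].
by rewrite -Ec; apply: RI_le.
Qed.
(** At a Lebesgue point the error is at most 2 B times the mean of |f(y) - f(x)| over the ball of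
    radius 1 / (n + 1), where [B] bounds [stdbump]. *)
Lemma conv_moll_cvg f : L2 f -> {ae mu, forall x, conv f (moll n) x @[n --> \oo] --> f x}.
Proof.
move=> f2; have lf := L2_lint f2; have [mf fi] := lf.
have li : locally_integrable setT f.
  split => //; first exact: openT.
  move=> K _ cK; have [M [Mr HM]] := compact_bounded cK.
  pose s := `|M| + 1.
  have mK : measurable K by exact: compact_measurable.
  have Ks x : K x -> `|x| <= s.
    by move=> Kx; apply: HM => //; rewrite /s; have := ler_norm M; lra.
  have /integrableP[_ H] : mu.-integrable K (EFin \o (fun y => `|f y| * cut s y)).
    by apply: integrableS (fi s).
  apply: le_lt_trans H; rewrite le_eqVlt; apply/orP; left; apply/eqP.
  apply: eq_integral => x /set_mem Kx /=.
  by rewrite cutE Ks// mulr1 normr_id.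
have [B B0 HB] := test_bounded (@stdbump_test R).
apply: ae_imp (lebesgue_differentiation li) => x.
rewrite /lebesgue_pt => /fine_cvgP[[d1 /= d10 fin] /cvgrPdist_lt cv].
apply/cvgrPdist_le => e e0.
have e1 : 0 < e / (2 * (B + 1)) by apply: divr_gt0 => //; lra.
have [d2 /= d20 H2] := cv _ e1.
have m0 : 0 < Num.min d1 d2 by rewrite lt_min d10.
have := near_infty_natSinv_lt (PosNum m0); apply: filterS => n /=; rewrite lt_min => /andP[n1 n2].
set r := n.+1%:R^-1 in n1 n2 *.
have r0 : 0 < r by rewrite invr_gt0.
have {}fin := fin r; rewrite /= sub0r normrN gtr0_norm// in fin; have {}fin := fin n1 r0.
have {}H2 := H2 r; rewrite /= !sub0r !normrN gtr0_norm// in H2; have {}H2 := H2 n2 r0.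
have tk := flip_test x (moll_test n).
have E : f x - conv f (moll n) x = - RI (fun y => f y * moll n (-1 * y + x) - f x * moll n (-1 * y + x)).
  rewrite RIB; [|exact: lint_test|by apply: intgrZ; exact: test_intgr].
  rewrite RIZ; last exact: test_intgr.
  by rewrite RI_flip ?normrN ?normr1//; [rewrite moll_RI /conv; ring|exact: moll_test].
pose g y := `|f y - f x|.
have mg : measurable_fun setT g by apply: measurableT_comp => //; exact: measurable_funB.
pose A := ball x r; have mA : measurable A by exact: measurable_ball.
pose s := `|x| + r.
have mgA : measurable_fun setT (g \_ A) by apply/(measurable_restrictT _ mA); exact: measurable_funTS.
have igA : intgr (g \_ A).
  apply: (@intgr_le _ _ (fun y => `|f y| * cut s y + `|f x| * cut s y)) => //.
    by apply: intgrD; [exact: fi|apply: intgrZ; exact: cut_intgr].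
  move=> y; rewrite patchE; case: ifPn => [/set_mem Ay|_]; last first.
    by rewrite normr0 addr_ge0// mulr_ge0// cut_ge0.
  rewrite cutE ifT ?mulr1; last first.
    move: Ay; rewrite /A /ball /= => xy; have := ler_normB x (x - y); rewrite /s.
    by rewrite (_ : x - (x - y) = y); [lra|ring].
  by rewrite /g normr_id; exact: ler_normB.
have iA : mu.-integrable A (EFin \o g).
  have : mu.-integrable (setT `&` A) (EFin \o g).
    by apply/integrable_restrict => //; rewrite restrict_EFin.
  by rewrite setTI.
have Q : fine (davg f x r) = (2 * r)^-1 * \int[mu]_(y in A) g y.
  rewrite /davg /iavg lebesgue_measure_ball ?ltW// inver ifF; last by rewrite mulrn_eq0 /= gt_eqF.
  rewrite (_ : (\int[mu]_(y in ball x r) _ = (\int[mu]_(y in A) g y)%:E)%E); last first.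
    by rewrite /Rintegral fineK//; exact: integrable_fin_num.
  by rewrite -EFinM /= mulr2n (_ : r + r = 2 * r)//; ring.
rewrite E normrN; have ii : intgr (fun y => f y * moll n (-1 * y + x) - f x * moll n (-1 * y + x)).
  by apply: intgrB; [exact: lint_test|apply: intgrZ; exact: test_intgr].
apply: (le_trans (RI_norm ii)).
apply: (@le_trans _ _ (r^-1 * B * RI (g \_ A))).
  rewrite -RIZ//; apply: RI_le; [exact: intgr_norm|exact: intgrZ|].
  move=> y; rewrite -mulrBl normrM -/(g y) patchE; case: ifPn => [_|/negP nA].
    rewrite mulrC ler_wpM2r//; first by rewrite /g.
    rewrite /moll normrM ger0_norm// /r invrK ler_wpM2l//.
  rewrite moll_out ?normr0 ?mulr0// leNgt; apply/negP => H; apply: nA; apply/mem_set.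
  by rewrite /A /ball /=; move: H; rewrite -/r mulN1r addrC.
rewrite RIE -Rintegral_mkcond; move: H2; rewrite Q.
have : 0 <= \int[mu]_(y in A) g y by apply: Rintegral_ge0 => y _; exact: normr_ge0.
move: (\int[mu]_(y in A) g y) => T T0 HT.
have B1 : 0 < 2 * (B + 1) by lra.
have HT' : (2 * r)^-1 * T < e / (2 * (B + 1)) by apply: le_lt_trans HT; exact: ler_norm.
rewrite ltr_pdivlMr// in HT'.
have -> : r^-1 * B * T = (2 * r)^-1 * T * (2 * B) by field; rewrite gt_eqF.
apply: ltW; apply: le_lt_trans HT'; apply: ler_wpM2l; last lra.
by apply: mulr_ge0 => //; rewrite invr_ge0; lra.
Qed.
End Mollifier.

(** * From Sobolev functions to test functions *)

Section Truncation.
Context {R : realType}.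
Notation mu := (@lebesgue_measure R).
Implicit Types (f g h w : R -> R).
Lemma sq2_le (a b c d : R) : a ^+ 2 <= c -> b ^+ 2 <= d -> (a + b) ^+ 2 <= 2 * (c + d).
Proof. by move=> ac bd; have := sqr_ge0 (a - b); rewrite sqrrB sqrrD; lra. Qed.
Lemma sq4_le (a b c x y z : R) : a ^+ 2 <= x -> b ^+ 2 <= y -> c ^+ 2 <= z ->
  ((a + b) + (b + c)) ^+ 2 <= 4 * ((x + y) + (y + z)).
Proof. by move=> ax bY cz; have := sq2_le (sq2_le ax bY) (sq2_le bY cz); lra. Qed.
Lemma L2_intgr_w w f (W : R) : continuous w -> (forall x, `|w x| <= W) -> L2 f ->
  intgr (fun x => w x * f x ^+ 2).
Proof.
move=> cw bw [mf fi]; apply: (intgr_le (g := fun x => W * f x ^+ 2)).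
- apply: measurable_funM; first exact: cont_measurable.
  exact: measurable_funX.
- by apply: intgrZ; exact: fi.
- by move=> x; rewrite normrM [X in _ * X]ger0_norm ?sqr_ge0// ler_wpM2r// sqr_ge0.
Qed.
Lemma L2_dct w (W : R) (u : nat -> R -> R) (v g : R -> R) : continuous w -> (forall x, `|w x| <= W) ->
  (forall n, measurable_fun setT (u n)) -> measurable_fun setT v ->
  (forall x, u ^~ x @ \oo --> v x) -> intgr g -> (forall n x, u n x ^+ 2 <= g x) ->
  RI (fun x => w x * u n x ^+ 2) @[n --> \oo] --> RI (fun x => w x * v x ^+ 2).
Proof.
move=> cw bw mu_ mv uv ig ug; apply: (@RI_dct _ _ _ (fun x => W * g x)).
- by move=> n; apply: measurable_funM; [exact: cont_measurable|exact: measurable_funX].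
- by apply: measurable_funM; [exact: cont_measurable|exact: measurable_funX].
- by apply: aeW => x; apply: cvgM; [exact: cvg_cst|apply: cvgM; exact: uv].
- exact: intgrZ.
- move=> n x; rewrite normrM [X in _ * X]ger0_norm ?sqr_ge0//.
  by apply: ler_pM => //; exact: sqr_ge0.
Qed.
(** A cutoff normalized at the origin only: its dilates tend to 1 pointwise by continuity, which is
    all that dominated convergence asks for. *)
Definition zeta (u : R) : R := (stdbump 0)^-1 * stdbump u.
Lemma zeta_test : ctest zeta. Proof. by apply: testZ; exact: stdbump_test. Qed.
Lemma zeta0 : zeta 0 = 1. Proof. by rewrite /zeta mulVf// gt_eqF// stdbump_gt0. Qed.
(** Derivatives of the dilated cutoff carry factors [s n] tending to zero, and all products are
    dominated by squares of [q0] and its derivatives. Every quadratic term thus converges, and the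
    strict inequality survives at a finite stage. The alternative [e2 = 0] covers functions of class
    H^1. *)
Lemma truncation (w : R -> R) (W G e0 e1 e2 : R) (q0 : R -> R) :
  continuous w -> (forall x, `|w x| <= W) ->
  cinf q0 -> L2 q0 -> L2 (derive1 q0) -> e2 = 0 \/ L2 (derive1n 2 q0) ->
  e2 * RI (fun x => derive1n 2 q0 x ^+ 2) + e1 * RI (fun x => derive1 q0 x ^+ 2)
    + e0 * RI (fun x => q0 x ^+ 2) - G * RI (fun x => w x * q0 x ^+ 2) < 0 ->
  exists2 f, ctest f &
  e2 * quad (fun=> 1) 2 f + e1 * quad (fun=> 1) 1 f + e0 * quad (fun=> 1) 0 f - G * quad w 0 f < 0.
Proof.
move=> cw bw sq l0 l1 l2 H.
have tz := zeta_test; have tz1 := test_derive1 tz; have tz2 := test_derive1 tz1.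
have [Z0 Z00 HZ0] := test_bounded tz; have [Z1 Z10 HZ1] := test_bounded tz1; have [Z2 Z20 HZ2] := test_bounded tz2.
pose Z := Z0 + Z1 + Z2.
have ZP : 0 <= Z by rewrite !addr_ge0.
have {}HZ0 x : `|zeta x| <= Z by apply: (le_trans (HZ0 x)); rewrite /Z; lra.
have {}HZ1 x : `|derive1 zeta x| <= Z by apply: (le_trans (HZ1 x)); rewrite /Z; lra.
have {}HZ2 x : `|derive1 (derive1 zeta) x| <= Z by apply: (le_trans (HZ2 x)); rewrite /Z; lra.
pose s (n : nat) : R := n.+1%:R^-1.
have s0 n : 0 < s n by rewrite invr_gt0.
have s1 n : s n <= 1 by rewrite invf_le1// ler1n.
have cs : s n @[n --> \oo] --> (0 : R) by exact: cvg_harmonic.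
pose a n x := zeta (s n * x + 0).
pose a1 n x := s n * derive1 zeta (s n * x + 0).
pose a2 n x := s n * (s n * derive1 (derive1 zeta) (s n * x + 0)).
have da n : has_deriv (a n) (a1 n) by apply: has_deriv_affine; apply: smooth_has_deriv; case: tz.
have da1 n : has_deriv (a1 n) (a2 n).
  by apply: has_derivZ; apply: has_deriv_affine; apply: smooth_has_deriv; case: tz1.
have ba n x : `|a n x| <= Z by exact: HZ0.
have ba1 n x : `|a1 n x| <= Z * s n.
  by rewrite normrM gtr0_norm// mulrC ler_wpM2r// ltW.
have ba2 n x : `|a2 n x| <= Z * s n.
  rewrite normrM gtr0_norm// mulrC ler_wpM2r//; first exact: ltW.
  by rewrite normrM gtr0_norm//; apply: le_trans (HZ2 (s n * x + 0)); rewrite ler_piMl.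
have Zs n : Z * s n <= Z by rewrite ler_piMr.
have cvg0 (u : nat -> R -> R) x : (forall n x, `|u n x| <= Z * s n) -> u n x @[n --> \oo] --> (0 : R).
  move=> hu; have c : Z * s n @[n --> \oo] --> (0 : R).
    by rewrite -[X in _ --> X](mulr0 Z); apply: cvgM => //; exact: cvg_cst.
  apply/cvgrPdist_le => /= e ep; move/cvgrPdist_le: c => /(_ e ep); apply: filterS => n /=.
  rewrite !sub0r !normrN => h; apply: (le_trans (hu n x)); apply: le_trans h; exact: ler_norm.
have ca x : a n x @[n --> \oo] --> (1 : R).
  rewrite -zeta0 /a.
  have cz : zeta y @[y --> (0 : R)] --> zeta 0 by exact: (test_continuous tz).
  have cx : s n * x + 0 @[n --> \oo] --> (0 : R).
    have : s n * x + 0 @[n --> \oo] --> 0 * x + 0.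
      by apply: cvgD; [apply: cvgM => //; exact: cvg_cst|exact: cvg_cst].
    by rewrite mul0r addr0.
  exact: (cvg_comp (fun n => s n * x + 0) zeta cx cz).
have ca1 x : a1 n x @[n --> \oo] --> (0 : R) by exact: cvg0.
have ca2 x : a2 n x @[n --> \oo] --> (0 : R) by exact: cvg0.
pose q1 := derive1 q0; pose q2 := derive1 q1.
have dq : has_deriv q0 q1 by exact: smooth_has_deriv.
have dq1 : has_deriv q1 q2 by apply: smooth_has_deriv; exact: smooth_derive1.
have cq2 : continuous q2 by apply: smooth_continuous; do 2 apply: smooth_derive1.
have cq1 := has_deriv_continuous dq1; have cq0 := has_deriv_continuous dq.
pose f n x := q0 x * a n x.
have tf n : ctest (f n).
  by apply: testMr => //; apply: test_affine => //; rewrite gt_eqF.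
pose f1 n x := q1 x * a n x + q0 x * a1 n x.
pose f2 n x := (q2 x * a n x + q1 x * a1 n x) + (q1 x * a1 n x + q0 x * a2 n x).
have df n : has_deriv (f n) (f1 n) := has_derivM dq (da n).
have df1 n : has_deriv (f1 n) (f2 n) := has_derivD (has_derivM dq1 (da n)) (has_derivM dq (da1 n)).
have E1 n : derive1n 1 (f n) = f1 n by exact: has_deriv_derive1.
have E2 n : derive1n 2 (f n) = f2 n by rewrite derive1nS E1; exact: has_deriv_derive1.
have mc g : continuous g -> measurable_fun setT g by exact: cont_measurable.
have mf n : measurable_fun setT (f n) by apply: mc; exact: has_deriv_continuous (df n).
have mf1 n : measurable_fun setT (f1 n) by apply: mc; exact: has_deriv_continuous (df1 n).
have mf2 n : measurable_fun setT (f2 n).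
  apply: mc; rewrite -E2; apply: test_continuous; exact: test_derive1n.
have b1 (y : R) : `|1 : R| <= 1 by rewrite normr1.
have i0 : intgr (fun x => q0 x ^+ 2) := l0.2.
have i1 : intgr (fun x => q1 x ^+ 2) := l1.2.
have sq_le (u v V : R) : `|u| <= V -> (v * u) ^+ 2 <= V ^+ 2 * v ^+ 2.
  move=> uV; rewrite exprMn mulrC ler_wpM2r ?sqr_ge0// -(real_normK (num_real u)).
  by rewrite lerXn2r// nnegrE//; apply: le_trans uV.
have cf x : f n x @[n --> \oo] --> q0 x.
  by rewrite -[X in _ --> X]mulr1; apply: cvgM => //; exact: cvg_cst.
have cf1 x : f1 n x @[n --> \oo] --> q1 x.
  have : f1 n x @[n --> \oo] --> q1 x * 1 + q0 x * 0.
    by apply: cvgD; apply: cvgM => //; exact: cvg_cst.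
  by rewrite mulr1 mulr0 addr0.
have cf2 x : f2 n x @[n --> \oo] --> q2 x.
  have : f2 n x @[n --> \oo] --> (q2 x * 1 + q1 x * 0) + (q1 x * 0 + q0 x * 0).
    by apply: cvgD; apply: cvgD; apply: cvgM => //; exact: cvg_cst.
  by rewrite mulr1 !mulr0 !addr0.
have ba1' n x : `|a1 n x| <= Z by apply: le_trans (Zs n).
have ba2' n x : `|a2 n x| <= Z by apply: le_trans (Zs n).
have bf n x : f n x ^+ 2 <= Z ^+ 2 * q0 x ^+ 2 by exact: sq_le.
have bf1 n x : f1 n x ^+ 2 <= 2 * (Z ^+ 2 * q1 x ^+ 2 + Z ^+ 2 * q0 x ^+ 2).
  have h1 := sq_le _ (q1 x) _ (ba n x); have h2 := sq_le _ (q0 x) _ (ba1' n x).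
  exact: sq2_le.
have iZ0 := intgrZ (Z ^+ 2) i0; have iZ1 := intgrZ (Z ^+ 2) i1.
have K0 : quad w 0 (f n) @[n --> \oo] --> RI (fun x => w x * q0 x ^+ 2).
  under eq_fun do rewrite quadE.
  exact: (L2_dct cw bw mf (mc _ cq0) cf iZ0 bf).
have N0 : quad (fun=> 1) 0 (f n) @[n --> \oo] --> RI (fun x => 1 * q0 x ^+ 2).
  under eq_fun do rewrite quadE.
  exact: (L2_dct (@cont_cst R 1) b1 mf (mc _ cq0) cf iZ0 bf).
have N1 : quad (fun=> 1) 1 (f n) @[n --> \oo] --> RI (fun x => 1 * q1 x ^+ 2).
  under eq_fun do rewrite quadE E1.
  exact: (L2_dct (@cont_cst R 1) b1 mf1 (mc _ cq1) cf1 (intgrZ 2 (intgrD iZ1 iZ0)) bf1).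
have N2 : e2 * quad (fun=> 1) 2 (f n) @[n --> \oo] --> e2 * RI (fun x => 1 * q2 x ^+ 2).
  case: l2 => [->|l2].
    by rewrite mul0r; under eq_fun do rewrite mul0r; exact: cvg_cst.
  apply: cvgM; first exact: cvg_cst.
  under eq_fun do rewrite quadE E2.
  have i2 : intgr (fun x => q2 x ^+ 2) := l2.2.
  have iZ2 := intgrZ (Z ^+ 2) i2.
  apply: (L2_dct (@cont_cst R 1) b1 mf2 (mc _ cq2) cf2 (intgrZ 4 (intgrD (intgrD iZ2 iZ1) (intgrD iZ1 iZ0)))).
  move=> n x; rewrite /f2.
  exact: sq4_le (sq_le _ (q2 x) _ (ba n x)) (sq_le _ (q1 x) _ (ba1' n x)) (sq_le _ (q0 x) _ (ba2' n x)).
have L : e2 * quad (fun=> 1) 2 (f n) + e1 * quad (fun=> 1) 1 (f n) + e0 * quad (fun=> 1) 0 (f n)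
    - G * quad w 0 (f n) @[n --> \oo] -->
    e2 * RI (fun x => 1 * q2 x ^+ 2) + e1 * RI (fun x => 1 * q1 x ^+ 2) + e0 * RI (fun x => 1 * q0 x ^+ 2)
     - G * RI (fun x => w x * q0 x ^+ 2).
  apply: cvgB; last by apply: cvgM => //; exact: cvg_cst.
  apply: cvgD; last by apply: cvgM => //; exact: cvg_cst.
  by apply: cvgD => //; apply: cvgM => //; exact: cvg_cst.
have one (g : R -> R) : RI (fun x => 1 * g x ^+ 2) = RI (fun x => g x ^+ 2) by apply: RI_ext => x; rewrite mul1r.
rewrite !one in L.
have := cvgr_lt _ L _ H; move=> [N _ HN].
by exists (f N) => //; apply: HN => /=.
Qed.
(** By Jensen, mollification does not increase the terms with nonnegative weights; only the
    indefinite term can lose. It suffices that it loses at most [eps] for one index, and [eps] is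
    chosen so that G eps is half of the available gap. *)
Lemma weak_negative (w : R -> R) (W G e0 e1 e2 : R) (p0 p1 p2 : R -> R) :
  continuous w -> (forall x, `|w x| <= W) -> 0 < G -> 0 <= e0 -> 0 <= e1 -> 0 <= e2 ->
  L2 p0 -> L2 p1 -> weak_deriv p0 p1 -> e2 = 0 \/ weak_deriv p1 p2 /\ L2 p2 ->
  e2 * RI (fun x => p2 x ^+ 2) + e1 * RI (fun x => p1 x ^+ 2)
    + e0 * RI (fun x => p0 x ^+ 2) - G * RI (fun x => w x * p0 x ^+ 2) < 0 ->
  exists2 f, ctest f &
  e2 * quad (fun=> 1) 2 f + e1 * quad (fun=> 1) 1 f + e0 * quad (fun=> 1) 0 f - G * quad w 0 f < 0.
Proof.
move=> cw bw G0 he0 he1 he2 l0 l1 w01 w12 H.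
set E := _ - _ in H; pose eps := - E / (2 * G).
have eps0 : 0 < eps by apply: divr_gt0; [rewrite oppr_gt0|lra].
have W0 : 0 <= W by apply: le_trans (bw 0).
have i0 : intgr (fun x => p0 x ^+ 2) := l0.2.
have J n := conv_jensen l0 (@moll_test R n) (moll_ge0 n) (moll_RI n).
have [n Hn] : exists n, RI (fun x => w x * p0 x ^+ 2) - eps < RI (fun x => w x * conv p0 (moll n) x ^+ 2).
  (* Fatou needs nonnegative integrands, so the weight is shifted by [W]; by Jensen the added term
     never exceeds W int p0^2. *)
  apply: contrapT => /forallNP Hn.
  have iw := L2_intgr_w cw bw l0.
  have iwn n : intgr (fun x => w x * conv p0 (moll n) x ^+ 2) by apply: (L2_intgr_w cw bw); exact: (J n).1.
  have icn n : intgr (fun x => conv p0 (moll n) x ^+ 2) := (J n).1.2.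
  have wW x : 0 <= w x + W by have := bw x; rewrite ler_norml => /andP[? _]; lra.
  have : RI (fun x => w x * p0 x ^+ 2 + W * p0 x ^+ 2) <=
     RI (fun x => w x * p0 x ^+ 2) - eps + W * RI (fun x => p0 x ^+ 2).
    apply: (@RI_fatou _ (fun n x => w x * conv p0 (moll n) x ^+ 2 + W * conv p0 (moll n) x ^+ 2)).
    - by move=> m x; rewrite -mulrDl mulr_ge0// sqr_ge0.
    - by move=> m; apply: intgrD => //; exact: intgrZ.
    - move=> m; rewrite RID//; last exact: intgrZ.
      rewrite RIZ//; apply: lerD; first by rewrite leNgt; apply/negP; exact: Hn.
      by rewrite ler_wpM2l//; exact: (J m).2.
    - by move=> x; rewrite -mulrDl mulr_ge0// sqr_ge0.
    - by apply: intgrD => //; exact: intgrZ.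
    - apply: ae_imp (conv_moll_cvg l0) => x cx.
      by apply: cvgD; apply: cvgM; [exact: cvg_cst|exact: cvgM|exact: cvg_cst|exact: cvgM].
  by rewrite RID ?RIZ//; [lra|exact: intgrZ].
have tm := @moll_test R n; have tm1 := test_derive1 tm.
have lp0 := L2_lint l0; have lp1 := L2_lint l1.
have D1 : derive1 (conv p0 (moll n)) = conv p1 (moll n).
  by rewrite (has_deriv_derive1 (conv_deriv lp0 tm)) (conv_weak l0 l1 w01 tm).
have J1 := conv_jensen l1 tm (moll_ge0 n) (moll_RI n).
apply: (truncation cw bw (conv_smooth lp0 tm)) => //.
- exact: (J n).1.
- by rewrite D1; exact: J1.1.
- case: w12 => [|[w12 l2]]; [by left|right].
  rewrite derive1nS derive1n1 D1 (has_deriv_derive1 (conv_deriv lp1 tm)) (conv_weak l1 l2 w12 tm).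
  exact: (conv_jensen l2 tm (moll_ge0 n) (moll_RI n)).1.
rewrite D1.
have T2 : e2 * RI (fun x => derive1n 2 (conv p0 (moll n)) x ^+ 2) <= e2 * RI (fun x => p2 x ^+ 2).
  case: w12 => [->|[w12 l2]]; first by rewrite !mul0r.
  rewrite ler_wpM2l// derive1nS derive1n1 D1 (has_deriv_derive1 (conv_deriv lp1 tm)) (conv_weak l1 l2 w12 tm).
  exact: (conv_jensen l2 tm (moll_ge0 n) (moll_RI n)).2.
have T1 : e1 * RI (fun x => conv p1 (moll n) x ^+ 2) <= e1 * RI (fun x => p1 x ^+ 2).
  by rewrite ler_wpM2l//; exact: J1.2.
have T0 : e0 * RI (fun x => conv p0 (moll n) x ^+ 2) <= e0 * RI (fun x => p0 x ^+ 2).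
  by rewrite ler_wpM2l//; exact: (J n).2.
have TK : G * (RI (fun x => w x * p0 x ^+ 2) - eps) <= G * RI (fun x => w x * conv p0 (moll n) x ^+ 2).
  by rewrite ler_pM2l// ltW.
have Ge : G * eps = - E / 2 by rewrite /eps; field; rewrite gt_eqF.
rewrite mulrBr Ge in TK; rewrite /E in TK H; lra.
Qed.
End Truncation.

(** * Exponential decay of a function with all its derivatives *)

Section Decay.
Context {R : realType}.
Notation mu := (@lebesgue_measure R).
Implicit Types (f g h w : R -> R).
(** Reflection, which transports the behaviour at -oo to +oo; written affinely to fit
    [has_deriv_affine]. *)
Definition flip f (x : R) : R := f (-1 * x + 0).
Lemma flip_deriv f f' : has_deriv f f' -> has_deriv (flip f) (fun x => -1 * flip f' x).
Proof. by move=> df; exact: has_deriv_affine. Qed.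
(* A class closed under derivation whose members decay together with [f]. *)
Definition tail_span f (tau r : R) h := exists al be, forall x, r < x -> h x = al * f x + be * expR (- tau * x).
Lemma tail_span_deriv f f1 (tau r k B : R) h h1 : has_deriv f f1 -> has_deriv h h1 ->
  (forall x, r < x -> f1 x = - k * f x + B * expR (- tau * x)) ->
  tail_span f tau r h -> tail_span f tau r h1.
Proof.
move=> df dh H [al [be E]]; exists (- k * al), (al * B - tau * be) => x rx.
have d := has_derivB dh (has_derivD (has_derivZ al df) (has_derivZ be (has_deriv_expR (- tau)))).
have := deriv_ray d (r := r) _ rx => /(_ _)/eqP.
rewrite subr_eq0 => HH; rewrite (eqP (HH _)); first by rewrite H//; ring.
by move=> y ry; rewrite E// subrr.
Qed.
Lemma tail_spanD f tau r g h : tail_span f tau r g -> tail_span f tau r h ->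
  tail_span f tau r (fun x => g x + h x).
Proof.
by move=> [a [b E]] [c [d E']]; exists (a + c), (b + d) => x rx; rewrite E// E'//; ring.
Qed.
Lemma tail_spanZ f tau r (c : R) h : tail_span f tau r h -> tail_span f tau r (fun x => c * h x).
Proof. by move=> [a [b E]]; exists (c * a), (c * b) => x rx; rewrite E//; ring. Qed.
Lemma tail_spanM f tau r (c : R) w h : (forall x, r < x -> w x = c) -> tail_span f tau r h ->
  tail_span f tau r (fun x => w x * h x).
Proof. by move=> wc [a [b E]]; exists (c * a), (c * b) => x rx; rewrite E// wc//; ring. Qed.
Lemma tail_span_bound f (tau r C d : R) h : 0 <= r -> d <= tau ->
  (forall x, r < x -> `|f x| <= C * expR (- d * x)) ->
  tail_span f tau r h -> exists C', forall x, r < x -> `|h x| <= C' * expR (- d * x).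
Proof.
move=> r0 dt H [al [be E]]; exists (`|al| * C + `|be|) => x rx; rewrite E//.
apply: (le_trans (ler_normD _ _)); rewrite mulrDl; apply: lerD.
  by rewrite normrM -mulrA ler_wpM2l// H.
rewrite normrM (ger0_norm (expR_ge0 _)) ler_wpM2l// ler_expR !mulNr lerN2 ler_wpM2r//.
by apply: le_trans r0 _; exact: ltW.
Qed.
Definition decays h := exists C d, 0 < d /\ forall x, `|h x| <= C * expR (- (d * `|x|)).
Lemma decays_intro h (r C1 C2 d1 d2 : R) : continuous h -> 0 <= r -> 0 < d1 -> 0 < d2 ->
  (forall x, r < x -> `|h x| <= C1 * expR (- d1 * x)) ->
  (forall x, r < x -> `|flip h x| <= C2 * expR (- d2 * x)) -> decays h.
Proof.
move=> ch r0 d10 d20 H1 H2.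
pose d := Num.min d1 d2.
have d0 : 0 < d by rewrite lt_min d10.
have dd1 : d <= d1 by rewrite ge_min lexx.
have dd2 : d <= d2 by rewrite ge_min lexx orbT.
have rr : - r <= r by rewrite ge0_cp.
have cn : continuous (fun x => `|h x|).
  by move=> x; apply: (cvg_comp h (@Num.norm R R) (ch x)); exact: norm_continuous.
have [c _ Hc] := EVT_max rr (continuous_subspaceT cn).
(* [expR (d * r)] compensates the exponential on [-r, r], where only the maximum of |h| is
   available. *)
pose C := `|h c| * expR (d * r) + `|C1| + `|C2|.
exists C, d; split => // x.
have e0 := expR_ge0 (- (d * `|x|)).
have t0 : 0 <= `|h c| * expR (d * r) * expR (- (d * `|x|)) by rewrite !mulr_ge0// expR_ge0.
have t1 : 0 <= `|C1| * expR (- (d * `|x|)) by rewrite mulr_ge0.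
have t2 : 0 <= `|C2| * expR (- (d * `|x|)) by rewrite mulr_ge0.
rewrite /C !mulrDl.
have step (D dd y : R) : 0 <= y -> d <= dd -> D * expR (- dd * y) <= `|D| * expR (- (d * y)).
  move=> y0 ddd; apply: (le_trans (ler_norm _)); rewrite normrM (ger0_norm (expR_ge0 _)) ler_wpM2l//.
  by rewrite ler_expR mulNr lerN2 ler_wpM2r.
have [xr|xr] := leP `|x| r.
  have : `|h x| <= `|h c| by apply: Hc; rewrite in_itv /= -ler_norml.
  have : 1 <= expR (d * r) * expR (- (d * `|x|)).
    by rewrite -expRD -expR0 ler_expR subr_ge0 ler_pM2l.
  have := normr_ge0 (h c); rewrite -mulrA in t0 *; nra.
have [x0|x0] := leP 0 x.
  rewrite ger0_norm// in xr t1 t2 t0 *; have := H1 x xr; have := step C1 d1 x x0 dd1; lra.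
rewrite ltr0_norm// in xr t1 t2 t0 *.
have nx0 : 0 <= - x by rewrite oppr_ge0 ltW.
have := H2 (- x) xr; have := step C2 d2 (- x) nx0 dd2.
rewrite /flip (_ : -1 * - x + 0 = x); [lra|ring].
Qed.
Lemma decays_L2 h : continuous h -> decays h -> L2 h.
Proof.
move=> ch [C [d [d0 H]]]; split; first exact: cont_measurable.
have d2 : 0 < d + d by rewrite addr_gt0.
have i := intgrZ (C ^+ 2) (expR_even_intgr d2).
apply: (intgr_le _ i); first by apply: cont_measurable; exact: cont_mul.
move=> x; rewrite ger0_norm ?sqr_ge0// -(real_normK (num_real (h x))).
have -> : C ^+ 2 * expR (- ((d + d) * `|x|)) = (C * expR (- (d * `|x|))) ^+ 2.
  by rewrite exprMn; congr (_ * _); rewrite expr2 -expRD; congr expR; ring.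
by rewrite lerXn2r// nnegrE//; apply: le_trans (H x).
Qed.
Lemma decays_cvgy h : decays h -> h x @[x --> +oo] --> 0.
Proof.
move=> [C [d [d0 H]]]; apply: (exp_decay_cvg d0 (C := C)) => x x0.
by have := H x; rewrite [`|x|]ger0_norm.
Qed.
Lemma decays_cvgNy h : decays h -> h x @[x --> -oo] --> 0.
Proof.
move=> [C [d [d0 H]]]; apply/cvgNy_compNP; apply: (exp_decay_cvg d0 (C := C)) => x x0 /=.
by have := H (- x); rewrite [`|- x|]normrN [`|x|]ger0_norm.
Qed.
Lemma decays_Hinf h : cinf h -> (forall n, decays (derive1n n h)) -> Hinf_with h (fun n => derive1n n h).
Proof.
move=> sh dh k; split => //; split => [j _|j _]; last first.
  by apply: decays_L2 => //; apply: smooth_continuous; exact: smooth_derive1n.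
move=> phi /ctestP tp.
have sj := smooth_derive1n j sh; have cj1 := smooth_continuous (smooth_derive1 sj).
have cj := smooth_continuous sj.
have tp1 := test_derive1 tp; have [sp kp] := tp.
rewrite RI_EFin; last exact: test_intgrM.
rewrite RI_EFin; last exact: test_intgrM.
rewrite -EFinN; congr EFin; apply: RI_parts => //.
- exact: smooth_has_deriv.
- exact: smooth_has_deriv.
- exact: test_continuous.
Qed.
(** Controls both tails at once. The class is stable under differentiation, linear combinations and
    multiplication by functions constant near each infinity, such as the density, so it contains
    every unknown built from [f]. *)
Definition tail_class f (tp tm r : R) h := [/\ cinf h, tail_span f tp r h & tail_span (flip f) tm r (flip h)].
Lemma good_derive1 f (tp tm r k Bp Bm : R) h : cinf f -> (forall x, r < x -> derive1 f x = - k * f x + Bp * expR (- tp * x)) ->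
  (forall x, r < x -> -1 * flip (derive1 f) x = - k * flip f x + Bm * expR (- tm * x)) ->
  tail_class f tp tm r h -> tail_class f tp tm r (derive1 h).
Proof.
move=> sf Hp Hm [sh hp hm]; split; first exact: smooth_derive1.
  exact: tail_span_deriv (smooth_has_deriv sf) (smooth_has_deriv sh) Hp hp.
have := tail_span_deriv (flip_deriv (smooth_has_deriv sf)) (flip_deriv (smooth_has_deriv sh)) Hm hm.
move/(tail_spanZ (-1)); congr tail_span; apply/funext => x; ring.
Qed.
Lemma goodD f tp tm r g h : tail_class f tp tm r g -> tail_class f tp tm r h -> tail_class f tp tm r (fun x => g x + h x).
Proof.
move=> [s1 p1 m1] [s2 p2 m2]; split; [exact: smoothD|exact: tail_spanD|].
by have := tail_spanD m1 m2.
Qed.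
Lemma goodZ f tp tm r (c : R) h : tail_class f tp tm r h -> tail_class f tp tm r (fun x => c * h x).
Proof.
move=> [s1 p1 m1]; split; [exact: smoothZ|exact: tail_spanZ|].
by have := tail_spanZ c m1.
Qed.
Lemma goodM f tp tm r (cp cm : R) w h : cinf w -> (forall x, r < x -> w x = cp) -> (forall x, r < x -> flip w x = cm) ->
  tail_class f tp tm r h -> tail_class f tp tm r (fun x => w x * h x).
Proof.
move=> sw wp wm [s1 p1 m1]; split; [exact: smoothM|exact: (tail_spanM (c := cp))|].
by have := tail_spanM wm m1.
Qed.
End Decay.

(** * Characteristic roots outside the support of rho' *)

Section Solution.
Context {R : realType}.
Variables (rho : R -> R) (k nu G e0 e1 e2 c0 : R).
Hypotheses (k0 : 0 < k) (nu0 : 0 < nu) (G0 : 0 < G) (he0 : 0 <= e0) (he1 : 0 <= e1) (he2 : 0 <= e2).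
Hypotheses (srho : cinf rho) (trho : ctest (derive1 rho)) (c00 : 0 < c0) (rho_ge : forall x, c0 <= rho x).
Hypothesis (he : e2 * k ^+ 4 + e0 = e1 * k ^+ 2).
(** The tail equation is a f'''' - b f'' + c f = 0. The relation [he] says exactly that c = b k^2 -
    a k^4, i.e. that k^2 is a root of a X^2 - b X + c; the other root is tau^2 = c / (a k^2). *)
Lemma tail_data f f1 f2 f3 f4 (rr l r M : R) : 0 < l -> 0 < rr -> 0 <= r ->
  has_deriv f f1 -> has_deriv f1 f2 -> has_deriv f2 f3 -> has_deriv f3 f4 ->
  (forall x, `|f x| <= M) -> (forall x, `|f1 x| <= M) ->
  (forall x, r < x -> el_coef2 nu e2 l * f4 x - (l ^+ 2 * rr + (2 * l * nu * k ^+ 2 + e1)) * f2 x +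
     (l ^+ 2 * k ^+ 2 * rr + (l * nu * k ^+ 4 + e0)) * f x = 0) ->
  exists tau B C d, [/\ 0 < d, d <= tau,
    forall x, r < x -> f1 x = - k * f x + B * expR (- tau * x) &
    forall x, r < x -> `|f x| <= C * expR (- d * x)].
Proof.
move=> l0 rr0 r0 d0 d1 d2 d3 b0 b1 H.
pose a := el_coef2 nu e2 l; pose c := l ^+ 2 * k ^+ 2 * rr + (l * nu * k ^+ 4 + e0).
have a0 : 0 < a by rewrite /a /el_coef2 ltr_pwDl// mulr_gt0.
have k20 : 0 < k ^+ 2 by rewrite exprn_gt0.
have c0' : 0 < c.
  rewrite /c ltr_pwDl//; first by rewrite !mulr_gt0// exprn_gt0.
  by rewrite addr_ge0// !mulr_ge0// ?exprn_ge0// ltW.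
pose t2 := c / (a * k ^+ 2).
have t20 : 0 < t2 by rewrite divr_gt0// mulr_gt0.
pose tau := Num.sqrt t2.
have tau0 : 0 < tau by rewrite sqrtr_gt0.
have tau2 : tau ^+ 2 = t2 by rewrite sqr_sqrtr// ltW.
have an : a != 0 by rewrite gt_eqF.
have kn : k != 0 by rewrite gt_eqF.
have H' x : r < x -> f4 x = (k ^+ 2 + tau ^+ 2) * f2 x - k ^+ 2 * tau ^+ 2 * f x.
  move=> rx; have E := H x rx; rewrite -/a -/c in E.
  apply: (mulfI an); rewrite tau2 /t2.
  have -> : a * f4 x = (l ^+ 2 * rr + (2 * l * nu * k ^+ 2 + e1)) * f2 x - c * f x by lra.
  have -> : l ^+ 2 * rr + (2 * l * nu * k ^+ 2 + e1) = a * k ^+ 2 + c / k ^+ 2.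
    have -> : c = (l ^+ 2 * rr + (2 * l * nu * k ^+ 2 + e1)) * k ^+ 2 - a * k ^+ 4.
      apply/eqP; rewrite -subr_eq0 (_ : _ - _ = e2 * k ^+ 4 + e0 - e1 * k ^+ 2); first by rewrite he subrr.
      by rewrite /c /a /el_coef2; ring.
    by field.
  by field; rewrite an kn.
have [B HB] := tail_first_order k0 tau0 d0 d1 d2 d3 b0 b1 r0 H'.
have [C [d [dp dt HC]]] := tail_decay k0 tau0 d0 b0 r0 HB.
by exists tau, B, C, d; split.
Qed.
End Solution.

(** * The growing mode *)

Section Profile.
Context {R : realType}.
Lemma lipschitz_deriv_bound (f f1 : R -> R) (M : R) : has_deriv f f1 -> continuous f1 ->
  (forall x y, `|f x - f y| <= M * `|x - y|) -> forall x, `|f1 x| <= M.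
Proof.
move=> df c1 H x; rewrite leNgt; apply/negP => Mx.
have cn : continuous (fun y => `|f1 y|).
  by move=> y; apply: (cvg_comp f1 (@Num.norm R R) (c1 y)); exact: norm_continuous.
have : \forall y \near x, M < `|f1 y| by have /cvgr_gt := cn x; apply.
move=> [/= e e0 He].
have e2 : x < x + e / 2 by rewrite ltrDl divr_gt0.
have [c /andP[xc cx] E] := MVTx df e2.
have := H (x + e / 2) x; rewrite E normrM; apply/negP; rewrite -ltNge ltr_pM2r.
  by apply: He => /=; rewrite ltr0_norm; lra.
by rewrite normr_gt0 subr_eq0 gt_eqF.
Qed.
Variables (rho : R -> R) (k nu G e0 e1 e2 c0 : R).
Hypotheses (k0 : 0 < k) (nu0 : 0 < nu) (G0 : 0 < G) (he0 : 0 <= e0) (he1 : 0 <= e1) (he2 : 0 <= e2).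
Hypotheses (srho : cinf rho) (trho : ctest (derive1 rho)) (c00 : 0 < c0) (rho_ge : forall x, c0 <= rho x).
Hypothesis (he : e2 * k ^+ 4 + e0 = e1 * k ^+ 2).
(** The decay class is returned as an abstract predicate [P]: its closure properties are all that is
    needed to place velocity and pressure in H^k for every k, without returning to the tails. *)
Lemma profile f0 : ctest f0 -> formE rho G e0 e1 e2 f0 < 0 ->
  exists (l : R) (psi : R -> R) (P : (R -> R) -> Prop), [/\ 0 < l, P psi, exists x, psi x != 0 &
    forall x, el_coef2 nu e2 l * derive1n 4 psi x - (l ^+ 2 * derive1 rho x * derive1 psi x + el_coef1 rho k nu e1 l x * derive1n 2 psi x)
      + el_coef0 rho k nu G e0 l x * psi x = 0] /\
   [/\ forall h, P h -> [/\ cinf h, decays h & P (derive1 h)],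
    forall g h, P g -> P h -> P (fun x => g x + h x),
    forall c h, P h -> P (fun x => c * h x) & forall h, P h -> P (fun x => rho x * h x)].
Proof.
move=> tf0 Ef0.
have [l [l0 [psi [[M1 b1] [M2 b2] nz EL]]]] :=
  euler_lagrange k0 nu0 G0 he0 he1 he2 srho trho c00 rho_ge tf0 Ef0.
have a0 : el_coef2 nu e2 l != 0 by rewrite gt_eqF// /el_coef2 ltr_pwDl// mulr_gt0.
have [sp ode] := weak_ode a0 (el_coef1_smooth k nu e1 srho l) (el_coef0_smooth k nu G e0 srho l)
  (lipschitz_continuous b2) EL.
have dA1 : derive1 (el_coef1 rho k nu e1 l) = (fun x => l ^+ 2 * derive1 rho x).
  apply: has_deriv_derive1.
  have := has_derivD (has_derivZ (l ^+ 2) (smooth_has_deriv srho)) (has_deriv_cst (2 * l * nu * k ^+ 2 + e1)).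
  by move/has_deriv_eq; apply => x; rewrite addr0.
have {}ode x : el_coef2 nu e2 l * derive1n 4 psi x - (l ^+ 2 * derive1 rho x * derive1 psi x + el_coef1 rho k nu e1 l x * derive1n 2 psi x)
      + el_coef0 rho k nu G e0 l x * psi x = 0 by have := ode x; rewrite dA1.
have d0 := smooth_has_deriv sp; have s1 := smooth_derive1 sp.
have d1 := smooth_has_deriv s1; have s2 := smooth_derive1 s1.
have d2 := smooth_has_deriv s2; have s3 := smooth_derive1 s2.
have d3 := smooth_has_deriv s3.
have b3 := lipschitz_deriv_bound d0 (smooth_continuous s1) b2.
pose M := Num.max M1 M2.
have bM x : `|psi x| <= M by apply: (le_trans (b1 x)); rewrite le_max lexx.
have bM1 x : `|derive1 psi x| <= M by apply: (le_trans (b3 x)); rewrite le_max lexx orbT.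
have [_ [r' kr']] := trho.
pose r := `|r'|; have r0 : 0 <= r by exact: normr_ge0.
have kr x : r < `|x| -> derive1 rho x = 0 by move=> rx; apply: kr'; apply: le_lt_trans rx; exact: ler_norm.
have rr : r < r + 1 by rewrite ltrDl.
have krp x : r < x -> derive1 rho x = 0 by move=> rx; apply: kr; apply: lt_le_trans rx (ler_norm _).
have krm x : r < x -> derive1 rho (-1 * x + 0) = 0.
  by move=> rx; apply: kr; rewrite addr0 mulN1r normrN; apply: lt_le_trans rx (ler_norm _).
(* The density is constant on each side, possibly with different values; the two tails therefore get
   separate rates [tp] and [tm]. *)
have rp x : r < x -> rho x = rho (r + 1).
  by move=> rx; exact: (const_ray (smooth_has_deriv srho) krp rx rr).
have rm x : r < x -> flip rho x = flip rho (r + 1).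
  move=> rx; apply: (const_ray (flip_deriv (smooth_has_deriv srho)) _ rx rr) => y ry.
  by rewrite /flip krm// mulr0.
have pos x : 0 < rho x by apply: lt_le_trans (rho_ge x).
have [tp [Bp [Cp [dp [dp0 dtp Hp1 Hp2]]]]] : exists tau B C d, [/\ 0 < d, d <= tau,
    forall x, r < x -> derive1 psi x = - k * psi x + B * expR (- tau * x) &
    forall x, r < x -> `|psi x| <= C * expR (- d * x)].
  apply: (tail_data k0 nu0 he0 he2 he l0 (pos (r + 1)) r0 d0 d1 d2 d3 bM bM1) => x rx.
  have := ode x; rewrite /el_coef1 /el_coef0 krp// rp// mulr0 mul0r add0r mulr0 subr0.
  by rewrite !derive1nS derive1n0.
have [tm [Bm [Cm [dm [dm0 dtm Hm1 Hm2]]]]] : exists tau B C d, [/\ 0 < d, d <= tau,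
    forall x, r < x -> -1 * flip (derive1 psi) x = - k * flip psi x + B * expR (- tau * x) &
    forall x, r < x -> `|flip psi x| <= C * expR (- d * x)].
  (* Reflection multiplies the j-th derivative by (-1)^j. Only even orders occur in the tail
     equation, which therefore keeps its form at -oo. *)
  have E1 := flip_deriv d0; have E2 := has_derivZ (-1) (flip_deriv d1).
  have E3 := has_derivZ (-1) (has_derivZ (-1) (flip_deriv d2)).
  have E4 := has_derivZ (-1) (has_derivZ (-1) (has_derivZ (-1) (flip_deriv d3))).
  apply: (tail_data k0 nu0 he0 he2 he l0 (pos (-1 * (r + 1) + 0)) r0 E1 E2 E3 E4 (M := M)).
  - by move=> x; exact: bM.
  - by move=> x; rewrite mulN1r normrN; exact: bM1.
  move=> x rx; have := ode (-1 * x + 0); have := rm x rx; rewrite /flip => rmx.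
  rewrite /el_coef1 /el_coef0 krm// rmx mulr0 mul0r add0r mulr0 subr0.
  move=> H; rewrite -[RHS]H !derive1nS derive1n0.
  move: (derive1 (derive1 (derive1 (derive1 psi))) _ : R) (derive1 (derive1 psi) _ : R) => p4 p2.
  by move: (el_coef2 _ _ _) (rho _) => ? ?; ring.
exists l, psi, (tail_class psi tp tm r); split.
  split => //; split => //.
    by exists 1, 0 => x _; rewrite mul1r mul0r addr0.
  by exists 1, 0 => x _; rewrite mul1r mul0r addr0.
split.
- move=> h gh; have [sh hp hm] := gh; split => //; last exact: good_derive1 Hp1 Hm1 gh.
  have [C1 H1] := tail_span_bound r0 dtp Hp2 hp; have [C2 H2] := tail_span_bound r0 dtm Hm2 hm.
  exact: decays_intro (smooth_continuous sh) r0 dp0 dm0 H1 H2.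
- by move=> g h; exact: goodD.
- by move=> c h; exact: goodZ.
- by move=> h; exact: (goodM (cp := rho (r + 1)) (cm := flip rho (r + 1))).
Qed.
End Profile.

(** * From the instability conditions to negative energy, and the momentum identities *)

Section Hypotheses.
Context {R : realType}.
Notation mu := (@lebesgue_measure R).
Implicit Types (g k M xi : R) (rho drho : R -> R).
Lemma lt_esqrt (k : R) (x : \bar R) : 0 <= k -> (k%:E < esqrt x)%E -> ((k ^+ 2)%:E < x)%E.
Proof.
move=> k0; case: x => [s| |] /=; [|by rewrite !ltry|by rewrite ltNge leNye].
rewrite !lte_fin => ks.
have s0 : 0 < s by rewrite -sqrtr_gt0; apply: le_lt_trans ks.
by rewrite -(sqr_sqrtr (ltW s0)) ltrXn2r// ?nnegrE// ltW.
Qed.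
Lemma esqrt_lt (k : R) (x : \bar R) : (esqrt x < k%:E)%E -> (x < (k ^+ 2)%:E)%E.
Proof.
case: x => [s| |] /=; [|by rewrite ltNge leey|by rewrite !ltNyr].
rewrite !lte_fin => sk; have [s0|s0] := leP s 0.
  apply: (le_lt_trans s0); rewrite exprn_even_gt0//= gt_eqF//; apply: le_lt_trans sk; exact: sqrtr_ge0.
by rewrite -(sqr_sqrtr (ltW s0)) ltrXn2r// ?nnegrE ?sqrtr_ge0// ltW//; apply: le_lt_trans sk; exact: sqrtr_ge0.
Qed.
Lemma Int_RI (f : R -> R) : intgr f -> Int f = (RI f)%:E.
Proof. by move=> fi; rewrite /Int RI_EFin. Qed.
Lemma ratio1 (a b c d : R) : 0 < d ->
  ((a%:E * b%:E - c%:E) / d%:E)%E = ((a * b - c) / d)%:E.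
Proof. by move=> d0; rewrite inver gt_eqF// [RHS]EFinM EFinB EFinM. Qed.
Lemma ratio2 (a b d : R) : 0 < d -> (a%:E * b%:E / d%:E)%E = (a * b / d)%:E.
Proof. by move=> d0; rewrite inver gt_eqF// [RHS]EFinM EFinM. Qed.
(* [coef2, coef1, coef0] are the coefficients of |psi''|^2, |psi'|^2, |psi|^2 in |xi|^2
   times the magnetic energy. *)
Definition coef2 (c : field_case) M : R := if c is Vertical then M ^+ 2 else 0.
Definition coef1 (c : field_case) M xi1 xi2 : R :=
  if c is Vertical then M ^+ 2 * normxi xi1 xi2 ^+ 2 else M ^+ 2 * xi1 ^+ 2.
Definition coef0 (c : field_case) M xi1 xi2 : R :=
  if c is Vertical then 0 else M ^+ 2 * xi1 ^+ 2 * normxi xi1 xi2 ^+ 2.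
Lemma normxi_sqr (xi1 xi2 : R) : normxi xi1 xi2 ^+ 2 = xi1 ^+ 2 + xi2 ^+ 2.
Proof. by rewrite sqr_sqrtr// addr_ge0// sqr_ge0. Qed.
(** [S2] and [vc2] are extrema of quotients, so a strict inequality on |xi|^2 is realized by one
    admissible function. Clearing the denominator turns it into negativity of the energy, and
    [weak_negative] supplies the test function. *)
Lemma unstable_test (c : field_case) g M drho xi1 xi2 : 0 < g -> ctest drho -> (exists x0, 0 < drho x0) ->
  in_Ag c g drho M xi1 xi2 ->
  0 < normxi xi1 xi2 /\ exists2 f, ctest f &
   coef2 c M * quad (fun=> 1) 2 f + coef1 c M xi1 xi2 * quad (fun=> 1) 1 f + coef0 c M xi1 xi2 * quad (fun=> 1) 0 f
   - g * normxi xi1 xi2 ^+ 2 * quad drho 0 f < 0.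
Proof.
move=> g0 td [x0 dx0]; have cd := test_continuous td; have [W W0 HW] := test_bounded td.
have k0 : 0 <= normxi xi1 xi2 by exact: sqrtr_ge0.
move: (normxi_sqr xi1 xi2); rewrite /coef1 /coef0; move kE : (normxi xi1 xi2) => k in k0 * => k2.
have M20 : 0 <= M ^+ 2 := sqr_ge0 M.
have kk0 : 0 <= k ^+ 2 := sqr_ge0 k.
case: c; rewrite /in_Ag /coef2 kE.
- move=> [[[h1 [_ h2]]|xi10] hn].
  + have kn : 0 < k.
      by rewrite lt_neqAle k0 andbT; apply/eqP => k00; move: h1; rewrite -k00 invr0 mulr0 ltxx.
    have Mx : M * xi1 != 0 by apply/eqP => E; move: h1; rewrite E normr0 mul0r ltxx.
    split => //.
    have G0 : 0 < g * k ^+ 2 by rewrite mulr_gt0// exprn_gt0.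
    have /ereal_sup_gt[_ [psi [D [[D0 [Hw HL]] [nz ->]]]]] := lt_esqrt k0 h2.
    have L0 : L2 psi by rewrite -D0; exact: HL.
    have L1 : L2 (D 1%N) by exact: HL.
    have w01 : weak_deriv psi (D 1%N) by rewrite -D0; exact: Hw.
    have i0 : intgr (fun x => psi x ^+ 2) := L0.2.
    have i1 : intgr (fun x => D 1%N x ^+ 2) := L1.2.
    have id := L2_intgr_w cd HW L0.
    move: nz; rewrite /nonzeroL2 (Int_RI i0) (Int_RI i1) (Int_RI id) lte_fin => nz.
    rewrite kE ratio1// lte_fin ltr_pdivlMr// => E.
    apply: (weak_negative (W := W) (p2 := fun=> 0) cd HW G0 _ _ _ L0 L1 w01) => //.
    * by apply: mulr_ge0 => //; apply: mulr_ge0 => //; exact: sqr_ge0.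
    * by apply: mulr_ge0 => //; exact: sqr_ge0.
    * by left.
    have m0 : 0 < (M * xi1) ^+ 2 by rewrite exprn_even_gt0.
    move: E; rewrite mul0r add0r; move: (RI _) (RI _) (RI _) => A B C.
    rewrite -(ltr_pM2l m0) => E.
    have E2 : (M * xi1) ^+ 2 * (g * k ^+ 2 / (M * xi1) ^+ 2 * B - A) = g * k ^+ 2 * B - (M * xi1) ^+ 2 * A.
      by field; move: Mx; rewrite mulf_eq0 negb_or => /andP[-> ->].
    by rewrite E2 !exprMn in E; lra.
  (* For xi1 = 0 the horizontal field exerts no force on the mode: all magnetic weights vanish, and
     a bump where rho' > 0 suffices. *)
  + have x2 : xi2 != 0 by apply/eqP => E; exact: hn.
    have kn : 0 < k.
      rewrite -kE /normxi sqrtr_gt0 xi10 expr0n/= add0r exprn_even_gt0//.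
    split => //; rewrite xi10.
    have : \forall y \near x0, 0 < drho y by have /cvgr_gt := cd x0; apply.
    move=> [/= e ep He].
    have en : e^-1 != 0 by rewrite invr_eq0 gt_eqF.
    pose f y := stdbump (e^-1 * y + - (x0 / e)).
    have tf : ctest f by apply: test_affine => //; exact: stdbump_test.
    have cf := test_continuous tf.
    exists f => //; rewrite expr0n/= !mulr0 !mul0r !add0r oppr_lt0 mulr_gt0//.
      by rewrite mulr_gt0// exprn_gt0.
    rewrite quadE /=; apply: (@RI_gt0 _ _ x0).
    * by apply: cont_mul => //; exact: cont_mul.
    * exact: test_intgr_sqr.
    * move=> y; have [ye|ye] := ltP `|x0 - y| e.
        by rewrite mulr_ge0 ?sqr_ge0// ltW//; exact: He.
      rewrite /f stdbump_out ?expr0n ?mulr0//.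
      rewrite (_ : e^-1 * y + _ = - ((x0 - y) / e)); last by ring.
      by rewrite normrN normrM normfV (gtr0_norm ep) ler_pdivlMr// mul1r.
    * rewrite mulr_gt0// exprn_gt0// /f (_ : _ + _ = 0) ?stdbump_gt0//; ring.
- move=> /esqrt_lt/ereal_inf_lt[_ [psi [D [[D0 [Hw HL]] [den ->]]]]].
  have L0 : L2 psi by rewrite -D0; exact: HL.
  have L1 : L2 (D 1%N) by exact: HL.
  have L2' : L2 (D 2%N) by exact: HL.
  have w01 : weak_deriv psi (D 1%N) by rewrite -D0; exact: Hw.
  have w12 : weak_deriv (D 1%N) (D 2%N) by exact: Hw.
  have i1 : intgr (fun x => D 1%N x ^+ 2) := L1.2.
  have i2 : intgr (fun x => D 2%N x ^+ 2) := L2'.2.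
  have id := L2_intgr_w cd HW L0.
  have iden : intgr (fun x => g * drho x * psi x ^+ 2 - M ^+ 2 * D 1%N x ^+ 2).
    apply: intgrB; last exact: intgrZ.
    by apply: (intgr_eq (intgrZ g id)) => x; rewrite mulrA.
  have dE : RI (fun x => g * drho x * psi x ^+ 2 - M ^+ 2 * D 1%N x ^+ 2) =
    g * RI (fun x => drho x * psi x ^+ 2) - M ^+ 2 * RI (fun x => D 1%N x ^+ 2).
    rewrite -RIZ// -RIZ// -RIB; [|exact: intgrZ|exact: intgrZ].
    by apply: RI_ext => x; rewrite mulrA.
  move: den; rewrite (Int_RI iden) (Int_RI i2) lte_fin => den.
  rewrite ratio2// lte_fin ltr_pdivrMr// => E.
  have N0 : 0 <= M ^+ 2 * RI (fun x => D 2%N x ^+ 2).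
    by rewrite mulr_ge0//; apply: RI_ge0 => x; exact: sqr_ge0.
  (* For k = 0 the inequality [E] would make the nonnegative M^2 int psi''^2 strictly negative. *)
  have kn : 0 < k.
    rewrite lt_neqAle k0 andbT; apply/eqP => k00; move: E; rewrite -k00 expr0n/= mul0r.
    by rewrite ltNge N0.
  split => //.
  have G0 : 0 < g * k ^+ 2 by rewrite mulr_gt0// exprn_gt0.
  apply: (weak_negative (W := W) (p2 := D 2%N) cd HW G0 _ _ _ L0 L1 w01) => //.
  + by rewrite mulr_ge0.
  + by right.
  by rewrite dE in E; lra.
Qed.
(** [p1] and [p3] stand for psi' and psi'''. The horizontal velocity is parallel to xi, so one
    identity, at xi1 and at xi2, handles both components. *)
Lemma horizontal_momentum (l nu k e2 xi r0 p1 p3 : R) : k != 0 -> l != 0 ->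
  l ^+ 2 * r0 * (- (xi / k ^+ 2) * p1)
  - l * xi * (- (l / k ^+ 2) * (r0 * p1) + - (el_coef2 nu e2 l / (l * k ^+ 2)) * (k ^+ 2 * p1 + -1 * p3))
  + l * nu * (k ^+ 2 * (- (xi / k ^+ 2) * p1) - (- (xi / k ^+ 2) * p3))
  = e2 * (- (xi / k ^+ 2) * p3 + xi * p1).
Proof. by move=> kn ln; rewrite /el_coef2; field; rewrite kn ln. Qed.
(** With pressure and velocity substituted, the third momentum equation is the Euler-Lagrange
    equation divided by k^2. The suffixes [_h] and [_v] refer to the direction of the field. *)
Lemma vertical_momentum_h (l nu k g M xi r0 r1 p0 p1 p2 p4 : R) : k != 0 -> l != 0 ->
  (l * nu + 0) * p4 - (l ^+ 2 * r1 * p1 + (l ^+ 2 * r0 + (2 * l * nu * k ^+ 2 + M ^+ 2 * xi ^+ 2)) * p2)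
    + (l ^+ 2 * k ^+ 2 * r0 + (l * nu * k ^+ 4 + M ^+ 2 * xi ^+ 2 * k ^+ 2) - g * k ^+ 2 * r1) * p0 = 0 ->
  l ^+ 2 * r0 * p0 + l * (- (l / k ^+ 2) * (r1 * p1 + r0 * p2) +
     - ((l * nu + 0) / (l * k ^+ 2)) * (k ^+ 2 * p2 + -1 * p4))
   + l * nu * (k ^+ 2 * p0 - p2) - g * r1 * p0 = M ^+ 2 * (- (xi ^+ 2 * p0 + xi * (- (xi / k ^+ 2) * p2))).
Proof.
move=> kn ln; set X := (X in X = 0 -> _) => X0; apply/eqP; rewrite -subr_eq0; apply/eqP.
transitivity (X / k ^+ 2); last by rewrite X0 mul0r.
by rewrite /X; field; rewrite kn ln.
Qed.
Lemma vertical_momentum_v (l nu k g M r0 r1 p0 p1 p2 p4 : R) : k != 0 -> l != 0 ->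
  (l * nu + M ^+ 2) * p4 - (l ^+ 2 * r1 * p1 + (l ^+ 2 * r0 + (2 * l * nu * k ^+ 2 + M ^+ 2 * k ^+ 2)) * p2)
    + (l ^+ 2 * k ^+ 2 * r0 + (l * nu * k ^+ 4 + 0) - g * k ^+ 2 * r1) * p0 = 0 ->
  l ^+ 2 * r0 * p0 + l * (- (l / k ^+ 2) * (r1 * p1 + r0 * p2) +
     - ((l * nu + M ^+ 2) / (l * k ^+ 2)) * (k ^+ 2 * p2 + -1 * p4))
   + l * nu * (k ^+ 2 * p0 - p2) - g * r1 * p0 = M ^+ 2 * 0.
Proof.
move=> kn ln; set X := (X in X = 0 -> _) => X0; apply/eqP; rewrite -subr_eq0; apply/eqP.
transitivity (X / k ^+ 2); last by rewrite X0 mul0r.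
by rewrite /X; field; rewrite kn ln.
Qed.
End Hypotheses.

(** * Assembly of the solution from its profile *)

Theorem theorem2p2 (R : realType) (c : field_case) (g visc M : R) (rho : R -> R)
    (xi1 xi2 : R) :
  0 < g -> 0 < visc ->
  (* rho-bar in L^infty(R) *)
  (exists C : R, forall x, `|rho x| <= C) ->
  (* rho-bar' exists and belongs to C_0^infty(R) *)
  (forall x, derivable rho x 1) -> test_fun (derive1 rho) ->
  (* inf rho-bar > 0 *)
  (exists c0 : R, 0 < c0 /\ forall x, c0 <= rho x) ->
  (exists x0 : R, 0 < derive1 rho x0) ->
  case_hyp c g (derive1 rho) M ->
  in_Ag c g (derive1 rho) M xi1 xi2 ->
  exists lam : R, 0 < lam /\
  exists (phi theta psi pi : R -> R) (Dphi Dtheta Dpsi Dpi : nat -> R -> R),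
    [/\ Hinf_with phi Dphi, Hinf_with theta Dtheta, Hinf_with psi Dpsi
      & Hinf_with pi Dpi] /\
    {ae @lebesgue_measure R, forall x,
      let n2 := xi1 ^+ 2 + xi2 ^+ 2 in
      [/\ lam ^+ 2 * rho x * phi x - lam * xi1 * pi x
            + lam * visc * (n2 * phi x - Dphi 2%N x)
            = M ^+ 2 * B1 c xi1 xi2 Dphi Dtheta Dpsi x,
          lam ^+ 2 * rho x * theta x - lam * xi2 * pi x
            + lam * visc * (n2 * theta x - Dtheta 2%N x)
            = M ^+ 2 * B2 c xi1 xi2 Dphi Dtheta Dpsi x,
          lam ^+ 2 * rho x * psi x + lam * Dpi 1%N x
            + lam * visc * (n2 * psi x - Dpsi 2%N x)
            - g * derive1 rho x * psi x
            = M ^+ 2 * B3 c xi1 xi2 Dphi Dtheta Dpsi x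
        & xi1 * phi x + xi2 * theta x + Dpsi 1%N x = 0]} /\
    [/\ phi x @[x --> +oo] --> 0, theta x @[x --> +oo] --> 0
       & psi x @[x --> +oo] --> 0] /\
    [/\ phi x @[x --> -oo] --> 0, theta x @[x --> -oo] --> 0
       & psi x @[x --> -oo] --> 0] /\
    in_calA rho xi1 xi2 psi Dpsi.
Proof.
move=> g0 visc0 [C HC] drho trho0 [c0 [c00 rho_ge]] rpos _ Ag.
have trho := (ctestP _).1 trho0.
have srho : cinf rho by apply/smoothP; exists (derive1 rho); [exact: has_derivP|case: trho].
have [k0 [f0 tf0 Ef0]] := unstable_test g0 trho rpos Ag.
pose k := normxi xi1 xi2.
have k2 : k ^+ 2 = xi1 ^+ 2 + xi2 ^+ 2 := normxi_sqr xi1 xi2.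
rewrite -/k in k0 Ef0.
have M20 : 0 <= M ^+ 2 := sqr_ge0 M.
have x20 : 0 <= xi1 ^+ 2 := sqr_ge0 xi1.
have kk0 : 0 < k ^+ 2 by rewrite exprn_gt0.
have G0 : 0 < g * k ^+ 2 by rewrite mulr_gt0.
have he0 : 0 <= coef0 c M xi1 xi2.
  rewrite /coef0; case: (c) => //; rewrite -/k.
  by apply: mulr_ge0; [exact: mulr_ge0|exact: ltW].
have he1 : 0 <= coef1 c M xi1 xi2.
  rewrite /coef1; case: (c); rewrite -/k; first exact: mulr_ge0.
  by apply: mulr_ge0 => //; exact: ltW.
have he2 : 0 <= coef2 c M by rewrite /coef2; case: (c).
have he : coef2 c M * k ^+ 4 + coef0 c M xi1 xi2 = coef1 c M xi1 xi2 * k ^+ 2.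
  by rewrite /coef2 /coef1 /coef0 -/k; case: (c); ring.
have [l [psi0 [P [[l0 Ppsi0 nz ode0] [Pd PD PZ Prho]]]]] :=
  profile k0 visc0 G0 he0 he1 he2 srho trho c00 rho_ge he tf0 Ef0.
have PdI h : P h -> P (derive1 h) by case/Pd.
have Pc h : P h -> cinf h by case/Pd.
have PL h : P h -> L2 h by move=> /Pd[sh dh _]; apply: decays_L2 => //; exact: smooth_continuous.
have Pn n h : P h -> P (derive1n n h) by move=> Ph; elim: n => // n IH; exact: PdI.
have HH h : P h -> Hinf_with h (fun n => derive1n n h).
  by move=> Ph; apply: decays_Hinf; [exact: Pc|move=> n; case: (Pd _ (Pn n _ Ph))].
have crho := smooth_continuous srho.
have cpsi0 := smooth_continuous (Pc _ Ppsi0).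
have cpsi01 := smooth_continuous (Pc _ (PdI _ Ppsi0)).
pose q (f : R -> R) x := rho x * (k ^+ 2 * f x ^+ 2 + derive1 f x ^+ 2).
have iq f : P f -> intgr (q f).
  move=> Pf; have i0 := L2_intgr_w crho HC (PL _ Pf); have i1 := L2_intgr_w crho HC (PL _ (PdI _ Pf)).
  by apply: (intgr_eq (intgrD (intgrZ (k ^+ 2) i0) i1)) => x; rewrite /q; ring.
have rho0 x : 0 < rho x by apply: lt_le_trans (rho_ge x).
have I0 : 0 < RI (q psi0).
  have [x nx] := nz; apply: (@RI_gt0 _ _ x).
  - by apply: cont_mul => //; apply: cont_add; [apply: cont_scale; exact: cont_mul|exact: cont_mul].
  - exact: iq.
  - move=> y; apply: mulr_ge0; first exact: ltW.
    by apply: addr_ge0; [apply: mulr_ge0|]; exact: sqr_ge0.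
  - apply: mulr_gt0 => //; rewrite ltr_pwDl ?sqr_ge0// mulr_gt0//.
    by rewrite exprn_even_gt0.
(* J is homogeneous of degree two, so this factor normalizes it to 1. *)
pose s := (Num.sqrt (RI (q psi0)))^-1.
pose psi x := s * psi0 x.
have Ppsi : P psi by exact: PZ.
have dpsi n : derive1n n psi = fun x => s * derive1n n psi0 x by apply: derive1nZ; exact: Pc.
have dpsi1 : derive1 psi = fun x => s * derive1 psi0 x := dpsi 1%N.
have Iq : RI (q psi) = 1.
  rewrite (RI_ext (g := fun x => s ^+ 2 * q psi0 x)).
    by rewrite RIZ ?iq// /s exprVn sqr_sqrtr ?ltW// mulVf// gt_eqF.
  by move=> x; rewrite /q dpsi1 /psi; move: (derive1 psi0 x : R) => ?; ring.
pose a := el_coef2 visc (coef2 c M) l.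
have ode x : a * derive1n 4 psi x - (l ^+ 2 * derive1 rho x * derive1 psi x +
    el_coef1 rho k visc (coef1 c M xi1 xi2) l x * derive1n 2 psi x)
    + el_coef0 rho k visc (g * k ^+ 2) (coef0 c M xi1 xi2) l x * psi x = 0.
  rewrite -[RHS](mulr0 s) -(ode0 x) dpsi1 !dpsi /psi -/a.
  move: (derive1n 4 psi0 x : R) (derive1n 2 psi0 x : R) (derive1 psi0 x : R) (derive1 rho x : R) => *.
  by move: (el_coef1 _ _ _ _ _ _) (el_coef0 _ _ _ _ _ _ _) => *; ring.
have P1 := PdI _ Ppsi; have P3 := Pn 3%N _ Ppsi.
pose phi x := - (xi1 / k ^+ 2) * derive1 psi x.
pose theta x := - (xi2 / k ^+ 2) * derive1 psi x.
pose w x := k ^+ 2 * derive1 psi x + -1 * derive1n 3 psi x.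
(* In the horizontal momentum the viscous term and, for a vertical field, the magnetic term are both
   multiples of [w]; the coefficient [a] collects the two. *)
pose pr x := - (l / k ^+ 2) * (rho x * derive1 psi x) + - (a / (l * k ^+ 2)) * w x.
have Pphi : P phi by exact: PZ.
have Ptheta : P theta by exact: PZ.
have Pw : P w by apply: PD; exact: PZ.
have Ppr : P pr by apply: PD; [apply: PZ; exact: Prho|exact: PZ].
have dphi n : derive1n n phi = fun x => - (xi1 / k ^+ 2) * derive1n n.+1 psi x.
  by rewrite derive1nZ ?derive1Sn//; exact: Pc.
have dtheta n : derive1n n theta = fun x => - (xi2 / k ^+ 2) * derive1n n.+1 psi x.
  by rewrite derive1nZ ?derive1Sn//; exact: Pc.
have dpr : derive1n 1 pr = fun x => - (l / k ^+ 2) * (derive1 rho x * derive1n 1 psi x + rho x * derive1n 2 psi x)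
    + - (a / (l * k ^+ 2)) * (k ^+ 2 * derive1n 2 psi x + -1 * derive1n 4 psi x).
  have d1 : has_deriv (derive1n 1 psi) (derive1n 2 psi) by apply: smooth_has_deriv; exact: Pc.
  have d3 : has_deriv (derive1n 3 psi) (derive1n 4 psi) by apply: smooth_has_deriv; exact: Pc.
  have H1 := has_derivZ (- (l / k ^+ 2)) (has_derivM (smooth_has_deriv srho) d1).
  have H2 := has_derivZ (- (a / (l * k ^+ 2))) (has_derivD (has_derivZ (k ^+ 2) d1) (has_derivZ (-1) d3)).
  exact: has_deriv_derive1 (has_derivD H1 H2).
have kn : k != 0 by rewrite gt_eqF.
have ln : l != 0 by rewrite gt_eqF.
exists l; split => //.
exists phi, theta, psi, pr, (fun n => derive1n n phi), (fun n => derive1n n theta),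
  (fun n => derive1n n psi), (fun n => derive1n n pr).
have dec h : P h -> decays h by case/Pd.
split; first by split; exact: HH.
split; last first.
  split; first by split; apply: decays_cvgy; exact: dec.
  split; first by split; apply: decays_cvgNy; exact: dec.
  split; first exact: HH.
  by rewrite -Iq; apply: Int_RI; exact: iq.
apply: aeW => x; rewrite -k2; split; cbv beta.
- have := @horizontal_momentum R l visc k (coef2 c M) xi1 (rho x) (derive1n 1 psi x) (derive1n 3 psi x) kn ln.
  rewrite dphi /pr /w /phi -/a => ->.
  rewrite /B1 /coef2; case: (c); cbv beta iota; first by rewrite mul0r mulr0.
  by rewrite dphi.
- have := @horizontal_momentum R l visc k (coef2 c M) xi2 (rho x) (derive1n 1 psi x) (derive1n 3 psi x) kn ln.
  rewrite dtheta /pr /w /theta -/a => ->.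
  rewrite /B2 /coef2; case: (c); cbv beta iota; last by rewrite dtheta.
  rewrite mul0r derive1n0 derive1n0 /phi /theta; move: (derive1 psi x : R) => ?.
  (* For a horizontal field the second magnetic component vanishes because (phi, theta) is parallel
     to (xi1, xi2). *)
  by rewrite (_ : xi1 * xi2 * _ - _ = 0) ?mulr0//; ring.
- rewrite dpr; have := ode x; rewrite /a /el_coef2 /el_coef1 /el_coef0 /B3 /coef2 /coef1 /coef0 -/k.
  case: (c); cbv beta iota; last by apply: vertical_momentum_v.
  by rewrite dphi; apply: vertical_momentum_h.
- rewrite /phi /theta derive1nS derive1n0; move: (derive1 psi x : R) => p.
  rewrite (_ : _ + _ = (1 - (xi1 ^+ 2 + xi2 ^+ 2) / k ^+ 2) * p); last by field.
  by rewrite -k2 divff ?subrr ?mul0r// expf_neq0.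
Qed.
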